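(* ${\rm NE}\not\subseteq {\rm NP}_{\rm T}({\rm NP}\cap \mathrm{NEXPD})$.
   Context: ${\rm NE}=\bigcup_{c\ge 1}\mathrm{NTIME}(2^{cn})$. All languages are over $\Sigma=\{0,1\}$; for a language $A$, $A^{\le n}$ is the set of strings in $A$ of length at most $n$. A function $d:\mathbb{N}\to\mathbb{N}$ is nonexponential if for every constant $c>0$, $d(n)<2^{n^c}$ for infinitely many integers $n$. $\mathrm{NEXPD}$ is the class of languages $A$ whose density function $d_A(n)=|A^{\le n}|$ is nonexponential. For a class $C$ of languages, ${\rm NP}_{\rm T}(C)$ is the class of languages reducible to some language in $C$ via polynomial-time nondeterministic Turing reductions. *)

(* Defs.v *)
From HB Require Import structures.
From mathcomp Require Import all_boot all_order all_algebra finmap.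
From mathcomp Require Import boolp classical_sets cardinality reals exp.

Set Implicit Arguments.
Unset Strict Implicit.
Unset Printing Implicit Defensive.

Import Order.TTheory GRing.Theory Num.Theory.
Local Open Scope classical_set_scope.

Definition word := seq bool.
Definition language := set word.

Definition upto (A : language) (n : nat) : language :=
  A `&` [set w | size w <= n].

(* Since [fset_set] is a default value on infinite sets, this is what makes
   [density] below a genuine count. *)
Lemma finite_upto (A : language) (n : nat) : finite_set (upto A n).
Proof.
pose s := flatten [seq [seq val t | t <- enum {: k.-tuple bool}] | k <- iota 0 n.+1].
apply: (@sub_finite_set _ _ [set` s]); last exact: finite_seq.
move=> w [_ /= wn]; apply/flatten_mapP; exists (size w).
  by rewrite mem_iota add0n ltnS.
by apply/mapP; exists (in_tuple w); rewrite ?mem_enum.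
Qed.

Definition density (A : language) (n : nat) : nat := #|` fset_set (upto A n)|.

Definition nonexponential (R : realType) (d : nat -> nat) : Prop :=
  forall c : R, (0 < c)%R ->
    infinite_set [set n : nat | ((d n)%:R < 2 `^ (n%:R `^ c) :> R)%R].

Definition NEXPD (R : realType) : set language :=
  [set A | nonexponential R (density A)].

Inductive direction := Left | Stay | Right.

Definition direction_code (m : direction) : 'I_3 :=
  match m with Left => inord 0 | Stay => inord 1 | Right => inord 2 end.
Definition direction_decode (i : 'I_3) : direction :=
  match val i with 0 => Left | 1 => Stay | _ => Right end.
Lemma direction_codeK : cancel direction_code direction_decode.
Proof. by case; rewrite /direction_decode /= inordK. Qed.
HB.instance Definition _ := Finite.copy direction (can_type direction_codeK).

(* Tape symbols over auxiliary symbols [S]: [None] is the blank, [Some (inl b)]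
   the input symbol [b], [Some (inr a)] the auxiliary symbol [a]. *)
Notation symbol S := (option (bool + S)%type).

Section Tapes.
Variable S : Type.

(* A two-way infinite tape: [(l, r)] has [rev l ++ r] surrounded by blanks, and
   the head scans the first symbol of [r] (a blank if [r] is empty). *)
Definition tape := (seq (symbol S) * seq (symbol S))%type.

Definition scanned (t : tape) : symbol S := head None t.2.

Definition write_move (t : tape) (a : symbol S) (m : direction) : tape :=
  let: (l, r) := t in
  match m with
  | Left => (behead l, head None l :: a :: behead r)
  | Stay => (l, a :: behead r)
  | Right => (a :: l, behead r)
  end.

Definition blank_tape : tape := ([::], [::]).

Definition word_tape (w : word) : tape := ([::], [seq Some (inl b) | b <- w]).

Fixpoint bit_prefix (s : seq (symbol S)) : word :=
  if s is Some (inl b) :: s' then b :: bit_prefix s' else [::].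

(* The longest word over {0,1} starting at the scanned cell and extending to
   the right, the same convention as for the input. *)
Definition tape_word (t : tape) : word := bit_prefix t.2.

End Tapes.

(* Nondeterministic Turing machine with [(work_tapes M).+1] tapes, tape [ord0]
   holding the input.  A set of actions is available for each state and tuple of
   scanned symbols; if it is empty, the machine halts. *)
Record ntm := NTM {
  state : finType;
  aux : finType;
  work_tapes : nat;
  start : state;
  accept : {set state};
  delta : state -> {ffun 'I_work_tapes.+1 -> symbol aux} ->
    {set state * {ffun 'I_work_tapes.+1 -> symbol aux * direction}}
}.

Section Machine.
Variable M : ntm.

Definition config :=
  (state M * {ffun 'I_(work_tapes M).+1 -> tape (aux M)})%type.

Definition init (x : word) : config :=
  (start M, [ffun i => if i == ord0 then word_tape (aux M) x
                       else blank_tape (aux M)]).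

Definition step (c c' : config) : Prop :=
  exists2 act, act \in delta c.1 [ffun i => scanned (c.2 i)] &
    c' = (act.1, [ffun i => write_move (c.2 i) (act.2 i).1 (act.2 i).2]).

(* [R] is the one-step relation, so that the definitions below also serve for
   oracle computations. *)
Fixpoint nsteps (R : config -> config -> Prop) (n : nat) (c c' : config) : Prop :=
  if n is n'.+1 then exists2 d, R c d & nsteps R n' d c' else c = c'.

Definition accepted (R : config -> config -> Prop) : language :=
  [set x | exists n c, nsteps R n (init x) c /\ c.1 \in accept M].

(* Every computation path, accepting or not, respects the bound. *)
Definition time_bounded (R : config -> config -> Prop) (f : nat -> nat) : Prop :=
  forall x n c, nsteps R n (init x) c -> n <= f (size x).

End Machine.

Definition bigO (f t : nat -> nat) : Prop :=
  exists C N, forall n, N <= n -> f n <= C * t n.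

Definition NTIME (t : nat -> nat) : set language :=
  [set A | exists (M : ntm) (f : nat -> nat),
     [/\ bigO f t, time_bounded (@step M) f & accepted (@step M) = A]].

Definition NP : set language := \bigcup_k NTIME (fun n => n ^ k).

Definition NE : set language :=
  \bigcup_(c in [set c | 1 <= c]) NTIME (fun n => 2 ^ (c * n)).

Record oracle_ntm := OracleNTM {
  machine :> ntm;
  oracle_tape : 'I_(work_tapes machine).+1;
  query : state machine;
  yes : state machine;
  no : state machine
}.

(* In the query state the machine asks, in one step and leaving its tapes
   unchanged, whether the word on the oracle tape belongs to [B]. *)
Definition oracle_step (M : oracle_ntm) (B : language) (c c' : config M) : Prop :=
  if c.1 == query M then
    let w := tape_word (c.2 (oracle_tape M)) in
    (B w /\ c' = (yes M, c.2)) \/ (~ B w /\ c' = (no M, c.2))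
  else step c c'.

(* The running time bound is uniform in the oracle. *)
Definition polynomial_time (M : oracle_ntm) : Prop :=
  exists (k : nat) (f : nat -> nat), bigO f (fun n => n ^ k) /\
    forall B : language, time_bounded (@oracle_step M B) f.

Definition NP_T_reducible (A B : language) : Prop :=
  exists M : oracle_ntm, polynomial_time M /\ accepted (@oracle_step M B) = A.

Definition NP_T (C : set language) : set language :=
  [set A | exists2 B, C B & NP_T_reducible A B].

(* Main.v *)
(* Diagonalization through padding.  Let [V] be the language of a universal machine running, for
   exponential time, a logic program read from its input; [V] is in NE, so by assumption it is
   decided by a polynomial-time nondeterministic machine [N] with an oracle [A], where [A] is in
   NP, by a machine [M], and of nonexponential density.  Let [x] be an input coding the following
   program:
   - on [x], guess [J] and accept if [N] accepts [x 0^J];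
   - on [x 0^J] with [J > 0], accept if [N] rejects [x].
   In both cases oracle answers have to be certified.  On [x 0^J] there is time to search all the
   paths of [N] and [M], as [J] is a large polynomial in [n = |x|].  On [x] a positive answer is
   certified by a path of [M], and a negative one by a list of all other words of [A] up to the
   length of the queries: the number of these words, which is a constant of the program, is less
   than [2^(n/2)] for a suitable [n], as [A] has nonexponential density.  Hence [x] in [V] implies
   that some [x 0^J] is in [V], thus [x] not in [V]; so [x] is not in [V], therefore [x 0^J] is in
   [V] for the large [J], and [x] is in [V]: a contradiction. *)

Require Import Defs.
From HB Require Import structures.
From mathcomp Require Import all_boot all_order all_algebra.
From mathcomp Require Import boolp classical_sets cardinality reals exp zify ring.
From mathcomp Require finmap.

Set Implicit Arguments.
Unset Strict Implicit.
Unset Printing Implicit Defensive.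

(** * Tapes without trailing blanks *)

(* On infinite streams, tapes differing by blanks at the ends are equal. *)
Section Streams.
Variable S : Type.
Implicit Types (a c : symbol S) (l r : seq (symbol S)).

(** Self-reference comes from the input format: the universal machine takes its whole input both as
    the program and as the initial goal, so a program sees its own code. Padding must leave the
    program unchanged, hence a code closed by a long block of ones, and must be recognizable, hence
    an [x] ending in 1. The choice of constants looks circular: the program contains [kap] and
    [bet], which depend on [n], and yet has to be coded in fewer than [n] bits. The way out is a
    program size linear in [1 + size kap + size bet], with a coefficient fixed by [M] and [N] alone,
    while [size kap] is logarithmic in [n] and [size bet] is at most [n / K] for a [K] prescribed in
    advance. On the short word the number of rule applications is [2 ^ size bet] times a polynomial.
    As [size bet] is at most [n / 2], a factor [2 ^ (n / 2)] of the clock is left for the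
    polynomial. Soundness of the program is independent of time; only completeness counts steps, and
    there a bound on the size of every goal is carried along with the number of rule applications,
    since a step of the program costs a scan of the goal. *)

Definition stream_tape := ((nat -> symbol S) * (nat -> symbol S))%type.

Definition scons a (f : nat -> symbol S) n := if n is n'.+1 then f n' else a.

Definition tp l r : stream_tape := (nth None l, nth None r).

Definition shead (t : stream_tape) : symbol S := t.2 0.

Definition swrite (t : stream_tape) a (m : direction) : stream_tape :=
  match m with
  | Left => ((fun n => t.1 n.+1), scons (t.1 0) (scons a (fun n => t.2 n.+1)))
  | Stay => (t.1, scons a (fun n => t.2 n.+1))
  | Right => (scons a t.1, (fun n => t.2 n.+1))
  end.

Lemma nth_strm_behead r : (fun n => nth None r n.+1) = nth None (behead r).
Proof. by apply/funext => n; rewrite nth_behead. Qed.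

Lemma nth_strm_cons a r : scons a (nth None r) = nth None (a :: r).
Proof. by apply/funext => -[|n]. Qed.

Lemma nth_strm0 r : nth None r 0 = head None r.
Proof. by rewrite nth0. Qed.

Lemma nth_strm_rcons r : nth None (rcons r None) = nth None r.
Proof.
apply/funext => n; rewrite nth_rcons; case: ltnP => // h.
by rewrite (nth_default _ h); case: eqP.
Qed.

(** The bridge from the list tapes of the model: from here on runs are studied on streams, where
    tapes that agree up to outer blanks can be rewritten into each other. *)
Lemma tp_write_move (t : tape S) a m :
  tp (write_move t a m).1 (write_move t a m).2 = swrite (tp t.1 t.2) a m.
Proof.
by case: t m => l r []; rewrite /tp /= ?nth_strm_behead ?nth_strm_cons ?nth_strm0.
Qed.

Lemma swriteE l r a m : swrite (tp l r) a m =
  match m with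
  | Left => tp (behead l) (head None l :: a :: behead r)
  | Stay => tp l (a :: behead r)
  | Right => tp (a :: l) (behead r)
  end.
Proof. by rewrite -(tp_write_move (l, r)) /=; case: m. Qed.

(** Every action acts on all tapes; this is how a tape is left alone. *)
Lemma swrite_noop t : swrite t (shead t) Stay = t.
Proof. by case: t => f g; congr pair; apply/funext => -[|n]. Qed.

Lemma tp_rcons_r l r : tp l (rcons r None) = tp l r.
Proof. by rewrite /tp nth_strm_rcons. Qed.

Lemma tp_rcons_l l r : tp (rcons l None) r = tp l r.
Proof. by rewrite /tp nth_strm_rcons. Qed.

Lemma tp_r0 l : tp l [:: None] = tp l [::].
Proof. exact: (tp_rcons_r l [::]). Qed.

Lemma tp_l0 r : tp [:: None] r = tp [::] r.
Proof. exact: (tp_rcons_l [::] r). Qed.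

Lemma shead_tp l r : shead (tp l r) = head None r.
Proof. exact: nth_strm0. Qed.

Lemma shead_scanned (t : tape S) : scanned t = shead (tp t.1 t.2).
Proof. by rewrite shead_tp. Qed.

End Streams.

Arguments shead : simpl never.
Arguments tp : simpl never.
Arguments swrite : simpl never.

(** * A nondeterministic stack machine *)

(* [Mid^n Fin false] and [Mid^n Fin true] are the codes of soft and hard letters, [Bar]
   separates the goals on the stack. *)
Inductive chr := Dig of bool | Mid | Fin of bool | Bar.

Definition chr_code (c : chr) : bool + (bool + bool) :=
  match c with
  | Dig b => inl b | Fin b => inr (inl b)
  | Mid => inr (inr true) | Bar => inr (inr false)
  end.
Definition chr_decode (c : bool + (bool + bool)) : chr :=
  match c with
  | inl b => Dig b | inr (inl b) => Fin b
  | inr (inr true) => Mid | inr (inr false) => Bar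
  end.
Lemma chr_codeK : cancel chr_code chr_decode. Proof. by case. Qed.
HB.instance Definition _ := Finite.copy chr (can_type chr_codeK).

Inductive instr :=
  Match of chr | Emit of chr | Copy | Drop | Bits | Guess | Sep | End.

Definition instr_code (i : instr) : chr + chr + 'I_6 :=
  match i with
  | Match c => inl (inl c) | Emit c => inl (inr c)
  | Copy => inr (inord 0) | Drop => inr (inord 1) | Bits => inr (inord 2)
  | Guess => inr (inord 3) | Sep => inr (inord 4) | End => inr (inord 5)
  end.
Definition instr_decode (x : chr + chr + 'I_6) : instr :=
  match x with
  | inl (inl c) => Match c | inl (inr c) => Emit c
  | inr i => nth End [:: Copy; Drop; Bits; Guess; Sep; End] i
  end.
Lemma instr_codeK : cancel instr_code instr_decode.
Proof. by case => //=; rewrite inordK. Qed.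
HB.instance Definition _ := Finite.copy instr (can_type instr_codeK).

Inductive cstate := Rew | Pop | Choose | Skip | Exec | InCopy | InDrop | RewG
  | Clr | Acc.

Definition cstates := [:: Rew; Pop; Choose; Skip; Exec; InCopy; InDrop; RewG; Clr; Acc].
Definition cstate_code (s : cstate) : 'I_10 :=
  inord match s with
  | Rew => 0 | Pop => 1 | Choose => 2 | Skip => 3 | Exec => 4 | InCopy => 5
  | InDrop => 6 | RewG => 7 | Clr => 8 | Acc => 9
  end.
Definition cstate_decode (i : 'I_10) : cstate := nth Acc cstates i.
Lemma cstate_codeK : cancel cstate_code cstate_decode.
Proof. by case; rewrite /cstate_decode inordK. Qed.
HB.instance Definition _ := Finite.copy cstate (can_type cstate_codeK).

Definition uaux := (chr + instr)%type.
Definition usym := symbol uaux.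
Definition ch (c : chr) : usym := Some (inr (inl c)).
Definition tk (i : instr) : usym := Some (inr (inr i)).

Definition action := (usym * direction)%type.

Definition core_action := (cstate * action * action * action)%type.

(* Tape [p] holds the program, [k] the stack of goals (topmost on the right), [g] the current
   goal.  [Pop] moves the top of the stack to [g] ([Acc] if there is none), [Choose] and
   [Skip] guess a rule, and [Exec] runs it: up to the first [Sep] its instructions check the
   goal, and each of the following groups pushes one premise. *)
Definition core (s : cstate) (p k g : usym) : seq core_action :=
  let: np := (p, Stay) in let: nk := (k, Stay) in let: ng := (g, Stay) in
  match s with
  | Rew => if p is None then [:: (Pop, (None, Right), (k, Left), ng)]
           else [:: (Rew, (p, Left), nk, ng)]
  | Pop => match k with
           | None => [:: (Acc, np, nk, ng)]
           | Some (inr (inl Bar)) =>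
               [:: (Choose, np, (None, Stay), (g, Right))]
           | Some (inr (inl _)) => [:: (Pop, np, (None, Left), (k, Left))]
           | _ => [::]
           end
  | Choose => [:: (Exec, np, nk, ng); (Skip, np, nk, ng)]
  | Skip => match p with
            | Some (inr (inr End)) => [:: (Choose, (p, Right), nk, ng)]
            | Some (inr (inr _)) => [:: (Skip, (p, Right), nk, ng)]
            | _ => [::]
            end
  | Exec =>
    let: stop := (Exec, (p, Right), nk, ng) in
    match p with
    | Some (inr (inr i)) =>
      match i with
      | Match c =>
          if g == ch c then [:: (Exec, (p, Right), nk, (g, Right))] else [::]
      | Emit c => [:: (Exec, (p, Right), (ch c, Right), ng)]
      | Copy => stop ::
          match g with
          | Some (inr (inl (Dig _ | Fin false))) =>
              [:: (Exec, np, (g, Right), (g, Right))]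
          | Some (inr (inl Mid)) => [:: (InCopy, np, (g, Right), (g, Right))]
          | _ => [::]
          end
      | Drop => stop ::
          match g with
          | Some (inr (inl (Dig _ | Fin false))) =>
              [:: (Exec, np, nk, (g, Right))]
          | Some (inr (inl Mid)) => [:: (InDrop, np, nk, (g, Right))]
          | _ => [::]
          end
      | Bits => stop ::
          match g with
          | Some (inr (inl (Dig _))) => [:: (Exec, np, (g, Right), (g, Right))]
          | _ => [::]
          end
      | Guess => [:: stop; (Exec, np, (ch (Dig false), Right), ng);
                     (Exec, np, (ch (Dig true), Right), ng)]
      | Sep => [:: (RewG, (p, Right), nk, (g, Left))]
      | End => [:: (Clr, np, nk, ng)]
      end
    | _ => [::]
    end
  | InCopy => match g with
              | Some (inr (inl Mid)) =>
                  [:: (InCopy, np, (g, Right), (g, Right))]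
              | Some (inr (inl (Fin false))) =>
                  [:: (Exec, np, (g, Right), (g, Right))]
              | _ => [::]
              end
  | InDrop => match g with
              | Some (inr (inl Mid)) => [:: (InDrop, np, nk, (g, Right))]
              | Some (inr (inl (Fin false))) => [:: (Exec, np, nk, (g, Right))]
              | _ => [::]
              end
  | RewG => if g is None then [:: (Exec, np, nk, (None, Right))]
            else [:: (RewG, np, nk, (g, Left))]
  | Clr => if g is None then [:: (Rew, np, nk, ng)]
           else [:: (Clr, np, nk, (None, Right))]
  | Acc => [::]
  end.

Notation utape := (stream_tape uaux).

(** [n] is the exact number of steps, so that it can be compared with the ticks of an independent
    clock. *)
Fixpoint cacc n (s : cstate) (p k g : utape) : Prop :=
  if n is n'.+1 then
    exists2 a, a \in core s (shead p) (shead k) (shead g) &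
      cacc n' a.1.1.1 (swrite p a.1.1.2.1 a.1.1.2.2)
        (swrite k a.1.2.1 a.1.2.2) (swrite g a.2.1 a.2.2)
  else s = Acc.

(* [Copy] and [Drop] stop at hard letters only, so that hard letters delimit fields of
   arbitrary length. *)
Inductive letter := Bit of bool | Soft of nat | Hard of nat.

Definition letter_code (a : letter) : bool + (nat + nat) :=
  match a with Bit b => inl b | Soft n => inr (inl n) | Hard n => inr (inr n) end.
Definition letter_decode (a : bool + (nat + nat)) : letter :=
  match a with inl b => Bit b | inr (inl n) => Soft n | inr (inr n) => Hard n end.
Lemma letter_codeK : cancel letter_code letter_decode. Proof. by case. Qed.
HB.instance Definition _ := Countable.copy letter (can_type letter_codeK).

Definition enc1 (a : letter) : seq chr :=
  match a with
  | Bit b => [:: Dig b]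
  | Soft n => nseq n Mid ++ [:: Fin false]
  | Hard n => nseq n Mid ++ [:: Fin true]
  end.

Definition enc (w : seq letter) : seq chr := flatten [seq enc1 a | a <- w].

Lemma enc_cons a w : enc (a :: w) = enc1 a ++ enc w. Proof. by []. Qed.

Lemma enc_cat v w : enc (v ++ w) = enc v ++ enc w.
Proof. by rewrite /enc map_cat flatten_cat. Qed.

Lemma enc_Bar w : Bar \notin enc w.
Proof.
elim: w => //= -[b|n|n] w ih; rewrite /enc /= ?inE ?mem_cat ?inE -/(enc w) !negb_or ih ?andbT //.
  by rewrite mem_nseq andbC.
by rewrite mem_nseq andbC.
Qed.

Lemma nseq_Mid_inj m n b c u v :
  nseq m Mid ++ Fin b :: u = nseq n Mid ++ Fin c :: v -> [/\ m = n, b = c & u = v].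
Proof.
elim: m n => [|m ih] [|n] //=; first by case=> -> ->.
by case=> /ih[-> -> ->].
Qed.

(** Prefix code: a block of [Mid] is closed by the first [Fin]. *)
Lemma enc1_inj a b u v : enc1 a ++ u = enc1 b ++ v -> a = b /\ u = v.
Proof.
case: a => [b1|m|m]; case: b => [b2|n|n]; rewrite /= -?catA /=;
  try by [case=> -> -> | case: m | case: n | case/nseq_Mid_inj => -> // _ ->].
Qed.

Lemma enc1_neq0 a : enc1 a <> [::].
Proof. by case: a => // -[]. Qed.

Lemma enc_matchP a w r : enc w = enc1 a ++ r -> exists2 w', w = a :: w' & r = enc w'.
Proof.
case: w => [|b w]; last by rewrite enc_cons => /enc1_inj[-> <-]; exists w.
by rewrite /enc /=; case: (enc1 a) (@enc1_neq0 a).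
Qed.

(** * Execution of single instructions and of the control phases *)

Definition soft (a : letter) := if a is Hard _ then false else true.
Definition isbit (a : letter) := if a is Bit _ then true else false.

(** Left parts are listed from the head outwards, hence reversed. The head of the stack tape is on
    the blank after the top, so [k] lists the stack from its top. *)
Definition cc n s pl pr k gl gr :=
  cacc n s (tp (map tk pl) (map tk pr)) (tp (map ch k) [::])
    (tp (map ch gl) (map ch gr)).

Lemma swrite_noop_tp S l (r : seq (symbol S)) : swrite (tp l r) (head None r) Stay = tp l r.
Proof. by rewrite -[RHS]swrite_noop shead_tp. Qed.

Lemma swrite_left S l (r : seq (symbol S)) :
  swrite (tp l r) (head None r) Left = tp (behead l) (head None l :: r).
Proof.
by rewrite swriteE; case: r => [|c r] //=; rewrite (tp_rcons_r _ [:: _]).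
Qed.

(** Like the lemmas on instructions that follow, an equivalence with exact step counts: one
    statement serves both soundness and completeness. *)
Lemma ccS_exec n i pl pr k gl gr :
  cc n Exec pl (i :: pr) k gl gr <->
  exists2 n', n = n'.+1 & exists2 a, a \in core Exec (tk i) None (head None (map ch gr)) &
      cacc n' a.1.1.1 (swrite (tp (map tk pl) (map tk (i :: pr))) a.1.1.2.1 a.1.1.2.2)
        (swrite (tp (map ch k) [::]) a.1.2.1 a.1.2.2)
        (swrite (tp (map ch gl) (map ch gr)) a.2.1 a.2.2).
Proof.
rewrite /cc; case: n => [|n] /=; first by split=> // -[].
by rewrite !shead_tp /=; split=> [h|[_ [<-]] //]; exists n.
Qed.

Lemma cc_match1 n c pl pr k gl gr :
  cc n Exec pl (Match c :: pr) k gl gr <->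
  exists n' gr', [/\ n = n'.+1, gr = c :: gr' & cc n' Exec (Match c :: pl) pr k (c :: gl) gr'].
Proof.
rewrite ccS_exec; split.
  case=> n' -> [a] /=; case: eqP => // h.
  rewrite inE => /eqP ->; case: gr h => //= d gr [->].
  by rewrite !swriteE /= tp_r0 => h; exists n', gr.
case=> n' [gr' [-> -> h]]; exists n' => //=.
exists (Exec, (tk (Match c), Right), (None, Stay), (ch c, Right)).
  by rewrite eqxx inE.
by rewrite /= !swriteE /= tp_r0.
Qed.

Lemma cc_match n cs pl pr k gl gr :
  cc n Exec pl (map Match cs ++ pr) k gl gr <->
  exists n' gr', [/\ n = size cs + n', gr = cs ++ gr' &
    cc n' Exec (catrev (map Match cs) pl) pr k (catrev cs gl) gr'].
Proof.
elim: cs n pl gl gr => [|c cs ih] n pl gl gr /=.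
  by split=> [h|[n' [gr' [-> ->]]]] //; exists n, gr.
rewrite cc_match1; split.
  by case=> n' [gr' [-> -> /ih[n1 [gr1 [-> -> h]]]]]; exists n1, gr1.
case=> n' [gr' [-> -> h]]; exists (size cs + n'), (cs ++ gr'); split => //.
by apply/ih; exists n', gr'.
Qed.

Lemma cc_emit1 n c pl pr k gl gr :
  cc n Exec pl (Emit c :: pr) k gl gr <->
  exists2 n', n = n'.+1 & cc n' Exec (Emit c :: pl) pr (c :: k) gl gr.
Proof.
rewrite ccS_exec; split=> -[n' -> h]; exists n' => //.
  case: h => a; rewrite inE => /eqP -> /=.
  by rewrite swrite_noop_tp !swriteE.
exists (Exec, (tk (Emit c), Right), (ch c, Right), (head None (map ch gr), Stay)).
  by rewrite inE.
by rewrite swrite_noop_tp !swriteE.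
Qed.

Lemma cc_emit n cs pl pr k gl gr :
  cc n Exec pl (map Emit cs ++ pr) k gl gr <->
  exists2 n', n = size cs + n' &
    cc n' Exec (catrev (map Emit cs) pl) pr (catrev cs k) gl gr.
Proof.
elim: cs n pl k => [|c cs ih] n pl k /=.
  by split=> [h|[n' ->]] //; exists n.
rewrite cc_emit1; split.
  by case=> n' -> /ih[n1 -> h]; exists n1.
by case=> n' -> h; exists (size cs + n') => //; apply/ih; exists n'.
Qed.

(** Whether a letter is hard shows only at its last character; a copy begun on a hard letter gets
    stuck there. *)
Lemma cc_incopy n j b pl pr k gl gr :
  cc n InCopy pl (Copy :: pr) k gl (nseq j Mid ++ Fin b :: gr) <->
  exists n', [/\ ~~ b, n = j.+1 + n' &
    cc n' Exec pl (Copy :: pr) (catrev (nseq j Mid ++ [:: Fin b]) k)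
      (catrev (nseq j Mid ++ [:: Fin b]) gl) gr].
Proof.
elim: j n k gl => [|j ih] n k gl.
  case: n => [|n] /=; first by split=> [|[? []]].
  rewrite /cc /= !shead_tp /=; case: b => /=; first by split=> [[]|[? []]].
  split.
    case=> a; rewrite inE => /eqP -> /=.
    by rewrite !swriteE /= => h; exists n.
  case=> n' [_ [->] h].
  eexists; first by rewrite inE.
  by rewrite /= !swriteE /=.
case: n => [|n]; first by split=> [|[? []]].
rewrite /cc /= !shead_tp /=; split.
  case=> a; rewrite inE => /eqP -> /=; rewrite !swriteE /= => h.
  by case/(ih n (Mid :: k) (Mid :: gl)): h => n' [hb -> h]; exists n'; split; rewrite ?hb //; lia.
case=> n' [hb [->] h]; eexists; first by rewrite inE.
rewrite /= !swriteE /=; apply: (proj2 (ih (j.+1 + n') (Mid :: k) (Mid :: gl))).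
by exists n'; split => //; lia.
Qed.

(** The instructions that loop a guessed number of times; in [core] the first action of each ends
    the loop. *)
Definition gap_instr (i : instr) :=
  match i with Copy | Drop | Bits | Guess => true | _ => false end.

Lemma cc_stop (i : instr) n pl pr k gl gr (c := head None (map ch gr)) :
  gap_instr i ->
  cc n Exec pl (i :: pr) k gl gr <->
  exists2 n', n = n'.+1 & cc n' Exec (i :: pl) pr k gl gr \/
   exists2 a, a \in behead (core Exec (tk i) None c) &
      cacc n' a.1.1.1 (swrite (tp (map tk pl) (map tk (i :: pr))) a.1.1.2.1 a.1.1.2.2)
        (swrite (tp (map ch k) [::]) a.1.2.1 a.1.2.2)
        (swrite (tp (map ch gl) (map ch gr)) a.2.1 a.2.2).
Proof.
move=> hi; rewrite ccS_exec.
have -> : core Exec (tk i) None (head None (map ch gr)) =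
  (Exec, (tk i, Right), (None, Stay), (head None (map ch gr), Stay)) ::
  behead (core Exec (tk i) None c).
  by case: (i) hi.
split=> -[n' -> h]; exists n' => //.
  case: h => a; rewrite inE => /orP[/eqP ->|ha h]; last by right; exists a.
  by rewrite /= swrite_noop_tp !swriteE /= tp_r0; left.
case: h => [h|[a ha h]]; last by exists a => //; rewrite inE ha orbT.
eexists; first exact: mem_head.
by rewrite /= swrite_noop_tp !swriteE /= tp_r0.
Qed.

Lemma cc_copy n pl pr k gl g :
  cc n Exec pl (Copy :: pr) k gl (enc g) <->
  exists z g' n', [/\ all soft z, g = z ++ g', n = size (enc z) + n'.+1 &
    cc n' Exec (Copy :: pl) pr (catrev (enc z) k) (catrev (enc z) gl) (enc g')].
Proof.
split.
  elim/ltn_ind: n k gl g => n ih k gl g /(cc_stop _ _ _ _ _ _ (isT : gap_instr Copy))[n' en [h|]].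
    by exists [::], g, n'.
  case: g => [|a g] /=; first by case.
  (* One whole letter at a time: [key] resumes the induction when the machine is back in [Exec]
     after a soft letter. *)
  suff key : soft a -> forall m, m < n ->
     cc m Exec pl (Copy :: pr) (catrev (enc1 a) k) (catrev (enc1 a) gl) (enc g) ->
     n = size (enc1 a) + m ->
     exists z g' n', [/\ all soft z, a :: g = z ++ g', n = size (enc z) + n'.+1 &
       cc n' Exec (Copy :: pl) pr (catrev (enc z) k) (catrev (enc z) gl) (enc g')].
    rewrite enc_cons; case: a key => [b|[|j]|[|j]] key [x] //=.
    - rewrite inE => /eqP -> /=; rewrite !swriteE /= => h.
      by apply: (key isT n') => //; lia.
    - rewrite inE => /eqP -> /=; rewrite !swriteE /= => h.
      by apply: (key isT n') => //; lia.
    - rewrite inE => /eqP -> /=; rewrite !swriteE /= -catA /= => h.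
      have /cc_incopy[m [_ em {}h]] : cc n' InCopy pl (Copy :: pr) (Mid :: k) (Mid :: gl)
         (nseq j Mid ++ Fin false :: enc g) by [].
      by apply: (key isT m) => //; rewrite /= ?size_cat ?size_nseq /=; lia.
    - rewrite inE => /eqP -> /=; rewrite !swriteE /= -catA /= => h.
      have /cc_incopy[m [//]] : cc n' InCopy pl (Copy :: pr) (Mid :: k) (Mid :: gl)
         (nseq j Mid ++ Fin true :: enc g) by [].
  move=> sa m mn /(ih _ mn)[z [g' [n1 [sz -> em h]]]] ->.
  exists (a :: z), g', n1; split; rewrite ?enc_cons ?size_cat /= ?sa //; first lia.
  by rewrite !catrev_catl.
case=> z [g' [n' [sz -> -> h]]].
elim: z sz k gl h => [|a z ih] /= => [_ k gl h|/andP[sa sz] k gl].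
  by apply/(cc_stop _ _ _ _ _ _ (isT : gap_instr Copy)); exists n' => //; left.
rewrite enc_cons !catrev_catl => /(ih sz) h.
rewrite size_cat -addnA enc_cons; case: a sa h => //= [b _ h|j _ h].
  apply/(cc_stop _ _ _ _ _ _ (isT : gap_instr Copy)); eexists; first by [].
  by right; eexists; [exact: mem_head|rewrite /= !swriteE].
rewrite size_cat size_nseq /= -catA /=.
apply/(cc_stop _ _ _ _ _ _ (isT : gap_instr Copy)); exists (j + (size (enc z) + n'.+1)); first lia.
right; case: j h => [|j] h; eexists; [exact: mem_head | by rewrite /= !swriteE
  | exact: mem_head | rewrite /= !swriteE /=].
apply: (proj2 (cc_incopy (j.+1 + (size (enc z) + n'.+1)) j false pl pr (Mid :: k) (Mid :: gl) (enc (z ++ g')))).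
by exists (size (enc z) + n'.+1); split => //; lia.
Qed.

Lemma cc_indrop n j b pl pr k gl gr :
  cc n InDrop pl (Drop :: pr) k gl (nseq j Mid ++ Fin b :: gr) <->
  exists n', [/\ ~~ b, n = j.+1 + n' &
    cc n' Exec pl (Drop :: pr) k (catrev (nseq j Mid ++ [:: Fin b]) gl) gr].
Proof.
elim: j n gl => [|j ih] n gl.
  case: n => [|n] /=; first by split=> [|[? []]].
  rewrite /cc /= ?shead_tp /=; case: b => /=; first by split=> [[]|[? []]].
  split.
    case=> a; rewrite inE => /eqP -> /=.
    by rewrite !swriteE /= tp_r0 => h; exists n.
  case=> n' [_ [->] h].
  eexists; first exact: mem_head.
  by rewrite /= !swriteE /= tp_r0.
case: n => [|n]; first by split=> [|[? []]].
rewrite /cc /= ?shead_tp /=; split.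
  case=> a; rewrite inE => /eqP -> /=; rewrite !swriteE /= tp_r0 => h.
  by case/(ih n (Mid :: gl)): h => n' [hb -> h]; exists n'; split; rewrite ?hb //; lia.
case=> n' [hb [->] h]; eexists; first exact: mem_head.
rewrite /= !swriteE /= tp_r0; apply: (proj2 (ih (j.+1 + n') (Mid :: gl))).
by exists n'; split => //; lia.
Qed.

Lemma cc_drop n pl pr k gl g :
  cc n Exec pl (Drop :: pr) k gl (enc g) <->
  exists z g' n', [/\ all soft z, g = z ++ g', n = size (enc z) + n'.+1 &
    cc n' Exec (Drop :: pl) pr k (catrev (enc z) gl) (enc g')].
Proof.
split.
  elim/ltn_ind: n gl g => n ih gl g /(cc_stop _ _ _ _ _ _ (isT : gap_instr Drop))[n' en [h|]].
    by exists [::], g, n'.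
  case: g => [|a g] /=; first by case.
  suff key : soft a -> forall m, m < n ->
     cc m Exec pl (Drop :: pr) k (catrev (enc1 a) gl) (enc g) ->
     n = size (enc1 a) + m ->
     exists z g' n', [/\ all soft z, a :: g = z ++ g', n = size (enc z) + n'.+1 &
       cc n' Exec (Drop :: pl) pr k (catrev (enc z) gl) (enc g')].
    rewrite enc_cons; case: a key => [b|[|j]|[|j]] key [x] //=.
    - rewrite inE => /eqP -> /=; rewrite !swriteE /= tp_r0 => h.
      by apply: (key isT n') => //; lia.
    - rewrite inE => /eqP -> /=; rewrite !swriteE /= tp_r0 => h.
      by apply: (key isT n') => //; lia.
    - rewrite inE => /eqP -> /=; rewrite !swriteE /= tp_r0 -catA /= => h.
      have /cc_indrop[m [_ em {}h]] : cc n' InDrop pl (Drop :: pr) k (Mid :: gl)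
         (nseq j Mid ++ Fin false :: enc g) by [].
      by apply: (key isT m) => //; rewrite /= ?size_cat ?size_nseq /=; lia.
    - rewrite inE => /eqP -> /=; rewrite !swriteE /= tp_r0 -catA /= => h.
      have /cc_indrop[m [//]] : cc n' InDrop pl (Drop :: pr) k (Mid :: gl)
         (nseq j Mid ++ Fin true :: enc g) by [].
  move=> sa m mn /(ih _ mn)[z [g' [n1 [sz -> em h]]]] ->.
  exists (a :: z), g', n1; split; rewrite ?enc_cons ?size_cat /= ?sa //; first lia.
  by rewrite !catrev_catl.
case=> z [g' [n' [sz -> -> h]]].
elim: z sz gl h => [|a z ih] /= => [_ gl h|/andP[sa sz] gl].
  by apply/(cc_stop _ _ _ _ _ _ (isT : gap_instr Drop)); exists n' => //; left.
rewrite enc_cons !catrev_catl => /(ih sz) h.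
rewrite size_cat -addnA enc_cons; case: a sa h => //= [b _ h|j _ h].
  apply/(cc_stop _ _ _ _ _ _ (isT : gap_instr Drop)); eexists; first by [].
  by right; eexists; [exact: mem_head|rewrite /= !swriteE /= tp_r0].
rewrite size_cat size_nseq /= -catA /=.
apply/(cc_stop _ _ _ _ _ _ (isT : gap_instr Drop)); exists (j + (size (enc z) + n'.+1)); first lia.
right; case: j h => [|j] h; eexists; [exact: mem_head | by rewrite /= !swriteE /= tp_r0
  | exact: mem_head | rewrite /= !swriteE /= tp_r0].
apply: (proj2 (cc_indrop (j.+1 + (size (enc z) + n'.+1)) j false pl pr k (Mid :: gl) (enc (z ++ g')))).
by exists (size (enc z) + n'.+1); split => //; lia.
Qed.

Lemma cc_bits n pl pr k gl g :
  cc n Exec pl (Bits :: pr) k gl (enc g) <->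
  exists z g' n', [/\ all isbit z, g = z ++ g', n = size (enc z) + n'.+1 &
    cc n' Exec (Bits :: pl) pr (catrev (enc z) k) (catrev (enc z) gl) (enc g')].
Proof.
split.
  elim/ltn_ind: n k gl g => n ih k gl g /(cc_stop _ _ _ _ _ _ (isT : gap_instr Bits))[n' en [h|]].
    by exists [::], g, n'.
  case: g => [|a g] /=; first by case.
  rewrite enc_cons; case: a => [b|[|j]|[|j]] [x] //=.
  rewrite inE => /eqP -> /=; rewrite !swriteE /= => h.
  have n'n : n' < n by lia.
  case/(ih _ n'n (Dig b :: k) (Dig b :: gl)): h => z [g' [n1 [sz -> em h]]].
  by exists (Bit b :: z), g', n1; split => //=; rewrite ?en ?em //; lia.
case=> z [g' [n' [sz -> -> h]]].
elim: z sz k gl h => [|a z ih] /= => [_ k gl h|/andP[sa sz] k gl].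
  by apply/(cc_stop _ _ _ _ _ _ (isT : gap_instr Bits)); exists n' => //; left.
rewrite enc_cons !catrev_catl => /(ih sz) h.
rewrite size_cat -addnA enc_cons; case: a sa h => //= b _ h.
apply/(cc_stop _ _ _ _ _ _ (isT : gap_instr Bits)); eexists; first by [].
by right; eexists; [exact: mem_head|rewrite /= !swriteE].
Qed.

Lemma cc_guess n pl pr k gl gr :
  cc n Exec pl (Guess :: pr) k gl gr <->
  exists z n', [/\ n = size z + n'.+1 &
    cc n' Exec (Guess :: pl) pr (catrev (map Dig z) k) gl gr].
Proof.
split.
  elim/ltn_ind: n k => n ih k /(cc_stop _ _ _ _ _ _ (isT : gap_instr Guess))[n' en [h|]].
    by exists [::], n'.
  case=> a /=; rewrite !inE => /orP[]/eqP -> /=.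
    rewrite swrite_noop_tp !swriteE /= => h.
    have n'n : n' < n by lia.
    case/(ih _ n'n (Dig false :: k)): h => z [n1 [em h]].
    by exists (false :: z), n1; split => //=; rewrite ?en ?em //; lia.
  rewrite swrite_noop_tp !swriteE /= => h.
  have n'n : n' < n by lia.
  case/(ih _ n'n (Dig true :: k)): h => z [n1 [em h]].
  by exists (true :: z), n1; split => //=; rewrite ?en ?em //; lia.
case=> z [n' [-> h]].
elim: z k h => [|b z ih] /= => [k h|k /ih h].
  by apply/(cc_stop _ _ _ _ _ _ (isT : gap_instr Guess)); exists n' => //; left.
apply/(cc_stop _ _ _ _ _ _ (isT : gap_instr Guess)); exists (size z + n'.+1); first lia.
right; exists (Exec, (tk Guess, Stay), (ch (Dig b), Right), (head None (map ch gr), Stay)).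
  by rewrite /= !inE; case: (b); rewrite ?eqxx ?orbT.
by rewrite /= swrite_noop_tp !swriteE.
Qed.

Definition stk (k : seq chr) : utape := tp (map ch k) [::].
Definition prg (pl pr : seq instr) : utape := tp (map tk pl) (map tk pr).

Lemma cacc_rewg n p k gl (r : seq usym) :
  cacc n RewG p k (tp (behead (map ch gl)) (head None (map ch gl) :: r)) <->
  exists2 n', n = (size gl).+1 + n' &
    cacc n' Exec p k (tp [::] (catrev (map ch gl) r)).
Proof.
elim: gl n r => [|c gl ih] [|n] r; try by split=> [|[?]].
  rewrite /= ?shead_tp /=; split.
    case=> a; rewrite inE => /eqP -> /=; rewrite !swrite_noop swriteE /= tp_l0.
    by exists n.
  case=> n' [->] h; eexists; first exact: mem_head.
  by rewrite /= !swrite_noop swriteE /= tp_l0.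
rewrite /= ?shead_tp /=.
have e : swrite (tp (map ch gl) (ch c :: r)) (ch c) Left =
   tp (behead (map ch gl)) (head None (map ch gl) :: ch c :: r).
  exact: (swrite_left _ (ch c :: r)).
split.
  case=> a; rewrite inE => /eqP -> /=; rewrite !swrite_noop e.
  by case/ih => n' -> h; exists n'.
case=> n' [en] h; eexists; first exact: mem_head.
by rewrite /= !swrite_noop e; apply/ih; exists n'.
Qed.

Lemma cc_sep n pl pr k gl gr :
  cc n Exec pl (Sep :: pr) k gl gr <->
  exists2 n', n = (size gl).+2 + n' & cc n' Exec (Sep :: pl) pr k [::] (catrev gl gr).
Proof.
rewrite ccS_exec; split.
  case=> n1 -> [a]; rewrite inE => /eqP -> /=.
  rewrite swrite_left !swriteE /= tp_r0 => /cacc_rewg[n' -> h]; exists n' => //.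
  by move: h; rewrite /cc !catrevE map_cat map_rev.
case=> n' -> h; exists ((size gl).+1 + n') => //.
move: {-1}((size gl).+1 + n') (erefl ((size gl).+1 + n')) => m em.
eexists; first exact: mem_head.
rewrite /= swrite_left !swriteE /= tp_r0; apply/cacc_rewg; exists n' => //.
by move: h; rewrite /cc !catrevE map_cat map_rev.
Qed.

(** The hypothesis says that the cells already passed are blank. It is preserved as [Clr] erases
    rightwards, and finally makes the goal tape empty. *)
Lemma cacc_clr n p k (l : seq usym) gr : (forall r, tp l r = tp [::] r) ->
  cacc n Clr p k (tp l (map ch gr)) <->
  exists2 n', n = (size gr).+1 + n' & cacc n' Rew p k (tp [::] [::]).
Proof.
elim: gr n l => [|c gr ih] [|n] l hl; try by split=> [|[?]].
  rewrite /= ?shead_tp /=; split.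
    case=> a; rewrite inE => /eqP -> /=; rewrite !swrite_noop ?swriteE /= ?tp_r0 hl.
    by exists n.
  case=> n' [->] h; eexists; first exact: mem_head.
  by rewrite /= !swrite_noop ?swriteE /= ?tp_r0 hl.
have hl' r : tp (None :: l) r = tp [::] r.
  apply: etrans (tp_l0 r); have := hl r.
  by rewrite /tp -!nth_strm_cons => -[->].
rewrite /= ?shead_tp /=; split.
  case=> a; rewrite inE => /eqP -> /=; rewrite !swrite_noop ?swriteE /=.
  by case/(ih _ _ hl') => n' -> h; exists n'.
case=> n' [en] h; eexists; first exact: mem_head.
rewrite /= !swrite_noop ?swriteE /=.
by apply/(ih _ _ hl'); exists n'.
Qed.

Lemma cc_end n pl pr k gr :
  cc n Exec pl (End :: pr) k [::] gr <->
  exists2 n', n = (size gr).+2 + n' &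
    cacc n' Rew (prg pl (End :: pr)) (stk k) (tp [::] [::]).
Proof.
rewrite ccS_exec; split.
  case=> n1 -> [a]; rewrite inE => /eqP -> /=.
  rewrite swrite_noop_tp !swriteE /= tp_r0.
  by case/cacc_clr => // n' -> h; exists n'.
case=> n' -> h; exists ((size gr).+1 + n') => //.
move: {-1}((size gr).+1 + n') (erefl ((size gr).+1 + n')) => m em.
eexists; first exact: mem_head.
rewrite /= swrite_noop_tp !swriteE /= tp_r0.
by apply/cacc_clr => //; exists n'.
Qed.

Lemma cacc_rew0 n pr k g :
  cacc n Rew (tp [::] (None :: map tk pr)) (stk k) g <->
  exists2 n', n = n'.+1 &
    cacc n' Pop (prg [::] pr) (tp (behead (map ch k)) [:: head None (map ch k)]) g.
Proof.
case: n => [|n]; first by split=> // -[].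
have e : tp (map ch k) [::] = tp (map ch k) [:: None] :> utape by rewrite tp_r0.
rewrite /= /stk ?shead_tp /=; split.
  case=> a; rewrite inE => /eqP -> /=; rewrite swrite_noop !swriteE /=.
  rewrite tp_l0 (tp_rcons_r _ [:: _]) => h; by exists n.
case=> n' [->] h; eexists; first exact: mem_head.
by rewrite /= swrite_noop !swriteE /= tp_l0 (tp_rcons_r _ [:: _]).
Qed.

Lemma cacc_rew n pl i pr k g :
  cacc n Rew (prg pl (i :: pr)) (stk k) g <->
  exists2 n', n = (size pl).+2 + n' &
    cacc n' Pop (prg [::] (catrev pl (i :: pr)))
      (tp (behead (map ch k)) [:: head None (map ch k)]) g.
Proof.
elim: pl n i pr => [|j pl ih] [|n] i pr; try by split=> [|[?]].
  rewrite /= /prg ?shead_tp /=.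
  have e : swrite (tp [::] (tk i :: map tk pr)) (tk i) Left = tp [::] (None :: map tk (i :: pr)).
    exact: (swrite_left [::] (tk i :: map tk pr)).
  split.
    case=> a; rewrite inE => /eqP -> /=; rewrite !swrite_noop e.
    by case/cacc_rew0 => n' -> h; exists n'.
  case=> n' [en] h; eexists; first exact: mem_head.
  by rewrite /= !swrite_noop e; apply/cacc_rew0; exists n'.
rewrite /= /prg ?shead_tp /=.
have e : swrite (tp (tk j :: map tk pl) (tk i :: map tk pr)) (tk i) Left = tp (map tk pl) (map tk (j :: i :: pr)).
  exact: (swrite_left (_ :: _) (_ :: _)).
split.
  case=> a; rewrite inE => /eqP -> /=; rewrite !swrite_noop e.
  by case/ih => n' -> h; exists n'.
case=> n' [en] h; eexists; first exact: mem_head.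
by rewrite /= !swrite_noop e; apply/ih; exists n'.
Qed.

(** The stack is read leftwards and the goal tape is written leftwards, which preserves the order of
    the goal; the induction from the right end follows the head. *)
Lemma cacc_pop n p x k g : Bar \notin x ->
  cacc n Pop p (tp (behead (map ch (rev x ++ Bar :: k)))
     [:: head None (map ch (rev x ++ Bar :: k))]) (tp [::] (None :: map ch g)) <->
  exists2 n', n = (size x).+1 + n' &
    cacc n' Choose p (stk k) (tp [::] (map ch (x ++ g))).
Proof.
elim/last_ind: x n g => [|x c ih] n g.
  move=> _; case: n => [|n]; first by split=> // -[].
  rewrite /= /stk ?shead_tp /=; split.
    case=> a; rewrite inE => /eqP -> /=.
    by rewrite swrite_noop !swriteE /= tp_l0 tp_r0 => h; exists n.
  case=> n' [->] h; eexists; first exact: mem_head.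
  by rewrite /= swrite_noop !swriteE /= tp_l0 tp_r0.
rewrite mem_rcons inE negb_or => /andP[bc bx].
case: n => [|n]; first by split=> // -[n' /=]; rewrite size_rcons.
rewrite rev_rcons cat_rcons size_rcons.
apply: (@iff_trans _ (cacc n Pop p (tp (behead (map ch (rev x ++ Bar :: k)))
    [:: head None (map ch (rev x ++ Bar :: k))]) (tp [::] (None :: map ch (c :: g))))).
  rewrite /= ?shead_tp; case: c bc => [b||b|//] _ /=; (split;
   [by case=> a; rewrite inE => /eqP-> /=;
       rewrite swrite_noop !swriteE /= (tp_rcons_r _ [:: _])
   |by move=> h; eexists; [exact: mem_head
      |rewrite /= swrite_noop !swriteE /= (tp_rcons_r _ [:: _])]]).
rewrite (ih n (c :: g) bx); split=> -[n']; [move=> -> | case=> ->] => h; by exists n'.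
Qed.

Lemma cacc_pop0 n p g :
  cacc n Pop p (tp [::] [:: None]) g <-> n = 1.
Proof.
case: n => [|n] //=; rewrite ?shead_tp /=; split.
  by case=> a; rewrite inE => /eqP -> /=; case: n => // n [].
by case=> ->; eexists; first exact: mem_head.
Qed.

(** * Rules and their execution *)

Inductive item := IM of letter | IE of letter | ICopy | IDrop | IBits | IGuess.

Definition item_pack (i : item) : letter + letter + nat :=
  match i with
  | IM a => inl (inl a) | IE a => inl (inr a)
  | ICopy => inr 0 | IDrop => inr 1 | IBits => inr 2 | IGuess => inr 3
  end.
Definition item_unpack (x : letter + letter + nat) : item :=
  match x with
  | inl (inl a) => IM a | inl (inr a) => IE a
  | inr i => nth IGuess [:: ICopy; IDrop; IBits] i
  end.
Lemma item_packK : cancel item_pack item_unpack. Proof. by case. Qed.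
HB.instance Definition _ := Countable.copy item (can_type item_packK).

Definition item_code (i : item) : seq instr :=
  match i with
  | IM a => map Match (enc1 a) | IE a => map Emit (enc1 a)
  | ICopy => [:: Copy] | IDrop => [:: Drop] | IBits => [:: Bits]
  | IGuess => [:: Guess]
  end.

Definition itoks (s : seq item) := flatten (map item_code s).

Definition bits (z : seq bool) : seq letter := map Bit z.

(** The transducer computed by the items, with guessed gaps. The empty sequence accepts any
    remaining goal: unread letters are ignored. *)
Fixpoint trn (s : seq item) (g o : seq letter) : Prop :=
  match s with
  | [::] => o = [::]
  | IM a :: s => exists2 g', g = a :: g' & trn s g' o
  | IE a :: s => exists2 o', o = a :: o' & trn s g o'
  | ICopy :: s => exists z g' o', [/\ all soft z, g = z ++ g', o = z ++ o' & trn s g' o']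
  | IDrop :: s => exists z g', [/\ all soft z, g = z ++ g' & trn s g' o]
  | IBits :: s => exists z g' o', [/\ all isbit z, g = z ++ g', o = z ++ o' & trn s g' o']
  | IGuess :: s => exists z o', o = bits z ++ o' /\ trn s g o'
  end.

(* A premise-free pattern: [Some a] matches the letter [a], [None] skips a block of
   soft letters. *)
Definition check := seq (option letter).
Definition citem (x : option letter) := if x is Some a then IM a else IDrop.

Definition rule := (check * seq (seq item))%type.

Definition premise_code (s : seq item) := Emit Bar :: itoks s ++ [:: Sep].

Definition rule_code (r : rule) : seq instr :=
  itoks (map citem r.1) ++ Sep :: flatten (map premise_code r.2) ++ [:: End].

Fixpoint trns (ss : seq (seq item)) (g : seq letter) (hs : seq (seq letter)) : Prop :=
  match ss, hs with
  | [::], [::] => True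
  | s :: ss', h :: hs' => trn s g h /\ trns ss' g hs'
  | _, _ => False
  end.

Definition fires (r : rule) g hs := trn (map citem r.1) g [::] /\ trns r.2 g hs.

(* [ok] is a constraint on the goals that are popped, used to bound their size. *)
Inductive solve (ok : pred (seq letter)) (P : seq rule) : nat -> seq (seq letter) -> Prop :=
  | solve_nil : solve ok P 0 [::]
  | solve_cons n g gs r hs : r \in P -> fires r g hs -> ok g ->
      solve ok P n (catrev hs gs) -> solve ok P n.+1 (g :: gs).

Definition goal_stack (gs : seq (seq letter)) : seq chr :=
  flatten [seq rev (enc g) ++ [:: Bar] | g <- gs].

Lemma goal_stack_cons g gs : goal_stack (g :: gs) = rev (enc g) ++ Bar :: goal_stack gs.
Proof. by rewrite /goal_stack /= -catA. Qed.

Lemma enc_bits z : enc (bits z) = map Dig z.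
Proof. by elim: z => //= b z ih; rewrite enc_cons ih. Qed.

Lemma catrev_shift T (u v l : seq T) : catrev (catrev u l) v = catrev l (u ++ v).
Proof. by rewrite !catrevE rev_cat revK catA. Qed.

Lemma exec_trn_sound s n pl pr k gl g :
  cc n Exec pl (itoks s ++ Sep :: pr) k gl (enc g) ->
  exists n' o, [/\ n' <= n, trn s g o &
    cc n' Exec (Sep :: catrev (itoks s) pl) pr (catrev (enc o) k) [::]
      (catrev gl (enc g))].
Proof.
elim: s n pl k gl g => [|i s ih] n pl k gl g.
  by rewrite /= => /cc_sep[n' -> h]; exists n', [::]; split => //; lia.
rewrite /itoks /= -/(itoks s) catrev_catl -catA; case: i => [a|a|||| ] /=.
- case/cc_match => n1 [gr [-> /enc_matchP[g' -> ->]]] /ih[n' [o [ho ht h]]].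
  exists n', o; split => //; [lia|by exists g'|].
  by rewrite enc_cons -catrev_shift.
- case/cc_emit => n1 -> /ih[n' [o [ho ht h]]].
  exists n', (a :: o); split => //; [lia|by exists o|].
  by rewrite enc_cons catrev_catl.
- case/cc_copy => z [g' [n1 [sz -> ->]]] /ih[n' [o [ho ht h]]].
  exists n', (z ++ o); split => //; [lia|by exists z, g', o|].
  by rewrite !enc_cat catrev_catl -catrev_shift.
- case/cc_drop => z [g' [n1 [sz -> ->]]] /ih[n' [o [ho ht h]]].
  exists n', o; split => //; [lia|by exists z, g'|].
  by rewrite !enc_cat -catrev_shift.
- case/cc_bits => z [g' [n1 [sz -> ->]]] /ih[n' [o [ho ht h]]].
  exists n', (z ++ o); split => //; [lia|by exists z, g', o|].
  by rewrite !enc_cat catrev_catl -catrev_shift.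
case/cc_guess => z [n1 [->]] /ih[n' [o [ho ht h]]].
exists n', (bits z ++ o); split => //; [lia|by exists z, o|].
by rewrite !enc_cat enc_bits catrev_catl.
Qed.

(** Each instruction runs once, and each character of the goal is read at most once and passed once
    more when the goal is rewound; [gl] is the part read earlier. *)
Lemma exec_trn_complete s g o : trn s g o -> forall n pl pr k gl,
  cc n Exec (Sep :: catrev (itoks s) pl) pr (catrev (enc o) k) [::] (catrev gl (enc g)) ->
  exists2 m, m <= size (itoks s) + size gl + 2 * size (enc g) + size (enc o) + 2 &
    cc (m + n) Exec pl (itoks s ++ Sep :: pr) k gl (enc g).
Proof.
elim: s g o => [|i s ih] g o ht n pl pr k gl h.
  rewrite /= in ht; rewrite {}ht in h.
  exists (size gl).+2; first lia.
  by apply/cc_sep; exists n.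
have hs : size (itoks (i :: s)) = size (item_code i) + size (itoks s) by rewrite size_cat.
move: h; rewrite hs /itoks /= -/(itoks s) catrev_catl -catA; case: i ht {hs} => [a|a|||| ] /=.
- case=> g' -> ht h.
  case: (ih _ _ ht n (catrev (map Match (enc1 a)) pl) pr k (catrev (enc1 a) gl)).
    by rewrite catrev_shift.
  move=> m hm {}h; exists (size (enc1 a) + m).
    by move: hm; rewrite enc_cons !catrevE !size_cat size_rev size_map; lia.
  by rewrite -addnA; apply/cc_match; exists (m + n), (enc g').
- case=> o' -> ht; rewrite enc_cons catrev_catl => h.
  case: (ih _ _ ht _ _ _ _ _ h) => m hm {}h; exists (size (enc1 a) + m).
    by move: hm; rewrite !size_cat size_map; lia.
  by rewrite -addnA; apply/cc_emit; exists (m + n).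
- case=> z [g' [o' [sz -> -> ht]]]; rewrite !enc_cat !catrev_catl -catrev_shift => h.
  case: (ih _ _ ht _ _ _ _ _ h) => m hm {}h; exists (size (enc z) + m.+1).
    by move: hm; rewrite !catrevE !size_cat size_rev /=; lia.
  rewrite -addnA -enc_cat; apply/cc_copy; exists z, g', (m + n); split => //.
- case=> z [g' [sz -> ht]]; rewrite !enc_cat -catrev_shift => h.
  case: (ih _ _ ht _ _ _ _ _ h) => m hm {}h; exists (size (enc z) + m.+1).
    by move: hm; rewrite !catrevE !size_cat size_rev /=; lia.
  rewrite -addnA -enc_cat; apply/cc_drop; exists z, g', (m + n); split => //.
- case=> z [g' [o' [sz -> -> ht]]]; rewrite !enc_cat !catrev_catl -catrev_shift => h.
  case: (ih _ _ ht _ _ _ _ _ h) => m hm {}h; exists (size (enc z) + m.+1).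
    by move: hm; rewrite !catrevE !size_cat size_rev /=; lia.
  rewrite -addnA -enc_cat; apply/cc_bits; exists z, g', (m + n); split => //.
case=> z [o' [-> ht]]; rewrite !enc_cat enc_bits catrev_catl => h.
case: (ih _ _ ht _ _ _ _ _ h) => m hm {}h; exists (size z + m.+1).
  by move: hm; rewrite !size_cat size_map /=; lia.
rewrite -addnA; apply/cc_guess; exists z, (m + n); split => //.
Qed.

Lemma trn_check c g o : trn (map citem c) g o -> o = [::].
Proof. by elim: c g => //= -[a|] c ih g /=; [case=> g' _ /ih | case=> z [g' [_ _ /ih]]]. Qed.

Lemma exec_trns_sound ss n pl pr gs g :
  cc n Exec pl (flatten (map premise_code ss) ++ End :: pr) (goal_stack gs) [::] (enc g) ->
  exists n' hs, [/\ n' <= n, trns ss g hs &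
    cacc n' Rew (prg (catrev (flatten (map premise_code ss)) pl) (End :: pr))
     (stk (goal_stack (catrev hs gs))) (tp [::] [::])].
Proof.
elim: ss n pl gs => [|s ss ih] n pl gs /=.
  by move=> /cc_end[n' -> h]; exists n', [::]; split => //; lia.
rewrite catrev_catl /= -catA /= => /cc_emit1[n1 ->].
rewrite -catA /= => /exec_trn_sound[n2 [o [hn ht]]].
rewrite [catrev (enc o) _]catrevE -goal_stack_cons => /ih[n' [hs [hn' hts h]]].
exists n', (o :: hs); split => //=; first lia.
by rewrite catrev_catl.
Qed.

Lemma exec_trns_complete ss g hs L : trns ss g hs -> size (enc g) <= L ->
  (forall h, h \in hs -> size (enc h) <= L) -> forall n pl pr gs,
  cacc n Rew (prg (catrev (flatten (map premise_code ss)) pl) (End :: pr))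
     (stk (goal_stack (catrev hs gs))) (tp [::] [::]) ->
  exists2 m, m <= size (flatten (map premise_code ss)) * (3 * L + 3) + L + 2 &
    cc (m + n) Exec pl (flatten (map premise_code ss) ++ End :: pr) (goal_stack gs) [::] (enc g).
Proof.
elim: ss hs => [|s ss ih] [|o hs] //= ht gL hL n pl pr gs h.
  exists (size (enc g)).+2; first lia.
  by apply/cc_end; exists n.
case: ht => ht hts; rewrite catrev_catl /= in h.
case: (ih hs hts gL _ n _ pr (o :: gs) h) => [u hu|m1 hm1 {}h].
  by apply: hL; rewrite inE hu orbT.
rewrite goal_stack_cons -catrevE catrev_catl /= in h.
case: (exec_trn_complete ht (n := m1 + n) (pr := flatten (map premise_code ss) ++ End :: pr) (pl := Emit Bar :: pl) (k := Bar :: goal_stack gs) (gl := [::]) h) => m2 hm2 {}h.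
exists (m2 + m1).+1.
  have := hL o (mem_head _ _).
  by move: hm1 hm2; rewrite !size_cat /= ?size_cat /=; nia.
rewrite -catA /=; apply/cc_emit1; exists (m2 + m1 + n) => //.
by rewrite -addnA -catA /=.
Qed.

Definition program (P : seq rule) : seq instr := flatten (map rule_code P).

Lemma End_itoks s : End \notin itoks s.
Proof.
have E (f : chr -> instr) x : (forall c, f c <> End) -> End \notin map f x.
  by move=> h; apply/mapP => -[c _ e]; exact: (h c).
elim: s => //= -[a|a|||| ] s ih; rewrite /itoks /= -/(itoks s) ?mem_cat ?inE ?negb_or //= ih ?andbT;
  by [exact: E | apply/eqP].
Qed.

(** This is what lets [Skip] find the next rule. *)
Lemma rule_codeP r : exists2 c, rule_code r = rcons c End & End \notin c.
Proof.
exists (itoks (map citem r.1) ++ Sep :: flatten (map premise_code r.2)).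
  by rewrite -cats1 -catA.
have e1 : End != Sep by apply/eqP.
have e2 : End != Emit Bar by apply/eqP.
rewrite mem_cat negb_or End_itoks inE negb_or e1 /=.
elim: r.2 => //= s ss ih.
by rewrite in_cons !mem_cat mem_seq1 !negb_or End_itoks e1 e2.
Qed.

Lemma cc_choose n pl pr k gr :
  cc n Choose pl pr k [::] gr <-> exists2 n', n = n'.+1 &
    cc n' Exec pl pr k [::] gr \/ cc n' Skip pl pr k [::] gr.
Proof.
rewrite /cc; case: n => [|n]; first by split=> [|[]].
split=> [[a]|[_ [<-]] [h|h]] /=.
- rewrite !inE => /orP[]/eqP -> /=; rewrite !swrite_noop => h; exists n => //; by [left|right].
- by exists (Exec, (shead (prg pl pr), Stay), (shead (stk k), Stay), (shead (tp [::] (map ch gr)), Stay));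
    [exact: mem_head|rewrite /= !swrite_noop].
by exists (Skip, (shead (prg pl pr), Stay), (shead (stk k), Stay), (shead (tp [::] (map ch gr)), Stay));
  [rewrite !inE eqxx orbT|rewrite /= !swrite_noop].
Qed.

Lemma cc_skip n pl c pr k gr : End \notin c ->
  cc n Skip pl (rcons c End ++ pr) k [::] gr <-> exists2 n', n = (size c).+1 + n' &
    cc n' Choose (catrev (rcons c End) pl) pr k [::] gr.
Proof.
elim: c n pl => [|i c ih] [|n] pl; try by split=> [|[?]].
  move=> _; rewrite /cc /= ?shead_tp /=; split.
    by case=> a; rewrite inE => /eqP -> /=; rewrite !swrite_noop swriteE /= => h; exists n.
  case=> n' [->] h; eexists; first exact: mem_head.
  by rewrite /= !swrite_noop swriteE.
rewrite inE negb_or => /andP[ei ec].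
have -> : cc n.+1 Skip pl (rcons (i :: c) End ++ pr) k [::] gr <-> cc n Skip (i :: pl) (rcons c End ++ pr) k [::] gr.
  { rewrite /cc /= ?shead_tp /=; case: i ei => [c0 _|c0 _|_|_|_|_|_|]; last by rewrite eqxx.
  all: split; [
    by case=> a; rewrite inE => /eqP -> /=; rewrite !swrite_noop swriteE
  | by move=> h; eexists; [exact: mem_head | rewrite /= !swrite_noop swriteE]]. }
by rewrite ih //; split=> -[n']; [move=> -> | case=> ->] => h; exists n'.
Qed.

Lemma cc_choose_rule P n pl k gr :
  cc n Choose pl (program P) k [::] gr <-> exists P1 r P2 n',
   [/\ P = P1 ++ r :: P2, n = size P1 + size (program P1) + n'.+1 &
    cc n' Exec (catrev (program P1) pl) (program (r :: P2)) k [::] gr].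
Proof.
elim: P n pl => [|r P ih] n pl.
  split=> [|[[|??] [? [? [? []]]]] //].
  by case/cc_choose => n' ->; rewrite /cc; case: n' => [[]|n'] //= [] [] a; rewrite ?shead_tp.
have [c ec hc] := rule_codeP r.
split.
  case/cc_choose => n1 -> [h|].
    by exists [::], r, P, n1; split.
  rewrite /program /= -/(program P) ec => /cc_skip-/(_ hc)[n2 ->] /ih[P1 [r' [P2 [n' [-> -> h]]]]].
  exists (r :: P1), r', P2, n'; split => //.
    by rewrite /program /= ec size_cat size_rcons /program; lia.
  by rewrite /program /= ec catrev_catl.
case=> -[|r1 P1] [r' [P2 [n' [/= [<- eP] -> h]]]]; subst P.
  by apply/cc_choose; exists n' => //; left.
apply/cc_choose; exists (size c + 1 + (size P1 + size (program P1) + n'.+1)).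
  by rewrite /program /= ec size_cat size_rcons; lia.
right; rewrite /program /= -/(program _) ec; apply/(cc_skip _ _ _ _ _ hc).
exists (size P1 + size (program P1) + n'.+1); first by rewrite addn1.
apply: (proj2 (ih (size P1 + size (program P1) + n'.+1) _)); exists P1, r', P2, n'; split => //.
by move: h; rewrite /program /= ec catrev_catl.
Qed.

Lemma core_sound n P gs pl i pr : catrev pl (i :: pr) = program P ->
  cacc n Rew (prg pl (i :: pr)) (stk (goal_stack gs)) (tp [::] [::]) ->
  exists m, solve predT P m gs.
Proof.
elim/ltn_ind: n gs pl i pr => n ih [|g gs] pl i pr eP /cacc_rew[n1 en].
  by exists 0; constructor.
rewrite goal_stack_cons -[tp [::] [::]]tp_r0 => /(cacc_pop _ _ _ [::] (enc_Bar g))[n2 en1].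
rewrite cats0 -/(stk _) eP => h.
have {h} : cc n2 Choose [::] (program P) (goal_stack gs) [::] (enc g) by [].
case/cc_choose_rule => P1 [r [P2 [n3 [ePP en2]]]].
rewrite /program /= -/(program P2) /rule_code -!catA /=.
case/exec_trn_sound => n4 [o [hn4 /[dup] /trn_check -> hchk]].
rewrite -catA /= => /exec_trns_sound[n5 [hs [hn5 hts]]].
case/(ih n5 _ (catrev hs gs) _ End (program P2)) => [||m hm]; first lia.
  rewrite catrev_shift [LHS]/= !catrev_shift /= ePP /program map_cat flatten_cat /= /rule_code.
  by rewrite -!catA /= -!catA.
by exists m.+1; apply: (solve_cons (r := r) (hs := hs)) hm => //; rewrite ePP mem_cat inE eqxx orbT.
Qed.

(** One rule application scans the program and, for each premise, the goal: at most
    [10 * (size + 1) * (L + 1)] steps. The extra round is the last rewinding, which finds the stack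
    empty. *)
Lemma core_complete (ok : pred (seq letter)) L P m gs : (forall g, ok g -> size (enc g) <= L) ->
  solve ok P m gs -> forall pl i pr, catrev pl (i :: pr) = program P ->
  exists2 t, t <= m.+1 * (10 * ((size (program P)).+1 * L.+1)) &
    cacc t Rew (prg pl (i :: pr)) (stk (goal_stack gs)) (tp [::] [::]).
Proof.
move=> okL; elim => {m gs} [|m g gs r hs rP [hchk hts] /okL okg hsol ih] pl i pr eP.
  have hpl : size pl < size (program P) by rewrite -eP catrevE size_cat size_rev /=; lia.
  exists ((size pl).+2 + 1); first nia.
  by apply/cacc_rew; exists 1 => //; apply/cacc_pop0.
have hpl : size pl < size (program P) by rewrite -eP catrevE size_cat size_rev /=; lia.
(* The premises are popped later in the same derivation, so [ok] bounds them too. *)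
have hsL h : h \in hs -> size (enc h) <= L.
  have : h \in catrev hs gs -> size (enc h) <= L.
    elim: hsol {ih} => // m' g' gs' r' hs' _ _ og _ ih.
    rewrite inE => /orP[/eqP -> | hg]; first exact: okL.
    by apply: ih; rewrite catrevE mem_cat hg orbT.
  by move=> k hh; apply: k; rewrite catrevE mem_cat mem_rev hh.
have [P1 [P2 eP12]] : exists P1 P2, P = P1 ++ r :: P2.
  by exists (take (index r P) P), (drop (index r P).+1 P); rewrite -{2}[r](nth_index r rP) -drop_nth ?index_mem // cat_take_drop.
have epl : catrev (catrev (flatten (map premise_code r.2))
    (Sep :: catrev (itoks (map citem r.1)) (catrev (program P1) [::]))) (End :: program P2) = program P.
  rewrite catrev_shift [LHS]/= !catrev_shift /= eP12 /program map_cat flatten_cat /= /rule_code.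
  by rewrite -!catA /= -!catA.
have [t1 ht1 h1] := ih _ _ _ epl.
case: (exec_trns_complete hts okg hsL h1) => t2 ht2 h2.
have := exec_trn_complete hchk (n := t2 + t1) (pl := catrev (program P1) [::])
  (pr := flatten (map premise_code r.2) ++ End :: program P2) (k := goal_stack gs) (gl := [::]) h2.
case=> t3 ht3 h3.
have h4 : cc (size P1 + size (program P1) + (t3 + (t2 + t1)).+1) Choose [::] (program P) (goal_stack gs) [::] (enc g).
  apply/cc_choose_rule; exists P1, r, P2, (t3 + (t2 + t1)); split => //.
  by rewrite /program /= /rule_code -!catA /= -catA.
exists ((size pl).+2 + ((size (enc g)).+1 + (size P1 + size (program P1) + (t3 + (t2 + t1)).+1))).
  have e1 : size (program P) = size (program P1) +
    (size (itoks (map citem r.1)) + (size (flatten (map premise_code r.2)) + 1).+1 + size (program P2)).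
    by rewrite eP12 /program map_cat flatten_cat /= /rule_code !size_cat /= size_cat.
  have e2 Q : size Q <= size (program Q).
    elim: Q => //= r0 Q ihQ; rewrite /program /= size_cat -/(program Q).
    by rewrite /rule_code size_cat /=; lia.
  have := e2 P1; move: ht2 ht3 hpl okg ht1; rewrite [m.+2 * _]mulSn; move: (m.+1 * _) => X.
  move: (size (enc g)) e1 => G.
  move: (size (program P)) (size (program P1)) (size (program P2)) (size P1).
  move: (size (itoks _)) (size (flatten _)) => I F Z Z1 Z2 n1 eZ ht2 ht3 hpl okg ht1 hn1.
  have hF : F * (3 * L + 3) <= Z * (3 * L + 3) by rewrite leq_mul2r; apply/orP; right; lia.
  have eF : Z * (3 * L + 3) = 3 * (Z * L) + 3 * Z by ring.
  have eB : 10 * (Z.+1 * L.+1) = 10 * (Z * L) + 10 * Z + 10 * L + 10 by ring.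
  by rewrite /= in ht3; rewrite eB; lia.
apply/cacc_rew; eexists; first by [].
rewrite goal_stack_cons -[tp [::] [::]]tp_r0; apply/(cacc_pop _ _ _ [::] (enc_Bar g)).
eexists; first by [].
by rewrite cats0 eP.
Qed.

(** * The universal machine *)

Definition dg (b : bool) : usym := Some (inl b).

(* The clock walks through the binary tree whose depth is the length of the input; [true]
   means going up and [false] going down. *)
Definition clock (up : bool) (c : usym) : option (bool * action) :=
  match c with
  | Some (inl b) =>
      Some (if up then (if b then (true, (dg true, Left)) else (false, (dg true, Right)))
            else (false, (dg false, Right)))
  | None => if up then None else Some (true, (None, Left))
  | _ => None
  end.

Fixpoint ticks n (b : bool) (t : utape) : Prop :=
  if n is n'.+1 then
    if clock b (shead t) is Some (b', (a, m)) then ticks n' b' (swrite t a m) else False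
  else True.

(** Ticks to traverse a subtree with [k] cells of depth: two halves, and three ticks to enter each
    of them and to leave. At a leaf one tick turns the walk upwards. *)
Fixpoint descent k := if k is k'.+1 then 2 * descent k' + 3 else 1.

(** Ticks left when the walk goes up along [l] from height [k]: a cell [true] is finished, a cell
    [false] still has its second half to visit. *)
Fixpoint ascent (l : seq bool) k :=
  match l with
  | [::] => 0
  | b :: l' => (if b then 1 else descent k + 2) + ascent l' k.+1
  end.

Lemma ticksP n l r :
  (ticks n true (tp (behead (map dg l)) (head None (map dg l) :: map dg r)) <->
     n <= ascent l (size r)) /\
  (ticks n false (tp (map dg l) (map dg r)) <-> n <= descent (size r) + ascent l (size r)).
Proof.
elim: n l r => [//|n ih] l r; split.
  case: l => [|[] l] /=; rewrite ?shead_tp //= swriteE /=.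
    by rewrite (ih l (true :: r)).1.
  by rewrite (ih (true :: l) r).2 /=; lia.
case: r => [|b r] /=; rewrite ?shead_tp //= swriteE /=.
  by rewrite (tp_rcons_r _ [:: _]) (ih l [::]).1.
by rewrite (ih (false :: l) r).2 /=; lia.
Qed.

Lemma descentE k : descent k + 3 = 2 ^ (k + 2).
Proof. by elim: k => // k ih; rewrite [descent _]/= (_ : k.+1 + 2 = (k + 2).+1) // expnS; lia. Qed.

Lemma ascent_ge n k : 2 ^ (n + k) <= ascent (nseq n false) k + 2 ^ k.
Proof.
elim: n k => //= n ih k; have := ih k.+1; have := descentE k.
rewrite (addnS n k) (addSn n k) [2 ^ k.+1]expnS (expnD 2 k 2) (_ : 2 ^ 2 = 4) //; lia.
Qed.

Lemma ascent_le n k : ascent (nseq n false) k <= 2 ^ (n + k + 2).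
Proof.
(* The added term is [descent k + 3], so that it pays for the ticks at one level and doubles for the
   next. *)
suff: ascent (nseq n false) k + 2 ^ (k + 2) <= 2 ^ (n + k + 2) by lia.
elim: n k => //= n ih k; have := ih k.+1; have := descentE k.
by rewrite (addnS n k) !addSn [2 ^ (k + 2).+1]expnS; lia.
Qed.

Notation ntok := #|{: instr}|.

Definition ustate := (bool + 'I_ntok.+1 + cstate * bool)%type.

Definition Setup b : ustate := inl (inl b).
Definition Read (t : nat) : ustate := inl (inr (inord t)).
Definition Run s b : ustate := inr (s, b).

Definition uaction := (ustate * action * action * action * action * action)%type.

Definition tok (t : nat) : instr := nth End (enum {: instr}) t.

(* Tapes: input, program, stack, goal, clock.  The program is read from the input, where the
   instruction of rank [t] is written [1^t 0], and [1^ntok] ends it; the stack is initialized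
   with the whole input as its only goal. *)
Definition full (q : ustate) (r0 r1 r2 r3 r4 : usym) : seq uaction :=
  let: n0 := (r0, Stay) in let: n1 := (r1, Stay) in let: n2 := (r2, Stay) in
  let: n3 := (r3, Stay) in let: n4 := (r4, Stay) in
  match q with
  | inl (inl false) => [:: (Setup true, n0, n1, (ch Bar, Right), n3, n4)]
  | inl (inl true) => [:: (Read 0, n0, n1, (ch (Fin true), Right), n3, n4)]
  | inl (inr t) =>
      if r0 is Some (inl b) then
        let: (t', p) := if t == ntok :> nat then (ntok, n1)
                        else if b then (t.+1, n1) else (0, (tk (tok t), Right)) in
        [:: (Read t', (r0, Right), p, (ch (Dig b), Right), n3, (dg false, Right))]
      else [:: (Run Rew true, n0, (None, Left), (ch (Fin true), Right), n3, (None, Left))]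
  | inr (s, b) =>
      if clock b r4 is Some (b', a4) then
        [seq (Run a.1.1.1 b', n0, a.1.1.2, a.1.2, a.2, a4) | a <- core s r1 r2 r3]
      else [::]
  end.

(** [Q] tests the last state: the same predicate serves for acceptance and, with a trivial test, for
    the running time. *)
Fixpoint frun (Q : pred ustate) n (q : ustate) (t0 t1 t2 t3 t4 : utape) : Prop :=
  if n is n'.+1 then
    exists2 a, a \in full q (shead t0) (shead t1) (shead t2) (shead t3) (shead t4) &
      frun Q n' a.1.1.1.1.1
        (swrite t0 a.1.1.1.1.2.1 a.1.1.1.1.2.2) (swrite t1 a.1.1.1.2.1 a.1.1.1.2.2)
        (swrite t2 a.1.1.2.1 a.1.1.2.2) (swrite t3 a.1.2.1 a.1.2.2)
        (swrite t4 a.2.1 a.2.2)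
  else Q q.

Definition udelta (q : ustate) (r : {ffun 'I_5 -> usym}) :
    {set ustate * {ffun 'I_5 -> usym * direction}} :=
  [set x in [seq (a.1.1.1.1.1, [ffun i : 'I_5 => nth (None, Stay)
      [:: a.1.1.1.1.2; a.1.1.1.2; a.1.1.2; a.1.2; a.2] i])
    | a <- full q (r (inord 0)) (r (inord 1)) (r (inord 2)) (r (inord 3)) (r (inord 4))]].

Definition accepting (q : ustate) : bool := if q is inr (Acc, _) then true else false.

Definition universal : ntm :=
  @NTM ustate uaux 4 (Setup false) [set q | accepting q] udelta.

Definition ctape (c : config universal) i : utape :=
  tp (c.2 (inord i)).1 (c.2 (inord i)).2.

Lemma frun_nsteps Q n (c : config universal) :
  frun Q n c.1 (ctape c 0) (ctape c 1) (ctape c 2) (ctape c 3) (ctape c 4) <->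
  exists2 c', nsteps (@step universal) n c c' & Q c'.1.
Proof.
elim: n c => [|n ih] c /=; first by split=> [h|[_ <-]] //; exists c.
have stepE (a : uaction) i : i < 5 ->
    ctape (a.1.1.1.1.1, [ffun j => write_move (c.2 j)
      (nth (None, Stay) [:: a.1.1.1.1.2; a.1.1.1.2; a.1.1.2; a.1.2; a.2] j).1
      (nth (None, Stay) [:: a.1.1.1.1.2; a.1.1.1.2; a.1.1.2; a.1.2; a.2] j).2]) i =
    swrite (ctape c i)
      (nth (None, Stay) [:: a.1.1.1.1.2; a.1.1.1.2; a.1.1.2; a.1.2; a.2] i).1
      (nth (None, Stay) [:: a.1.1.1.1.2; a.1.1.1.2; a.1.1.2; a.1.2; a.2] i).2.
  by move=> hi; rewrite /ctape /= ffunE inordK // tp_write_move.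
have eE : [seq (a.1.1.1.1.1, [ffun i : 'I_5 => nth (None, Stay)
      [:: a.1.1.1.1.2; a.1.1.1.2; a.1.1.2; a.1.2; a.2] i]) | a <- full c.1
     (shead (ctape c 0)) (shead (ctape c 1)) (shead (ctape c 2)) (shead (ctape c 3)) (shead (ctape c 4))]
   =i udelta c.1 [ffun i => scanned (c.2 i)].
  by move=> x; rewrite inE !ffunE !shead_scanned.
split.
  case=> a ha h; pose c' : config universal := (a.1.1.1.1.1, [ffun j => write_move (c.2 j)
      (nth (None, Stay) [:: a.1.1.1.1.2; a.1.1.1.2; a.1.1.2; a.1.2; a.2] j).1
      (nth (None, Stay) [:: a.1.1.1.1.2; a.1.1.1.2; a.1.1.2; a.1.2; a.2] j).2]).
  case: (proj1 (ih c')); first by rewrite !stepE.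
  move=> d hd Qd; exists d => //; exists c' => //.
  eexists; first by rewrite -eE; apply/mapP; exists a.
  by rewrite /c'; congr pair; apply/ffunP => j; rewrite !ffunE.
case=> c' [d [act]]; rewrite -eE => /mapP[a ha ->] ec hn Qd.
exists a => //.
have {}ec : d = (a.1.1.1.1.1, [ffun j => write_move (c.2 j)
      (nth (None, Stay) [:: a.1.1.1.1.2; a.1.1.1.2; a.1.1.2; a.1.2; a.2] j).1
      (nth (None, Stay) [:: a.1.1.1.1.2; a.1.1.1.2; a.1.1.2; a.1.2; a.2] j).2]).
  by rewrite ec; congr pair; apply/ffunP => j; rewrite !ffunE.
have : exists2 c', nsteps (step (M:=universal)) n d c' & Q c'.1 by exists c'.
by move/ih; rewrite ec !stepE.
Qed.

Fixpoint decode t (x : seq bool) : seq instr :=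
  if x is b :: x' then
    if t == ntok then decode t x' else
    if b then decode t.+1 x' else tok t :: decode 0 x'
  else [::].

Definition accq (c : bool) (q : ustate) : bool := c || accepting q.

Lemma frun_read c n t x l0 ps k g d : t <= ntok ->
  frun (accq c) n (Read t) (tp l0 (map dg x)) (tp (map tk ps) [::])
    (tp (map ch k) [::]) g (tp (map dg d) [::]) <->
  (c /\ n <= size x) \/ (exists n' ps', [/\ n = size x + n'.+1,
    ps' = catrev (decode t x) ps &
    frun (accq c) n' (Run Rew true) (tp (catrev (map dg x) l0) [::])
      (tp (behead (map tk ps')) [:: head None (map tk ps')])
      (tp (map ch (Fin true :: catrev (map Dig x) k)) [::]) g
      (tp (behead (map dg (nseq (size x) false ++ d)))
         [:: head None (map dg (nseq (size x) false ++ d))])]).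
Proof.
elim: x n t l0 ps k d => [|b x ih] n t l0 ps k d ht.
  case: n => [|n].
    by rewrite /accq /= orbF; split=> [|[[]|[n' [ps' []]]]] //; left.
  rewrite /= ?shead_tp /=; split.
    case=> a; rewrite inE => /eqP -> /=.
    rewrite !swrite_noop !swriteE /= !(tp_rcons_r _ [:: _]) ?tp_r0 => h.
    by right; exists n, ps.
  case=> [[]//|[n' [ps' [[->] -> h]]]]; eexists; first exact: mem_head.
  by rewrite /= !swrite_noop !swriteE /= !(tp_rcons_r _ [:: _]) ?tp_r0.
case: n => [|n].
  by rewrite /accq /= orbF; split=> [|[[]|[n' [ps' []]]]] //; left.
have key t' ps1 : t' <= ntok -> catrev (decode t (b :: x)) ps = catrev (decode t' x) ps1 ->
  (frun (accq c) n (Read t') (tp (dg b :: l0) (map dg x)) (tp (map tk ps1) [::])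
    (tp (map ch (Dig b :: k)) [::]) g (tp (map dg (false :: d)) [::]) <->
  (c /\ n.+1 <= size (b :: x)) \/ (exists n' ps', [/\ n.+1 = size (b :: x) + n'.+1,
    ps' = catrev (decode t (b :: x)) ps &
    frun (accq c) n' (Run Rew true) (tp (catrev (map dg (b :: x)) l0) [::])
      (tp (behead (map tk ps')) [:: head None (map tk ps')])
      (tp (map ch (Fin true :: catrev (map Dig (b :: x)) k)) [::]) g
      (tp (behead (map dg (nseq (size (b :: x)) false ++ d)))
         [:: head None (map dg (nseq (size (b :: x)) false ++ d))])])).
  move=> ht' ->; rewrite ih //.
  have -> : nseq (size (b :: x)) false ++ d = nseq (size x) false ++ false :: d.
    by rewrite /=; elim: (size x) => //= m ->.
  split=> -[[hc hn]|[n' [ps' [hn -> h]]]]; [by left|right|by left|right].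
    by exists n', (catrev (decode t' x) ps1); split => //=; lia.
  by exists n', (catrev (decode t' x) ps1); split => //=; move: hn => /=; lia.
rewrite -(key (if t == ntok then ntok else if b then t.+1 else 0)
  (if t == ntok then ps else if b then ps else tok t :: ps)); first last.
- by rewrite /=; case: eqP => [->|_] //; case: (b).
- by case: eqP => // /eqP; case: (b) => //; lia.
rewrite {key}/= ?shead_tp /= inordK ?ltnS //.
case: eqP => _; last case: b.
- split=> [[a]|h]; first by rewrite inE => /eqP -> /=; rewrite !swrite_noop !swriteE /= ?tp_r0.
  by eexists; [exact: mem_head|rewrite /= !swrite_noop !swriteE /= ?tp_r0].
- split=> [[a]|h]; first by rewrite inE => /eqP -> /=; rewrite !swrite_noop !swriteE /= ?tp_r0.
  by eexists; [exact: mem_head|rewrite /= !swrite_noop !swriteE /= ?tp_r0].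
split=> [[a]|h]; first by rewrite inE => /eqP -> /=; rewrite !swrite_noop !swriteE /= ?tp_r0.
by eexists; [exact: mem_head|rewrite /= !swrite_noop !swriteE /= ?tp_r0].
Qed.

(** The core and the clock share no tape, so a run of the whole machine is a run of each with the
    same number of steps. *)
Lemma frun_run n s b t0 p k g tc :
  frun (accq false) n (Run s b) t0 p k g tc <-> cacc n s p k g /\ ticks n b tc.
Proof.
elim: n s b t0 p k g tc => [|n ih] s b t0 p k g tc /=.
  by rewrite /accq /=; case: s; split=> // -[].
case: (clock b (shead tc)) => [[b' [a m]]|]; last by split=> [[]|[]].
split.
  by case=> x /mapP[y hy ->] /=; rewrite ih => -[h ht]; split => //; exists y.
case=> -[y hy h] ht; exists (Run y.1.1.1 b', (shead t0, Stay), y.1.1.2, y.1.2, y.2, (a, m)).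
  by apply/mapP; exists y.
by rewrite /= ih.
Qed.

Lemma frun_ticks Q n s b t0 p k g tc :
  frun Q n (Run s b) t0 p k g tc -> ticks n b tc.
Proof.
elim: n s b t0 p k g tc => [|n ih] s b t0 p k g tc //=.
case: (clock b (shead tc)) => [[b' [a m]]|] [] // x /mapP[y hy ->] /=; exact: ih.
Qed.

Definition raw (x : seq bool) : seq letter := Hard 0 :: bits x ++ [:: Hard 0].

Lemma ctape_init0 x : ctape (init universal x) 0 = tp [::] (map dg x).
Proof. by rewrite /ctape /= !ffunE -val_eqE /= inordK. Qed.

Lemma ctape_init x i : 0 < i < 5 -> ctape (init universal x) i = tp [::] [::].
Proof.
move=> hi; rewrite /ctape /= !ffunE -val_eqE /= inordK; last lia.
by case: i hi.
Qed.

(** [size x + 3] steps precede the core: two of [Setup], one for each bit, and one to see the end of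
    the input. *)
Lemma frun_init c n x :
  frun (accq c) n (Setup false) (tp [::] (map dg x)) (tp [::] [::]) (tp [::] [::])
    (tp [::] [::]) (tp [::] [::]) <->
  (c /\ n <= size x + 2) \/ (exists2 n', n = size x + n'.+3 &
    frun (accq c) n' (Run Rew true) (tp (catrev (map dg x) [::]) [::])
      (tp (behead (map tk (catrev (decode 0 x) [::])))
         [:: head None (map tk (catrev (decode 0 x) [::]))])
      (stk (goal_stack [:: raw x])) (tp [::] [::])
      (tp (behead (map dg (nseq (size x) false)))
         [:: head None (map dg (nseq (size x) false))])).
Proof.
case: n => [|n].
  rewrite /accq /= orbF; split=> [hc|[[]|[n']]] //; last by lia.
  by left.
have -> : frun (accq c) n.+1 (Setup false) (tp [::] (map dg x)) (tp [::] [::]) (tp [::] [::])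
    (tp [::] [::]) (tp [::] [::]) <->
    frun (accq c) n (Setup true) (tp [::] (map dg x)) (tp [::] [::]) (tp [:: ch Bar] [::])
    (tp [::] [::]) (tp [::] [::]).
  split=> [[a]|h].
    by rewrite inE => /eqP -> /=; rewrite !swrite_noop !swriteE.
  by eexists; [exact: mem_head|rewrite /= !swrite_noop !swriteE].
case: n => [|n].
  rewrite /accq /= orbF; split=> [hc|[[]|[n']]] //; last by lia.
  by left; split => //; lia.
have -> : frun (accq c) n.+1 (Setup true) (tp [::] (map dg x)) (tp [::] [::]) (tp [:: ch Bar] [::])
    (tp [::] [::]) (tp [::] [::]) <->
    frun (accq c) n (Read 0) (tp [::] (map dg x)) (tp (map tk [::]) [::])
      (tp (map ch [:: Fin true; Bar]) [::])
    (tp [::] [::]) (tp (map dg [::]) [::]).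
  split=> [[a]|h].
    by rewrite inE => /eqP -> /=; rewrite !swrite_noop !swriteE.
  by eexists; [exact: mem_head|rewrite /= !swrite_noop !swriteE].
rewrite frun_read // cats0.
have -> : Fin true :: catrev (map Dig x) [:: Fin true; Bar] = goal_stack [:: raw x].
  rewrite goal_stack_cons /raw enc_cons enc_cat enc_bits /= rev_cons rev_cat /=.
  by rewrite catrevE -cats1 -catA.
split=> -[[hc hn]|].
- by left; split => //; lia.
- case=> n' [ps [hn ->] h]; right; exists n' => //; lia.
- by left; split => //; lia.
by case=> n' hn h; right; exists n', (catrev (decode 0 x) [::]); split=> //; lia.
Qed.

(** All cells being [false], the clock starts at the first leaf of the tree. *)
Definition fuel n := ascent (nseq n false) 0.

Lemma universalP x : accepted (@step universal) x <->
  exists2 n, n <= fuel (size x) & cacc n Rew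
      (tp (behead (map tk (catrev (decode 0 x) [::])))
         [:: head None (map tk (catrev (decode 0 x) [::]))])
      (stk (goal_stack [:: raw x])) (tp [::] [::]).
Proof.
have -> : accepted (@step universal) x <->
    exists n, frun (accq false) n (Setup false) (tp [::] (map dg x)) (tp [::] [::])
      (tp [::] [::]) (tp [::] [::]) (tp [::] [::]).
  have e n := frun_nsteps (accq false) n (init universal x).
  split=> [[n [c [hn hc]]]|[n h]].
    exists n; rewrite -ctape_init0 -[in X in frun _ _ _ _ X](@ctape_init x 1) //.
    rewrite -[in X in frun _ _ _ _ _ X](@ctape_init x 2) //.
    rewrite -[in X in frun _ _ _ _ _ _ X](@ctape_init x 3) //.
    rewrite -[in X in frun _ _ _ _ _ _ _ X](@ctape_init x 4) //.
    by apply/e; exists c => //; move: hc; rewrite inE.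
  have := e n; rewrite ctape_init0 !ctape_init // => /proj1/(_ h)[c' hn hc].
  by exists n, c'; rewrite inE.
have hx n := (ticksP n (nseq (size x) false) [::]).1.
split=> [[n /frun_init[[]//|[n' _ /frun_run[h /hx hn]]]]|[n' hn h]]; first by exists n'.
exists (size x + n'.+3); apply/frun_init; right; exists n' => //.
by apply/frun_run; split => //; apply/hx.
Qed.

(** Paths on which the core would run forever are cut as well, since the clock gets stuck at the
    root. *)
Lemma universal_time n x c : nsteps (@step universal) n (init universal x) c ->
  n <= size x + 3 + fuel (size x).
Proof.
move=> h; have := proj2 (frun_nsteps (accq true) n (init universal x)).
rewrite ctape_init0 !ctape_init // => k.
have /k/frun_init[[_]|[n' -> /frun_ticks]] : exists2 c',
  nsteps (@step universal) n (init universal x) c' & accq true c'.1 by exists c.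
- lia.
by rewrite (ticksP n' (nseq (size x) false) [::]).1 /fuel /=; lia.
Qed.

Lemma fuel_ge n : 2 ^ n <= fuel n + 1.
Proof. by have := ascent_ge n 0; rewrite addn0. Qed.

Lemma universal_NE : NE (accepted (@step universal)).
Proof.
exists 1 => //; exists universal, (fun n => n + 3 + fuel n); split => //.
  exists 8, 0 => n _; have := ascent_le n 0; rewrite mul1n addn0 expnD /fuel.
  have := ltn_expl n (isT : 1 < 2); lia.
by move=> x n c /universal_time.
Qed.

(** The reading phase leaves the head on the last instruction, where [Rew] begins. *)
Lemma prg_tail P : P != [::] -> exists pl i,
  catrev pl [:: i] = program P /\
  tp (behead (map tk (catrev (program P) [::]))) [:: head None (map tk (catrev (program P) [::]))]
   = prg pl [:: i].
Proof.
move=> P0; have : program P != [::].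
  case: P P0 => // r P _; rewrite /program /= /rule_code.
  by case: (itoks _).
case/lastP: (program P) => // s i _; exists (rev s), i.
by rewrite !catrevE revK cats1 cats0 rev_rcons.
Qed.

Lemma universal_sound P x : P != [::] -> decode 0 x = program P ->
  accepted (@step universal) x -> exists m, solve predT P m [:: raw x].
Proof.
move=> /prg_tail[pl [i [epl e]]] ex /universalP[n _]; rewrite ex e.
exact: core_sound epl.
Qed.

Lemma universal_complete (ok : pred (seq letter)) L P m x :
  P != [::] -> decode 0 x = program P -> (forall g, ok g -> size (enc g) <= L) ->
  solve ok P m [:: raw x] ->
  m.+1 * (10 * ((size (program P)).+1 * L.+1)) < 2 ^ size x ->
  accepted (@step universal) x.
Proof.
move=> /prg_tail[pl [i [epl e]]] ex okL hs hm; apply/universalP.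
have [t ht h] := core_complete okL hs epl.
by exists t; [have := fuel_ge (size x); lia | rewrite ex e].
Qed.

(** * Coding programs as inputs *)

Definition instr_word (i : instr) : seq bool := nseq (enum_rank i) true ++ [:: false].

Definition program_word (p : seq instr) : seq bool := flatten (map instr_word p).

Lemma decode_ones t n x : t + n <= ntok -> decode t (nseq n true ++ x) = decode (t + n) x.
Proof.
elim: n t => [|n ih] t h /=; first by rewrite addn0.
by rewrite ltn_eqF ?ih ?addSnnS //; lia.
Qed.

Lemma decode_program p x : decode 0 (program_word p ++ x) = p ++ decode 0 x.
Proof.
elim: p => //= i p ih; rewrite /instr_word -!catA decode_ones ?add0n 1?ltnW //=.
by rewrite ltn_eqF // /tok nth_enum_rank ih.
Qed.

Lemma decode_halt x : decode ntok x = [::].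
Proof. by elim: x => //= b x; rewrite eqxx. Qed.

(** [ntok] is the rank of no instruction: that many ones stop the decoding for good, and any tail,
    such as a block of zeros, leaves the program unchanged. *)
Lemma decode_word p n x : ntok <= n -> decode 0 (program_word p ++ nseq n true ++ x) = p.
Proof.
move=> hn; rewrite decode_program -(subnKC hn) nseqD -catA decode_ones //.
by rewrite decode_halt cats0.
Qed.

Lemma size_program_word p : size (program_word p) <= size p * ntok.
Proof.
elim: p => //= i p ih; rewrite size_cat mulSn leq_add // size_cat size_nseq addn1.
exact: ltn_ord.
Qed.

Definition sep := Hard 0.

Lemma soft_split z w a b g r : all soft z -> all soft w ->
  z ++ Hard a :: g = w ++ Hard b :: r -> [/\ z = w, a = b & g = r].
Proof.
elim: z w => [|x z ih] [|y w] //=.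
- by move=> _ _ [-> ->].
- by move=> _ /andP[sy _] [] e; rewrite -e in sy.
- by move=> /andP[sx _] _ [] e; rewrite e in sx.
move=> /andP[_ sz] /andP[_ sw] [-> /(ih _ sz sw)[-> -> ->]]; by split.
Qed.

Lemma isbit_soft w : all isbit w -> all soft w.
Proof. by apply: sub_all => -[]. Qed.

Lemma isbit_bits z : all isbit (bits z).
Proof. by elim: z. Qed.

Lemma soft_bits z : all soft (bits z).
Proof. exact/isbit_soft/isbit_bits. Qed.

Lemma trn_copy a b s w g o : all soft w ->
  trn (ICopy :: IM (Hard a) :: s) (w ++ Hard b :: g) o <->
  a = b /\ exists2 o', o = w ++ o' & trn s g o'.
Proof.
move=> sw; split=> [[z [g1 [o' [sz e -> [g' eg h]]]]]|[-> [o' -> h]]].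
  by rewrite {}eg in e; have [-> -> ->] := soft_split sw sz e; split=> //; exists o'.
by exists w, (Hard b :: g), o'; split => //; exists g.
Qed.

Lemma trn_drop a b s w g o : all soft w ->
  trn (IDrop :: IM (Hard a) :: s) (w ++ Hard b :: g) o <-> a = b /\ trn s g o.
Proof.
move=> sw; split=> [[z [g1 [sz e [g' eg h]]]]|[-> h]].
  by rewrite {}eg in e; have [_ -> ->] := soft_split sw sz e.
by exists w, (Hard b :: g); split => //; exists g.
Qed.

Lemma trn_IM a s b g o : trn (IM a :: s) (b :: g) o <-> a = b /\ trn s g o.
Proof. by split=> [[g' [-> ->]]|[-> h]] //; exists g. Qed.

Lemma trn_IE w s g o : trn (map IE w ++ s) g o <-> exists2 o', o = w ++ o' & trn s g o'.
Proof.
elim: w o => [|a w ih] o /=; first by split=> [h|[o' ->]] //; exists o.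
split=> [[o1 -> /ih[o' -> h]]|[o' -> h]]; first by exists o'.
by exists (w ++ o') => //; apply/ih; exists o'.
Qed.

(** * Computation steps as rules *)

Section Symbols.
Variable S : finType.

(** All symbols become soft letters, so that [ICopy] can pass over a whole half of a tape; bits
    remain bits, so that query words become fields as they are. *)
Definition lsym (a : symbol S) : letter :=
  match a with
  | Some (inl b) => Bit b | None => Soft 0 | Some (inr x) => Soft (pickle x).+1
  end.

Lemma lsym_inj : injective lsym.
Proof.
move=> [[b|x]|] [[c|y]|] //=; first by case=> ->.
by case=> e; rewrite (pcan_inj pickleK e).
Qed.

Lemma soft_lsym (l : seq (symbol S)) : all soft (map lsym l).
Proof. by elim: l => //= -[[b|x]|] l ->. Qed.

Definition tape_letters (t : tape S) : seq letter :=
  map lsym t.1 ++ sep :: map lsym t.2 ++ [:: sep].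

Lemma tape_letters_cat t g :
  tape_letters t ++ g = map lsym t.1 ++ sep :: map lsym t.2 ++ sep :: g.
Proof. by rewrite /tape_letters -catA /= -catA. Qed.

(** An empty list is told apart from a list starting with a blank: a rule must know whether there is
    a letter to consume. *)
Definition view := (option (symbol S) * option (symbol S))%type.

Definition tape_view (t : tape S) : view := (ohead t.1, ohead t.2).

Definition omatch (x : option (symbol S)) : seq item :=
  if x is Some y then [:: IM (lsym y)] else [::].
Definition ocopy (x : option (symbol S)) : seq item := if x is Some y then [:: ICopy] else [::].
Definition omap_letter (x : option (symbol S)) : seq letter :=
  if x is Some y then [:: lsym y] else [::].

(** If [x] is [None], nothing is copied and [IM sep] checks that the list is empty. *)
Definition field_items (x : option (symbol S)) (new : seq letter) : seq item :=
  omatch x ++ map IE new ++ ocopy x ++ [:: IM sep; IE sep].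

Lemma field_itemsP x new s (l : seq (symbol S)) g o :
  trn (field_items x new ++ s) (map lsym l ++ sep :: g) o <->
  x = ohead l /\ exists2 o', o = new ++ map lsym (behead l) ++ sep :: o' & trn s g o'.
Proof.
case: x => [y|]; case: l => [|y' l]; rewrite /field_items /= -?catA.
- by split=> [[g' [e]]|[]] //; case: y e => [[]|].
- have hc o1 : trn ([:: ICopy, IM sep, IE sep & s]) (map lsym l ++ sep :: g) o1 <->
     exists2 o', o1 = map lsym l ++ sep :: o' & trn s g o'.
    rewrite trn_copy ?soft_lsym //; split=> [[_ [o2 -> [o' -> h]]]|[o' -> h]]; first by exists o'.
    by split=> //; exists (sep :: o') => //; exists o'.
  split.
    case=> g' [/lsym_inj -> <-] /trn_IE[o1 ->] /hc[o' -> h].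
    by split=> //; exists o'.
  case=> -[->] [o' -> h]; exists (map lsym l ++ sep :: g) => //.
  by apply/trn_IE; eexists; [reflexivity|apply/hc; exists o'].
- rewrite trn_IE; split=> [[o1 -> [g' [<-] [o' -> h]]]|[_ [o' -> h]]].
    by split=> //; exists o'.
  by eexists; first reflexivity; exists g => //; exists o'.
rewrite trn_IE; split=> [[o1 -> [g' [e]]]|[]] //.
by case: y' e => [[]|].
Qed.

Definition left_letters (v : view) (am : symbol S * direction) : seq letter :=
  match am.2 with
  | Right => lsym am.1 :: omap_letter v.1 | Stay => omap_letter v.1 | Left => [::]
  end.
Definition right_letters (v : view) (am : symbol S * direction) : seq letter :=
  match am.2 with
  | Right => [::] | Stay => [:: lsym am.1] | Left => [:: lsym (odflt None v.1); lsym am.1]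
  end.

Definition tape_items (v : view) (am : symbol S * direction) : seq item :=
  field_items v.1 (left_letters v am) ++ field_items v.2 (right_letters v am).

Lemma tape_itemsP v am s t g o :
  trn (tape_items v am ++ s) (tape_letters t ++ g) o <->
  v = tape_view t /\
  exists2 o', o = tape_letters (write_move t am.1 am.2) ++ o' & trn s g o'.
Proof.
case: t v am => l r [v1 v2] [a m].
rewrite /tape_items -(catA (field_items _ _)) tape_letters_cat field_itemsP /tape_view /=.
split.
  case=> -> [o1 -> /field_itemsP[-> [o' -> h]]]; split=> //; exists o' => //.
  rewrite tape_letters_cat /left_letters /right_letters /=.
  by case: m; case: l => [|? l]; case: r => [|? r]; rewrite /= -?catA.
case=> -[-> ->] [o' -> h]; split=> //.
eexists; last by apply/field_itemsP; split=> //; exists o'.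
rewrite tape_letters_cat /left_letters /right_letters /=.
by case: m; case: l => [|? l]; case: r => [|? r]; rewrite /= -?catA.
Qed.

Definition ocheck (x : option (symbol S)) : check :=
  if x is Some y then [:: Some (lsym y); None] else [::].

Definition tape_check (v : view) : check :=
  ocheck v.1 ++ Some sep :: ocheck v.2 ++ [:: Some sep].

Lemma ocheckP x c (l : seq (symbol S)) g o :
  trn (map citem (ocheck x ++ Some sep :: c)) (map lsym l ++ sep :: g) o <->
  x = ohead l /\ trn (map citem c) g o.
Proof.
case: x => [y|]; case: l => [|y' l]; rewrite [map _ _]/=.
- by split=> [[g' [e]]|[]] //; case: y e => [[]|].
- rewrite [map lsym _]/= cat_cons trn_IM trn_drop ?soft_lsym //.
  by split=> [[/lsym_inj -> [_ h]]|[[->] h]].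
- by rewrite trn_IM; split=> [[]|[]].
by split=> [[g' [e]]|[]] //; case: y' e => [[]|].
Qed.

Lemma tape_checkP v c t g o :
  trn (map citem (tape_check v ++ c)) (tape_letters t ++ g) o <->
  v = tape_view t /\ trn (map citem c) g o.
Proof.
case: t v => l r [v1 v2].
rewrite /tape_check tape_letters_cat -catA cat_cons -catA !ocheckP /tape_view /=.
by split=> [[-> [-> h]]|[[-> ->] h]].
Qed.

Definition copy_tape : seq item := [:: ICopy; IM sep; IE sep; ICopy; IM sep; IE sep].

Lemma copy_tapeP s t g o :
  trn (copy_tape ++ s) (tape_letters t ++ g) o <->
  exists2 o', o = tape_letters t ++ o' & trn s g o'.
Proof.
rewrite tape_letters_cat [copy_tape ++ s]/= trn_copy ?soft_lsym //; split.
  case=> _ [o1 -> [o2 -> h]].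
  have [_ [o3 -> [o' -> {}h]]] := proj1 (trn_copy 0 0 (IE sep :: s) g o2 (soft_lsym t.2)) h.
  exists o' => //.
  by rewrite tape_letters_cat.
case=> o' -> h; split=> //.
exists (sep :: map lsym t.2 ++ sep :: o'); first by rewrite tape_letters_cat.
exists (map lsym t.2 ++ sep :: o') => //.
apply: (proj2 (trn_copy 0 0 (IE sep :: s) g _ (soft_lsym t.2))); split=> //.
by exists (sep :: o') => //; exists o'.
Qed.

Definition drop_tape : seq item := [:: IDrop; IM sep; IDrop; IM sep].

Lemma drop_tapeP s t g o :
  trn (drop_tape ++ s) (tape_letters t ++ g) o <-> trn s g o.
Proof.
rewrite tape_letters_cat [drop_tape ++ s]/= !trn_drop ?soft_lsym //.
by split=> [[_ []]|].
Qed.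

End Symbols.

Arguments lsym {S} a.

Section MachineRules.
Variables (X : ntm) (hd : bool -> state X -> letter).
Notation K := (work_tapes X).+1.
Implicit Types (c : config X) (v : {ffun 'I_K -> view (aux X)}).

Definition tapes_letters (T : {ffun 'I_K -> tape (aux X)}) : seq letter :=
  flatten [seq tape_letters (T i) | i <- enum 'I_K].

Definition config_letters md c : seq letter := hd md c.1 :: tapes_letters c.2.

Definition views c := [ffun i => tape_view (c.2 i)].

Definition reads v := [ffun i => odflt None (v i).2].

Lemma reads_views c : reads (views c) = [ffun i => scanned (c.2 i)].
Proof. by apply/ffunP => i; rewrite !ffunE /scanned; case: (c.2 i) => l []. Qed.

Definition act_on c (act : state X * {ffun 'I_K -> symbol (aux X) * direction}) : config X :=
  (act.1, [ffun i => write_move (c.2 i) (act.2 i).1 (act.2 i).2]).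

Definition actions c := enum (delta c.1 (reads (views c))).

Lemma stepP c c' : step c c' <-> exists2 act, act \in actions c & c' = act_on c act.
Proof.
by rewrite /step /actions reads_views; split=> -[act ha ->]; exists act;
  rewrite // ?mem_enum // -mem_enum.
Qed.

Definition step_items md v (act : state X * {ffun 'I_K -> symbol (aux X) * direction}) :=
  IE (hd md act.1) :: flatten [seq tape_items (v i) (act.2 i) | i <- enum 'I_K].

Lemma all_views v c : (forall i, i \in enum 'I_K -> v i = tape_view (c.2 i)) <-> v = views c.
Proof.
split=> [h|-> i _]; last by rewrite ffunE.
by apply/ffunP => i; rewrite h ?mem_enum // ffunE.
Qed.

Lemma step_itemsP md v act c o : trn (step_items md v act) (tapes_letters c.2) o <->
  v = views c /\ o = config_letters md (act_on c act).
Proof.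
rewrite -all_views /step_items /tapes_letters /config_letters /tapes_letters.
elim: (enum 'I_K) o => [|i s ih] o.
  by split=> [[o' -> ->]|[_ ->]] //; exists [::].
rewrite [flatten _]/= [in flatten (_ :: _)]/=; split.
  case=> o' -> /tape_itemsP[hv [o1 -> h]].
  have [hs [eo]] : (forall j, j \in s -> v j = tape_view (c.2 j)) /\
     hd md act.1 :: o1 = hd md (act_on c act).1 :: flatten [seq tape_letters ((act_on c act).2 j) | j <- s].
    by apply/ih; exists o1.
  split; last by rewrite eo /= ffunE.
  by move=> j; rewrite inE => /orP[/eqP ->|/hs].
case=> hv ->; eexists; first reflexivity.
apply/tape_itemsP; split; first by rewrite hv ?mem_head.
rewrite [map _ _]/= ffunE; eexists; first reflexivity.
have : exists2 o', hd md act.1 :: flatten [seq tape_letters ((act_on c act).2 j) | j <- s]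
    = hd md act.1 :: o' & trn (flatten [seq tape_items (v i) (act.2 i) | i <- s])
      (flatten [seq tape_letters (c.2 i) | i <- s]) o'.
  by apply/ih; split=> // j js; rewrite hv // inE js orbT.
by case=> _ [<-].
Qed.

Definition views_check v : check := flatten [seq tape_check (v i) | i <- enum 'I_K].

Lemma views_checkP v c : trn (map citem (views_check v)) (tapes_letters c.2) [::] <-> v = views c.
Proof.
rewrite -all_views /views_check /tapes_letters.
elim: (enum 'I_K) => [|i s ih] //.
rewrite [flatten _]/= [in flatten (_ :: _)]/= tape_checkP ih; split.
  by case=> hv hs j; rewrite inE => /orP[/eqP ->|/hs].
by move=> h; split=> [|j js]; apply: h; rewrite inE ?eqxx // js orbT.
Qed.

Definition copy_tapes : seq item := flatten [seq copy_tape | i <- enum 'I_K].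

Lemma copy_tapesP T o : trn copy_tapes (tapes_letters T) o <-> o = tapes_letters T.
Proof.
rewrite /copy_tapes /tapes_letters; elim: (enum 'I_K) o => [|i s ih] o //.
rewrite [flatten _]/= [in flatten (_ :: _)]/= copy_tapeP.
by split=> [[o' -> /ih ->]|->] //; eexists; [reflexivity|apply/ih].
Qed.

Definition acc_rules q : seq rule :=
  (if q \in accept X then [:: ([::], [::])] else [::]) ++
  [seq ([::], [:: step_items true p.1 p.2]) |
     p <- [seq (v, act) | v <- enum {: {ffun 'I_K -> view (aux X)}}, act <- enum (delta q (reads v))]].

(** The premises verify the view too, but a configuration without successors has no premises; there
    the explicit check alone ties the rule to the view. *)
Definition rej_rules q : seq rule :=
  if q \in accept X then [::] else
  [seq (views_check v, [seq step_items false v act | act <- enum (delta q (reads v))]) |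
     v <- enum {: {ffun 'I_K -> view (aux X)}}].

Lemma acc_rules_sound r c hs : r \in acc_rules c.1 -> fires r (tapes_letters c.2) hs ->
  (c.1 \in accept X /\ hs = [::]) \/
  (exists2 c', step c c' & hs = [:: config_letters true c']).
Proof.
rewrite mem_cat => /orP[|].
  case: ifP => // ha; rewrite inE => /eqP -> [_]; case: hs => // _; by left.
case/mapP => -[v act] /allpairsPdep[v' [act' [_ ha [-> ->]]]] -> [_].
case: hs => // o [|? ?] /= [] // /step_itemsP[ev ->] _; right.
exists (act_on c act') => //; apply/stepP; exists act' => //.
by rewrite /actions -ev.
Qed.

Lemma acc_rules_accept c : c.1 \in accept X ->
  exists2 r, r \in acc_rules c.1 & fires r (tapes_letters c.2) [::].
Proof. by move=> ha; exists ([::], [::]); rewrite // /acc_rules ha mem_cat mem_head. Qed.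

Lemma acc_rules_step c c' : step c c' ->
  exists2 r, r \in acc_rules c.1 & fires r (tapes_letters c.2) [:: config_letters true c'].
Proof.
case/stepP => act ha ->; exists ([::], [:: step_items true (views c) act]).
  rewrite mem_cat; apply/orP; right; apply/mapP; exists (views c, act) => //.
  by apply/allpairsPdep; exists (views c), act; split=> //; rewrite mem_enum.
by split=> //=; split=> //; apply/step_itemsP.
Qed.

Definition successors c := [seq act_on c act | act <- actions c].

Lemma rej_rules_sound r c hs : r \in rej_rules c.1 -> fires r (tapes_letters c.2) hs ->
  c.1 \notin accept X /\ hs = map (config_letters false) (successors c).
Proof.
rewrite /rej_rules; case: ifP => // /negbT ha /mapP[v _ ->] [/views_checkP ev ht].
split=> //; rewrite /successors /actions -ev; move: ht => /=.
elim: (enum _) hs => [|act s ih] [|h hs] //= [/step_itemsP[_ ->] /ih ->] //.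
Qed.

Lemma rej_rules_complete c : c.1 \notin accept X ->
  exists2 r, r \in rej_rules c.1 &
    fires r (tapes_letters c.2) (map (config_letters false) (successors c)).
Proof.
move=> ha; exists (views_check (views c), [seq step_items false (views c) act | act <- actions c]).
  by rewrite /rej_rules (negbTE ha); apply/mapP; exists (views c); rewrite ?mem_enum.
split; first exact/views_checkP.
by rewrite /successors /=; elim: (actions c) => //= act s ih; split=> //; apply/step_itemsP.
Qed.

Lemma size_successors c : size (successors c) <=
  #|{: state X * {ffun 'I_K -> symbol (aux X) * direction}}|.
Proof. by rewrite size_map -cardE max_card. Qed.

End MachineRules.

(** * Rules on words cut into fields *)

Definition fields (l : seq (seq bool)) : seq letter := flatten [seq bits t ++ [:: sep] | t <- l].

Lemma fields_cons t l : fields (t :: l) = bits t ++ sep :: fields l.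
Proof. by rewrite /fields /= -catA. Qed.

(* Operations on a word cut into fields: copy, drop, guess a field, insert a constant one,
   match the first bit of the current field, match an empty field, split a field in two,
   and replace the last bit of a field by a word. *)
Inductive field_op := FC | FD | FG | FK of seq bool | FM of bool | FE | FS
  | FL of bool & seq bool.

(** In [FS] and [FL] the first gap stops at a guessed place: anywhere in the field for [FS], while
    the two matches that follow in [FL] leave only the place before the last bit. *)
Definition field_op_items (f : field_op) : seq item :=
  match f with
  | FC => [:: ICopy; IM sep; IE sep]
  | FD => [:: IDrop; IM sep]
  | FG => [:: IGuess; IE sep]
  | FK z => map IE (bits z ++ [:: sep])
  | FM b => [:: IM (Bit b)]
  | FE => [:: IM sep]
  | FS => [:: ICopy; IE sep; ICopy; IM sep; IE sep]
  | FL b w => [:: ICopy; IM (Bit b)] ++ map IE (bits w) ++ [:: IM sep; IE sep]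
  end.

Definition ops_items (s : seq field_op) := flatten (map field_op_items s).

Fixpoint oprel (s : seq field_op) (l l' : seq (seq bool)) : Prop :=
  match s with
  | [::] => l' = [::]
  | FC :: s => if l is t :: l1 then exists2 l2, l' = t :: l2 & oprel s l1 l2 else False
  | FD :: s => if l is t :: l1 then oprel s l1 l' else False
  | FG :: s => exists m l2, l' = m :: l2 /\ oprel s l l2
  | FK z :: s => exists2 l2, l' = z :: l2 & oprel s l l2
  | FM b :: s => if l is (c :: t) :: l1 then b = c /\ oprel s (t :: l1) l' else False
  | FE :: s => if l is [::] :: l1 then oprel s l1 l' else False
  | FS :: s => if l is t :: l1 then
      exists x y l2, [/\ t = x ++ y, l' = [:: x, y & l2] & oprel s l1 l2] else False
  | FL b w :: s => if l is t :: l1 then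
      exists t1 l2, [/\ t = rcons t1 b, l' = (t1 ++ w) :: l2 & oprel s l1 l2] else False
  end.

Lemma bits_cat u v : bits (u ++ v) = bits u ++ bits v.
Proof. exact: map_cat. Qed.

Lemma bits_split t z u : bits t = z ++ u -> exists x y, [/\ t = x ++ y, z = bits x & u = bits y].
Proof.
elim: t z => [|b t ih] [|c z] //=; first by exists [::], [::]; split=> //; case: (u) H.
  by move=> <-; exists [::], (b :: t).
by case=> <- /ih[x [y [-> -> ->]]]; exists (b :: x), y.
Qed.

Lemma ops_itemsP s l o :
  trn (ops_items s) (fields l) o <-> exists2 l', o = fields l' & oprel s l l'.
Proof.
elim: s l o => [|f s ih] l o.
  by split=> [->|[l' -> ->]]; first by exists [::].
rewrite /ops_items /= -/(ops_items s).
case: f => [||| z|b||| b w] /=.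
- case: l => [|t l].
    by split=> [[z [g' [o' [_ e _ [g1 eg]]]]]|[]] //; rewrite eg in e; case: z e.
  rewrite fields_cons -/(trn (ICopy :: IM (Hard 0) :: IE sep :: ops_items s) _ _) trn_copy ?soft_bits //.
  split=> [[_ [o1 -> [o2 -> /ih[l' -> h]]]]|[l1 -> [l' -> h]]].
    by exists (t :: l'); [rewrite fields_cons|exists l'].
  split=> //; rewrite fields_cons; eexists; first reflexivity.
  by eexists; first reflexivity; apply/ih; exists l'.
- case: l => [|t l].
    by split=> [[z [g' [_ e [g1 eg]]]]|[]] //; rewrite eg in e; case: z e.
  rewrite fields_cons -/(trn (IDrop :: IM (Hard 0) :: ops_items s) _ _) trn_drop ?soft_bits // ih.
  by split=> [[]|].
- split=> [[z [o' [-> [o1 -> /ih[l' -> h]]]]]|[l1 -> [z [l' [-> h]]]]].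
    by exists (z :: l'); [rewrite fields_cons|exists z, l'].
  exists z, (sep :: fields l'); rewrite fields_cons; split=> //.
  by eexists; first reflexivity; apply/ih; exists l'.
- rewrite trn_IE; split=> [[o' -> /ih[l' -> h]]|[l1 -> [l' -> h]]].
    by exists (z :: l'); [rewrite fields_cons -catA|exists l'].
  exists (fields l'); first by rewrite fields_cons -catA.
  by apply/ih; exists l'.
- split.
    case: l => [|[|c t] l] [g' e] //; move: e; rewrite fields_cons /= => -[-> <-].
    rewrite -[_ ++ _]fields_cons => /ih[l' -> h]; by exists l'.
  case=> l'; case: l => [|[|c t] l] // -> [-> h]; exists (fields (t :: l)).
    by rewrite !fields_cons.
  by apply/ih; exists l'.
- split.
    case: l => [|[|c t] l] [g' e] //; move: e; rewrite fields_cons /= => -[<-].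
    by move/ih.
  case=> l'; case: l => [|[|c t] l] // -> h; exists (fields l) => //.
  by apply/ih; exists l'.
- case: l => [|t l].
    split=> [[z [g' [o' [sz e _ [o1 _ [z' [g1 [o2 [sz' e' _ [g2 e2]]]]]]]]]]|[]] //.
    by rewrite e' e2 in e; case: z {sz} e => //; case: z' {sz' e'}.
  split.
    case=> z [g' [o' [sz e -> [o1 -> [z' [g1 [o2 [sz' e' -> [g2 e2 [o3 -> h]]]]]]]]]].
    rewrite fields_cons e' e2 catA in e.
    have szz : all soft (z ++ z') by rewrite all_cat sz.
    have [ez _ eg] := soft_split szz (soft_bits t) (esym e).
    have [x [y [-> -> ->]]] := bits_split (esym ez).
    rewrite eg in h; case/ih: h => l' -> h; exists [:: x, y & l'].
      by rewrite !fields_cons.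
    by exists x, y, l'.
  case=> l1 -> [x [y [l' [-> -> h]]]]; exists (bits x), (bits y ++ sep :: fields l).
  exists (sep :: bits y ++ sep :: fields l'); rewrite !fields_cons bits_cat -catA soft_bits.
  split=> //; eexists; first reflexivity.
  exists (bits y), (sep :: fields l), (sep :: fields l'); rewrite soft_bits; split=> //.
  eexists; first reflexivity; eexists; first reflexivity.
  by apply/ih; exists l'.
case: l => [|t l].
  by split=> [[z [g' [o' [_ e _ [g1 eg]]]]]|[]] //; rewrite eg in e; case: z e.
split.
  case=> z [g' [o' [sz e -> [g1 eg h]]]].
  move: h; rewrite -catA => /trn_IE[o1 -> [g2 eg2 [o2 -> h]]].
  rewrite fields_cons eg eg2 -(cat_rcons (Bit b)) in e.
  have szz : all soft (rcons z (Bit b)) by rewrite all_rcons.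
  have [ez _ eg'] := soft_split szz (soft_bits t) (esym e).
  case/lastP: t ez e => [|t c]; first by case: z {sz szz}.
  rewrite /bits map_rcons => /rcons_inj[-> ->] _.
  rewrite eg' in h; case/ih: h => l' -> h; exists ((t ++ w) :: l').
    by rewrite fields_cons bits_cat -catA.
  by exists t, l'.
case=> l1 -> [t1 [l' [-> -> h]]]; exists (bits t1), (Bit b :: sep :: fields l).
exists (bits w ++ sep :: fields l'); rewrite !fields_cons bits_cat soft_bits /bits map_rcons cat_rcons -catA.
split=> //; eexists; first reflexivity.
rewrite -catA; apply/trn_IE; eexists; first reflexivity; eexists; first reflexivity.
by eexists; first reflexivity; apply/ih; exists l'.
Qed.

Inductive field_check := CM of bool | CE | CD.

Definition field_check_items (f : field_check) : check :=
  match f with CM b => [:: Some (Bit b)] | CE => [:: Some sep] | CD => [:: None; Some sep] end.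

Fixpoint crel (s : seq field_check) (l : seq (seq bool)) : Prop :=
  match s, l with
  | [::], _ => True
  | CM b :: s, (c :: t) :: l => b = c /\ crel s (t :: l)
  | CE :: s, [::] :: l => crel s l
  | CD :: s, _ :: l => crel s l
  | _, _ => False
  end.

Lemma field_checkP s l :
  trn (map citem (flatten (map field_check_items s))) (fields l) [::] <-> crel s l.
Proof.
elim: s l => [|f s ih] l //; rewrite [flatten _]/= map_cat.
case: f => [b||] /=; case: l => [|[|c t] l]; try by split=> // -[g' e].
- rewrite fields_cons /= -[_ ++ _]fields_cons -ih.
  by split=> [[g' [-> ->]]|[-> h]] //; exists (fields (t :: l)).
- by rewrite fields_cons -ih; split=> [[g' [->]]|h] //; exists (fields l).
- by split=> [[z [g' [_ e [g1 eg]]]]|] //; rewrite eg in e; case: z e.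
- rewrite fields_cons -(ih l) -/(trn (IDrop :: IM (Hard 0) :: _) _ _) trn_drop //.
  by split=> [[]|].
rewrite fields_cons -(ih l) -/(trn (IDrop :: IM (Hard 0) :: _) _ _) trn_drop ?soft_bits //.
by split=> [[]|].
Qed.

Definition field_rule := (seq field_check * seq (letter * seq field_op))%type.

Definition compile_rule (r : field_rule) : rule :=
  (flatten (map field_check_items r.1), [seq IE p.1 :: ops_items p.2 | p <- r.2]).

Fixpoint oprels (ps : seq (letter * seq field_op)) (l : seq (seq bool)) (hs : seq (seq letter)) : Prop :=
  match ps, hs with
  | [::], [::] => True
  | p :: ps', h :: hs' => (exists2 l', h = p.1 :: fields l' & oprel p.2 l l') /\ oprels ps' l hs'
  | _, _ => False
  end.

Lemma fires_compile r l hs : fires (compile_rule r) (fields l) hs <-> crel r.1 l /\ oprels r.2 l hs.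
Proof.
rewrite /fires field_checkP; case: r => c ps /=.
suff -> : trns [seq IE p.1 :: ops_items p.2 | p <- ps] (fields l) hs <-> oprels ps l hs by [].
elim: ps hs => [|p ps ih] [|h hs] //=.
rewrite ih; split=> -[[x]].
  by move=> -> /ops_itemsP[l' -> hl] ?; split=> //; exists l'.
by move=> -> hl ?; split=> //; exists (fields x) => //; apply/ops_itemsP; exists x.
Qed.

(** Each premise reads the goal again from its beginning, hence also has to pass the head letter. *)
Definition headed (a : letter) (r : rule) : rule := (Some a :: r.1, [seq IM a :: p | p <- r.2]).

Lemma fires_headed a r b w hs : fires (headed a r) (b :: w) hs <-> a = b /\ fires r w hs.
Proof.
case: r => c ps; rewrite /fires /headed /= -/(trn (IM a :: map citem c) (b :: w) [::]) trn_IM.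
have e : a = b -> trns [seq IM a :: p | p <- ps] (b :: w) hs <-> trns ps w hs.
  move=> ->; elim: ps hs => [|p ps ih] [|h hs] //=.
  by rewrite ih; split=> -[h1 h2]; split=> //; [case: h1 => g' [->]|exists w].
by split=> [[[eab h1] h2]|[eab [h1 h2]]]; split=> //; [split=> //|]; apply/(e eab).
Qed.

(** * The diagonal program *)

(* The meaning of each predicate is given by [psem] below. *)
Inductive pred_name := PIn | PNot | PD | PD1 | PCh | PChS | PLen | PLenS | PLt | PNeq | PPad
  | PStrip.

Definition pred_code (p : pred_name) : 'I_12 :=
  inord match p with
  | PIn => 0 | PNot => 1 | PD => 2 | PD1 => 3 | PCh => 4 | PChS => 5 | PLen => 6
  | PLenS => 7 | PLt => 8 | PNeq => 9 | PPad => 10 | PStrip => 11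
  end.
Definition pred_decode (i : 'I_12) : pred_name :=
  nth PStrip [:: PIn; PNot; PD; PD1; PCh; PChS; PLen; PLenS; PLt; PNeq; PPad] i.
Lemma pred_codeK : cancel pred_code pred_decode.
Proof. by case; rewrite /pred_decode inordK. Qed.
HB.instance Definition _ := Finite.copy pred_name (can_type pred_codeK).

(** Lexicographic order, with the empty word as least element. Increasing chains are used to list
    distinct words. *)
Fixpoint wlt (t u : seq bool) : bool :=
  match t, u with
  | [::], _ :: _ => true
  | a :: t, b :: u => if a == b then wlt t u else ~~ a
  | _, _ => false
  end.

Lemma wlt_irr t : wlt t t = false.
Proof. by elim: t => //= a t ->; rewrite eqxx. Qed.

Lemma wlt_trans : transitive wlt.
Proof.
move=> u t v; elim: t u v => [|a t ih] [|b u] [|c v] //=.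
by case: a; case: b; case: c => //=; apply: ih.
Qed.

Lemma wlt_total t u : t != u -> wlt t u || wlt u t.
Proof.
elim: t u => [|a t ih] [|b u] //=.
by case: a; case: b => //= h; apply: ih; apply: contra h => /eqP ->.
Qed.

Fixpoint bval (l : seq bool) : nat := if l is b :: l' then b * 2 ^ size l' + bval l' else 0.

Section Program.
Variables (M : ntm) (N : oracle_ntm) (kap bet : seq bool).

Definition head_name := option (bool * (state M + state N) + pred_name)%type.

(** [None] gets [Hard 0], the letter with which the initial goal [raw x] begins. *)
Definition hl (h : head_name) : letter := Hard (if h is Some x then (pickle x).+1 else 0).

Lemma hl_inj : injective hl.
Proof. by move=> [x|] [y|] //= [] /(pcan_inj pickleK) ->. Qed.

Definition hM md (q : state M) := hl (Some (inl (md, inl q))).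
Definition hN md (q : state N) := hl (Some (inl (md, inr q))).
Definition hp (p : option pred_name) := hl (omap inr p).

(** An initial configuration is itself a list of fields: the empty left part of the input tape, the
    input, and two empty fields for each blank tape. *)
Definition init_ops (X : ntm) (f : field_op) : seq field_op :=
  [:: FK [::], f & nseq (work_tapes X).*2 (FK [::])].

(* [kap] is only used for its length: queries have length at most [2 ^ size kap].  [bet] is
   the binary expansion of the number of nonempty words of [A] of at most this length, so that
   [~ A s] can be certified by a chain of [bval bet] words of [A] other than [s]; the chain
   is guessed by halving ([PD], [PCh]), in order to keep the goals short. *)
Definition pred_rules (p : option pred_name) : seq field_rule :=
  match p with
  | None =>
    [:: ([::], [:: (hp (Some PPad), [:: FL true [:: true; false]])]);
        ([::], [:: (hp (Some PStrip), [:: FL false [::]])])]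
  | Some PPad =>
    [:: ([::], [:: (hp (Some PPad), [:: FL false [:: false; false]])]);
        ([::], [:: (hN true (start N), init_ops N FC)])]
  | Some PStrip =>
    [:: ([::], [:: (hp (Some PStrip), [:: FL false [::]])]);
        ([::], [:: (hN false (start N), init_ops N (FL true [:: true]))])]
  | Some PIn => [:: ([::], [:: (hM true (start M), init_ops M FC)])]
  | Some PNot =>
    [:: ([::], [:: (hM false (start M), init_ops M FC)]);
        ([::], [:: (hp (Some PLt), [:: FK [::]; FC]); (hp (Some PLen), [:: FK kap; FC]);
                   (hp (Some PD), [:: FK bet; FK [::]; FC])])]
  | Some PD =>
    [:: ([:: CE], [::]);
        ([::], [:: (hp (Some PD), [:: FM false; FC; FC; FC])]);
        ([::], [:: (hp (Some PD1), [:: FM true; FC; FC; FG; FC])])]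
  | Some PD1 =>
    [:: ([::], [:: (hp (Some PCh), [:: FC; FC; FC; FC]); (hp (Some PD), [:: FC; FD; FC; FC])])]
  | Some PCh =>
    [:: ([::], [:: (hp (Some PChS), [:: FM false; FC; FC; FG; FC; FC])]);
        ([::], [:: (hp (Some PChS), [:: FM true; FC; FC; FG; FC; FC])]);
        ([::], [:: (hp (Some PLt), [:: FE; FC; FC]); (hp (Some PNeq), [:: FE; FD; FC; FC]);
                   (hp (Some PLen), [:: FE; FK kap; FD; FC]); (hp (Some PIn), [:: FE; FD; FC])])]
  | Some PChS =>
    [:: ([::], [:: (hp (Some PCh), [:: FC; FC; FC; FD; FC]);
                   (hp (Some PCh), [:: FC; FD; FC; FC; FC])])]
  | Some PLen =>
    [:: ([::], [:: (hp (Some PLenS), [:: FM false; FC; FS])]);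
        ([::], [:: (hp (Some PLenS), [:: FM true; FC; FS])]);
        ([:: CE; CE], [::]); ([:: CE; CM false; CE], [::]); ([:: CE; CM true; CE], [::])]
  | Some PLenS =>
    [:: ([::], [:: (hp (Some PLen), [:: FC; FC; FD]); (hp (Some PLen), [:: FC; FD; FC])])]
  | Some PLt =>
    [:: ([::], [:: (hp (Some PLt), [:: FM false; FC; FM false; FC])]);
        ([::], [:: (hp (Some PLt), [:: FM true; FC; FM true; FC])]);
        ([:: CE; CM false], [::]); ([:: CE; CM true], [::]); ([:: CM false; CD; CM true], [::])]
  | Some PNeq =>
    [:: ([::], [:: (hp (Some PNeq), [:: FM false; FC; FM false; FC])]);
        ([::], [:: (hp (Some PNeq), [:: FM true; FC; FM true; FC])]);
        ([:: CE; CM false], [::]); ([:: CE; CM true], [::]); ([:: CM false; CD; CM true], [::]);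
        ([:: CM true; CD; CM false], [::]); ([:: CM false; CD; CE], [::]); ([:: CM true; CD; CE], [::])]
  end.

(** What can follow the query word on the oracle tape. Matching one of these letters after [IBits]
    forces the copied block of bits to be maximal, as in [tape_word]. *)
Definition non_bits : seq letter :=
  sep :: [seq lsym a | a <- enum {: symbol (aux N)} & ~~ isbit (lsym a)].

Definition query_items (h y : letter) : seq item :=
  flatten (nseq (oracle_tape N) drop_tape) ++ [:: IDrop; IM sep; IE h; IBits; IE sep; IM y].

Definition query_rules md : seq rule :=
  flatten [seq [:: ([::], [:: query_items (hp (Some PIn)) y; IE (hN md (yes N)) :: copy_tapes N]);
                   ([::], [:: query_items (hp (Some PNot)) y; IE (hN md (Defs.no N)) :: copy_tapes N])]
          | y <- non_bits].

(** An accepting query state gets the ordinary rules: its configurations are accepted whatever the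
    answer of the oracle. *)
Definition head_rules (h : head_name) : seq rule :=
  match h with
  | None => map compile_rule (pred_rules None)
  | Some (inr p) => map compile_rule (pred_rules (Some p))
  | Some (inl (md, inl q)) => if md then acc_rules hM q else rej_rules hM q
  | Some (inl (md, inr q)) =>
      if (q == query N) && (q \notin accept N) then query_rules md
      else if md then acc_rules hN q else rej_rules hN q
  end.

Definition prog : seq rule :=
  flatten [seq [seq headed (hl h) r | r <- head_rules h] | h <- enum {: head_name}].

Lemma prog_fires r h w hs : r \in prog -> fires r (hl h :: w) hs ->
  exists2 r', r' \in head_rules h & fires r' w hs.
Proof.
case/flattenP => s /mapP[h' _ ->] /mapP[r' hr ->] /fires_headed[/hl_inj <- hf].
by exists r'.
Qed.

Lemma prog_mem r h w hs : r \in head_rules h -> fires r w hs ->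
  exists2 r', r' \in prog & fires r' (hl h :: w) hs.
Proof.
move=> hr hf; exists (headed (hl h) r); last by apply/fires_headed.
apply/flattenP; exists [seq headed (hl h) r | r <- head_rules h]; last exact: map_f.
by apply/mapP; exists h; rewrite ?mem_enum.
Qed.
End Program.

(** * Soundness of the diagonal program *)

Lemma bits_prefix_split (S : finType) (r : seq (symbol S)) z y g g' : all isbit z -> ~~ isbit y ->
  map lsym r ++ sep :: g = z ++ y :: g' -> z = bits (bit_prefix r).
Proof.
elim: r z => [|a r ih] [|c z] //=.
- by case: c.
- by case: a => [[b|x]|] //= _ ny [e]; rewrite -e in ny.
by move=> /andP[hc hz] ny [e1 /(ih _ hz ny) ->]; case: a e1 hc => [[b|x]|] /= <-.
Qed.

Section Soundness.
Variables (M : ntm) (N : oracle_ntm) (A : language) (kap bet : seq bool).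

Lemma bits_prefix_ex (r : seq (symbol (aux N))) g : exists2 y, y \in non_bits N &
  exists g', map lsym r ++ sep :: g = bits (bit_prefix r) ++ y :: g'.
Proof.
elim: r => [|a r [y hy [g' e]]] /=.
  by exists sep; [exact: mem_head|exists g].
have h (b : symbol (aux N)) : ~~ isbit (lsym b) -> lsym b \in non_bits N.
  by move=> nb; rewrite inE; apply/orP; right; apply/mapP; exists b; rewrite // mem_filter nb mem_enum.
case: a => [[b|x]|].
- by exists y => //; exists g'; rewrite /= e.
- exists (lsym (Some (inr x) : symbol (aux N))); [exact: h|by eexists].
exists (lsym (None : symbol (aux N))); [exact: h|by eexists].
Qed.

Lemma non_bitsP y : y \in non_bits N -> ~~ isbit y.
Proof. by rewrite inE => /orP[/eqP ->|/mapP[a]] //; rewrite mem_filter => /andP[h _ ->]. Qed.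

Lemma drop_tapesP (T : 'I_(work_tapes N).+1 -> tape (aux N)) s r g o :
  trn (flatten (nseq (size s) drop_tape) ++ r) (flatten [seq tape_letters (T i) | i <- s] ++ g) o
  <-> trn r g o.
Proof.
elim: s => [|i s ih] //.
have -> : flatten (nseq (size (i :: s)) drop_tape) = drop_tape ++ flatten (nseq (size s) drop_tape) by [].
have -> : flatten [seq tape_letters (T i0) | i0 <- i :: s] =
  tape_letters (T i) ++ flatten [seq tape_letters (T i) | i <- s] by [].
by rewrite -(catA drop_tape (flatten _) r) -(catA (tape_letters _)) drop_tapeP.
Qed.

Lemma tapes_letters_split (T : {ffun 'I_(work_tapes N).+1 -> tape (aux N)}) (i : 'I_(work_tapes N).+1) :
  tapes_letters T = flatten [seq tape_letters (T j) | j <- take i (enum 'I_(work_tapes N).+1)] ++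
    (tape_letters (T i) ++ flatten [seq tape_letters (T j) | j <- drop i.+1 (enum 'I_(work_tapes N).+1)]).
Proof.
rewrite /tapes_letters -{1}(cat_take_drop i (enum _)) map_cat flatten_cat.
by rewrite (drop_nth i) ?size_enum_ord // nth_ord_enum.
Qed.

Lemma query_itemsP h (T : {ffun 'I_(work_tapes N).+1 -> tape (aux N)}) o :
  (exists2 y, y \in non_bits N & trn (query_items N h y) (tapes_letters T) o) <->
  o = h :: fields [:: tape_word (T (oracle_tape N))].
Proof.
set i := oracle_tape N.
have e o1 y : trn (query_items N h y) (tapes_letters T) o1 <->
  trn [:: IDrop; IM sep; IE h; IBits; IE sep; IM y] (tape_letters (T i) ++
    flatten [seq tape_letters (T j) | j <- drop i.+1 (enum 'I_(work_tapes N).+1)]) o1.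
  rewrite (tapes_letters_split T i) /query_items.
  have {1}-> : nat_of_ord (oracle_tape N) = size (take i (enum 'I_(work_tapes N).+1)).
    by rewrite size_takel // size_enum_ord ltnW.
  exact: drop_tapesP.
have {}e o1 y : trn (query_items N h y) (tapes_letters T) o1 <->
  trn [:: IE h; IBits; IE sep; IM y] (map lsym (T i).2 ++ sep ::
    flatten [seq tape_letters (T j) | j <- drop i.+1 (enum 'I_(work_tapes N).+1)]) o1.
  rewrite e tape_letters_cat trn_drop ?soft_lsym //.
  by split=> [[]|].
rewrite fields_cons; split.
  case=> y /non_bitsP ny h1; case: (proj1 (e _ y) h1) => o1 -> [z [g [o2 [hz eg ->]]]] [o3 -> [g' e' ->]].
  by rewrite e' in eg; rewrite (bits_prefix_split hz ny eg).
move=> ->; have [y hy [g' eg]] := bits_prefix_ex (T i).2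
  (flatten [seq tape_letters (T j) | j <- drop i.+1 (enum 'I_(work_tapes N).+1)]).
exists y => //; apply: (proj2 (e _ y)); rewrite eg; eexists; first reflexivity.
exists (bits (tape_word (T i))), (y :: g'), [:: sep].
by split=> //; [exact: isbit_bits|exists [::] => //; exists g'].
Qed.

Inductive goal := GM of bool & config M | GN of bool & config N
  | GF of option pred_name & seq (seq bool).

Definition goal_letters (x : goal) : seq letter :=
  match x with
  | GM md c => config_letters (@hM M N) md c
  | GN md c => config_letters (@hN M N) md c
  | GF p l => hp M N p :: fields l
  end.

Lemma init_opsP (X : ntm) f l l' : oprel (init_ops X f) l l' ->
  exists2 l1, oprel [:: f] l l1 & l' = [::] :: l1 ++ nseq (work_tapes X).*2 [::].
Proof.
have h k l1 l2 : oprel (nseq k (FK [::])) l1 l2 -> l2 = nseq k [::].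
  by elim: k l2 => //= k ih l2 [l3 -> /ih ->].
rewrite /init_ops => -[l1 ->]; case: f => [||| z|b||| b w] /=.
- by case: l => // t l [l2 -> /h ->]; exists [:: t] => //; exists [::].
- by case: l => // t l /h ->; exists [::].
- by case=> m [l2 [-> /h ->]]; exists [:: m] => //; exists m, [::].
- by move=> [l2 -> /h ->]; exists [:: z] => //; exists [::].
- by case: l => // -[] // c t l [-> /h ->]; exists [::].
- by case: l => // -[] // l /h ->; exists [::].
- by case: l => // t l [x [y [l2 [-> -> /h ->]]]]; exists [:: x; y] => //; exists x, y, [::].
by case: l => // t l [x [l2 [-> -> /h ->]]]; exists [:: x ++ w] => //; exists x, [::].
Qed.

Lemma init_letters (X : ntm) (hd : bool -> state X -> letter) md x :
  config_letters hd md (init X x) =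
  hd md (start X) :: fields ([::] :: x :: nseq (work_tapes X).*2 [::]).
Proof.
rewrite /config_letters /tapes_letters enum_ordSl /= ffunE eqxx.
rewrite !fields_cons /tape_letters /= -catA /=; congr [:: _, _ & _].
rewrite -map_comp (eq_map (g := Bit)) //; congr (_ ++ _ :: _).
rewrite -map_comp (eq_map (g := fun=> [:: sep; sep])); last by move=> i; rewrite /= ffunE.
rewrite -[work_tapes X in RHS](size_enum_ord); elim: (enum _) => //= i s ->.
by rewrite fields_cons fields_cons.
Qed.
End Soundness.

Definition leads (X : ntm) (R : config X -> config X -> Prop) (c : config X) : Prop :=
  exists n c', nsteps R n c c' /\ c'.1 \in accept X.

Lemma leads_accept (X : ntm) R (c : config X) : c.1 \in accept X -> leads R c.
Proof. by move=> h; exists 0, c. Qed.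

Lemma leads_step (X : ntm) R (c d : config X) : R c d -> leads R d -> leads R c.
Proof. by move=> h [n [c' [hn hc]]]; exists n.+1, c'; split=> //; exists d. Qed.

Lemma leadsE (X : ntm) R (c : config X) : leads R c ->
  c.1 \in accept X \/ exists2 d, R c d & leads R d.
Proof.
case=> -[|n] [c' [hn hc]]; first by left; rewrite [c]hn.
by case: hn => d hd hn; right; exists d => //; exists n, c'.
Qed.

Section Soundness.
Variables (M : ntm) (N : oracle_ntm) (A : language) (kap bet : seq bool).

Notation accM := (leads (@step M)).
Notation accN := (leads (@oracle_step N A)).
Notation LN x := (accN (init N x)).

Hypothesis AM : forall s, A s <-> accM (init M s).

Definition good (s x : seq bool) := [/\ A x, size x <= 2 ^ size kap & x != s].

(** The chain starts strictly above [t] and ends at [u], so that consecutive segments concatenate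
    without overlap. *)
Definition seg k t u s := exists l, [/\ size l = k, path wlt t l, last t l = u &
  forall x, x \in l -> good s x].

Hypothesis census : forall l, uniq l ->
  (forall x, x \in l -> [/\ A x, size x <= 2 ^ size kap & x != [::]]) -> size l <= bval bet.

Lemma seg_cat j k t m u s : seg j t m s -> seg k m u s -> seg (j + k) t u s.
Proof.
case=> l1 [<- p1 e1 h1] [l2 [<- p2 e2 h2]]; exists (l1 ++ l2).
split; rewrite ?size_cat ?cat_path ?last_cat ?e1 ?p1 //.
by move=> x; rewrite mem_cat => /orP[/h1|/h2].
Qed.

Lemma seg0 t s : seg 0 t t s.
Proof. by exists [::]. Qed.

(** If [A s] held, [s] and the chain together would be one word too many for the census. *)
Lemma census_notin u s : seg (bval bet) [::] u s -> wlt [::] s -> size s <= 2 ^ size kap -> ~ A s.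
Proof.
case=> l [sl pl _ hl] s0 ss As.
have lt0 x : x \in l -> wlt [::] x.
  by move: pl; rewrite (path_sortedE wlt_trans) => /andP[/allP h _]; apply: h.
have snl : s \notin l by apply/negP => /hl[_ _ /eqP].
have ul : uniq l.
  have := path_sorted pl; apply: (sorted_uniq wlt_trans); exact: wlt_irr.
have := census (l := s :: l); rewrite /= snl ul sl => /(_ isT).
move=> h; suff : bval bet < bval bet by rewrite ltnn.
apply: h => x; rewrite inE => /orP[/eqP ->|xl].
  by split=> //; case: (s) s0.
by have [? ? _] := hl x xl; split=> //; case: (x) (lt0 x xl).
Qed.

(** Malformed goals mean [True], which makes every rule sound on them. For the raw goal, the last
    bit of [x] makes one of the two conjuncts vacuous. *)
Definition psem (p : option pred_name) (l : seq (seq bool)) : Prop :=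
  match p, l with
  | Some PIn, s :: _ => A s
  | Some PNot, s :: _ => ~ A s
  | Some PD, [:: b, t, s & _] => exists u, seg (bval b) t u s
  | Some PD1, [:: b, t, m, s & _] => seg (2 ^ size b) t m s /\ exists u, seg (bval b) m u s
  | Some PCh, [:: b, t, u, s & _] => seg (2 ^ size b) t u s
  | Some PChS, [:: b, t, m, u, s & _] => seg (2 ^ size b) t m s /\ seg (2 ^ size b) m u s
  | Some PLen, [:: b, z & _] => size z <= 2 ^ size b
  | Some PLenS, [:: b, x, y & _] => size x <= 2 ^ size b /\ size y <= 2 ^ size b
  | Some PLt, [:: t, u & _] => wlt t u
  | Some PNeq, [:: t, u & _] => t != u
  | Some PPad, z :: _ => exists J, LN (z ++ nseq J false)
  | Some PStrip, z :: _ => forall u J, z = rcons u true ++ nseq J false -> ~ LN (rcons u true)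
  | None, x :: _ => (forall u, x = rcons u true -> exists J, LN (rcons x false ++ nseq J false)) /\
      (forall u J, x = rcons u true ++ nseq J.+1 false -> ~ LN (rcons u true))
  | _, _ => True
  end.

Definition sem (x : goal M N) : Prop :=
  match x with
  | GM md c => if md then accM c else ~ accM c
  | GN md c => if md then accN c else ~ accN c
  | GF p l => psem p l
  end.

Fixpoint sems (s : seq (goal M N)) : Prop := if s is x :: s' then sem x /\ sems s' else True.

(** Part of the claim is that the premises are again encodings of goals: this invariant is what
    gives the words on the stack a meaning. *)
Definition sound_step (l : Prop) (hs : seq (seq letter)) :=
  exists2 gs, hs = map (@goal_letters M N) gs & sems gs -> l.

Ltac unpack := repeat (simpl in *; match goal with
  | h : False |- _ => case h
  | h : _ /\ _ |- _ => destruct h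
  | h : ex _ |- _ => destruct h
  | h : ex2 _ _ |- _ => destruct h
  | h : and3 _ _ _ |- _ => destruct h
  | h : context [match ?l with [::] => _ | _ => _ end] |- _ => is_var l; destruct l
  end); subst.

Lemma sound_init_M md s : sound_step (if md then accM (init M s) else ~ accM (init M s))
  [:: hM N md (start M) :: fields [:: [::], s & nseq (work_tapes M).*2 [::]]].
Proof.
exists [:: GM N md (init M s)]; last by case: md => -[].
by rewrite /= init_letters.
Qed.

Lemma sound_init_N md s : sound_step (if md then LN s else ~ LN s)
  [:: hN M md (start N) :: fields [:: [::], s & nseq (work_tapes N).*2 [::]]].
Proof.
exists [:: GN M md (init N s)]; last by case: md => -[].
by rewrite /= init_letters.
Qed.

Lemma sound_step_impl (P Q : Prop) hs : (P -> Q) -> sound_step P hs -> sound_step Q hs.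
Proof. by move=> pq [gs e h]; exists gs => // /h. Qed.

Lemma strip_zero z u J : z ++ [:: false] = rcons u true ++ nseq J false ->
  exists2 J', J = J'.+1 & z = rcons u true ++ nseq J' false.
Proof.
case: J => [|J]; first by rewrite cats0 cats1 => /rcons_inj[].
rewrite -addn1 nseqD catA !cats1 => /rcons_inj[->]; by exists J => //; rewrite addn1.
Qed.

Lemma ends_true x u J : rcons x true <> rcons u true ++ nseq J.+1 false.
Proof. by rewrite -addn1 nseqD catA cats1 => /rcons_inj[]. Qed.

Lemma pred_sound p r l hs : r \in map compile_rule (pred_rules M N kap bet p) ->
  fires r (fields l) hs -> sound_step (psem p l) hs.
Proof.
have one q l' : sound_step (psem q l') [:: hp M N q :: fields l'].
  by eexists [:: GF M N q l'] => // -[].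
have one_prem q l1 hs1 : oprels [:: q] l1 hs1 ->
    exists2 l', hs1 = [:: q.1 :: fields l'] & oprel q.2 l1 l'.
  by case: hs1 => [|h1 [|? ?]] /= [] // [l' -> h] _; exists l'.
case: p => [[]|]; rewrite /= !inE.
- move=> /eqP -> /fires_compile[_ /one_prem[l' -> /init_opsP[l1 h ->]]]; unpack.
  by apply: sound_step_impl (sound_init_M true _); rewrite /= AM.
- move=> /orP[]/eqP -> /fires_compile[_].
    move=> /one_prem[l' -> /init_opsP[l1 h ->]]; unpack.
    by apply: sound_step_impl (sound_init_M false _); rewrite /= AM.
  move=> h; unpack; eexists [:: GF M N (Some PLt) [:: [::]; _]; GF M N (Some PLen) [:: kap; _];
    GF M N (Some PD) [:: bet; [::]; _]] => //= -[h1 [h2 [[u h3] _]]].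
  exact: census_notin h3 h1 h2.
- move=> /or3P[]/eqP -> /fires_compile[/= hc h].
  + case: hs h => // _; exists [::] => // _.
    by case: l hc => [|[|? ?] [|t [|s l]]] // _; exists t; apply: seg0.
  + unpack; exact: one.
  unpack; eexists [:: GF M N (Some PD1) [:: _; _; _; _]] => //= -[[h1 [u h2]] _].
  by exists u; rewrite mul1n; apply: seg_cat h1 h2.
- move=> /eqP -> /fires_compile[_ /= h]; unpack.
  by eexists [:: GF M N (Some PCh) [:: _; _; _; _]; GF M N (Some PD) [:: _; _; _]] => //= -[h1 [h2 _]].
- move=> /or3P[]/eqP -> /fires_compile[/= _ h].
  + unpack; eexists [:: GF M N (Some PChS) [:: _; _; _; _; _]] => //= -[[h1 h2] _].
    by rewrite expnS mul2n -addnn; apply: seg_cat h1 h2.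
  + unpack; eexists [:: GF M N (Some PChS) [:: _; _; _; _; _]] => //= -[[h1 h2] _].
    by rewrite expnS mul2n -addnn; apply: seg_cat h1 h2.
  unpack; eexists [:: GF M N (Some PLt) [:: _; _]; GF M N (Some PNeq) [:: _; _];
    GF M N (Some PLen) [:: _; _]; GF M N (Some PIn) [:: _]] => //= -[h1 [h2 [h3 [h4 _]]]].
  rewrite expn0; eexists [:: _]; split=> //=; first by rewrite h1.
  by move=> x; rewrite inE => /eqP ->.
- move=> /eqP -> /fires_compile[_ /= h]; unpack.
  by eexists [:: GF M N (Some PCh) [:: _; _; _; _]; GF M N (Some PCh) [:: _; _; _; _]] => //= -[h1 [h2 _]].
- rewrite !orbA -!orbA; move=> /or4P[| | |/orP[|]] /eqP -> /fires_compile[/= hc h]; unpack;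
    try by exists [::].
  + eexists [:: GF M N (Some PLenS) [:: _; _; _]] => //= -[[h1 h2] _].
    by rewrite size_cat expnS mul2n -addnn leq_add.
  eexists [:: GF M N (Some PLenS) [:: _; _; _]] => //= -[[h1 h2] _].
  by rewrite size_cat expnS mul2n -addnn leq_add.
- move=> /eqP -> /fires_compile[_ /= h]; unpack.
  by eexists [:: GF M N (Some PLen) [:: _; _]; GF M N (Some PLen) [:: _; _]] => //= -[h1 [h2 _]].
- move=> /or4P[| | |/orP[|]] /eqP -> /fires_compile[/= hc h]; unpack; try (by exists [::]);
    by eexists [:: GF M N (Some PLt) [:: _; _]] => //= -[].
- move=> /or4P[| | |/or4P[| | |/orP[|]]] /eqP -> /fires_compile[/= hc h]; unpack; try (by exists [::]);
    by eexists [:: GF M N (Some PNeq) [:: _; _]] => //= -[].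
- move=> /orP[]/eqP -> /fires_compile[_ h]; last first.
    case/one_prem: h => l' -> /init_opsP[l1 h ->]; unpack.
    apply: sound_step_impl (sound_init_N true _) => /= h.
    by exists 0; rewrite cats0.
  unpack; eexists [:: GF M N (Some PPad) [:: _]] => //= -[[J h] _].
  by exists J.+1; move: h; rewrite -cats1 -!catA.
- move=> /orP[]/eqP -> /fires_compile[_ h]; last first.
    case/one_prem: h => l' -> /init_opsP[l1 h ->]; unpack.
    apply: sound_step_impl (sound_init_N false _) => /= h u J.
    case: J => [|J]; first by rewrite cats0 => <-; rewrite -cats1.
    by rewrite -addn1 nseqD catA !cats1 => /rcons_inj[].
  unpack; eexists [:: GF M N (Some PStrip) [:: _]] => //= -[h _] u J.
  by rewrite -cats1 => /strip_zero[J' _ e]; apply: h; rewrite cats0 e.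
move=> /orP[]/eqP -> /fires_compile[_ h].
  unpack; eexists [:: GF M N (Some PPad) [:: _]] => //= -[[J h] _]; split.
    by move=> u _; exists J; move: h; rewrite -!cats1 -!catA.
  by move=> u J' /ends_true.
unpack; eexists [:: GF M N (Some PStrip) [:: _]] => //= -[h _]; split.
  by move=> u /rcons_inj[].
move=> u J; rewrite -cats1 => /(@strip_zero _ _ J.+1)[J' _ e]; apply: h; by rewrite cats0 e.
Qed.
End Soundness.

Section Soundness.
Variables (M : ntm) (N : oracle_ntm) (A : language) (kap bet : seq bool).

Notation accM := (leads (@step M)).
Notation accN := (leads (@oracle_step N A)).

Hypothesis AM : forall s, A s <-> accM (init M s).

Hypothesis census : forall l, uniq l ->
  (forall x, x \in l -> [/\ A x, size x <= 2 ^ size kap & x != [::]]) -> size l <= bval bet.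

Notation sound_step := (@sound_step M N A kap).
Notation sem := (@sem M N A kap).
Notation sems := (@sems M N A kap).
Notation prog := (prog M N kap bet).

Lemma sems_map T (f : T -> goal M N) (s : seq T) : sems (map f s) <-> forall x, List.In x s -> sem (f x).
Proof.
elim: s => //= x s ->; split=> [[h1 h2] y [<-|/h2]|h] //.
by split=> [|y hy]; apply: h; [left|right].
Qed.

Lemma in_successors (X : ntm) (c d : config X) : step c d -> List.In d (successors c).
Proof.
case/stepP => act ha ->; rewrite /successors; elim: (actions c) ha => //= a s ih.
by rewrite inE => /orP[/eqP ->|/ih]; [left|right].
Qed.

(** A query has exactly one successor, so a certified answer and the goal for that successor decide
    rejection as well as acceptance. *)
Lemma query_sound md (c : config N) r hs : c.1 = query N -> c.1 \notin accept N ->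
  r \in query_rules M N md -> fires r (tapes_letters c.2) hs ->
  sound_step (sem (GN M md c)) hs.
Proof.
move=> eq na; set w := tape_word (c.2 (oracle_tape N)).
have leadsQ : accN c <-> (A w /\ accN (yes N, c.2)) \/ (~ A w /\ accN (Defs.no N, c.2)).
  split.
    case/leadsE => [h|[d]]; first by rewrite h in na.
    by rewrite /oracle_step eq eqxx => -[[h ->]|[h ->]] hd; [left|right].
  by case=> -[h hd]; apply: leads_step hd; rewrite /oracle_step eq eqxx; [left|right].
have copyP q o : trn (IE (hN M md q) :: copy_tapes N) (tapes_letters c.2) o <->
    o = config_letters (@hN M N) md (q, c.2).
  by split=> [[o1 -> /copy_tapesP ->]|->] //; eexists; [reflexivity|apply/copy_tapesP].
have two a b g : trns [:: a; b] g hs -> exists h1 h2, [/\ hs = [:: h1; h2], trn a g h1 & trn b g h2].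
  by case: hs => [|h1 [|h2 [|? ?]]] [] // h3 [] // h4 _; exists h1, h2.
case/flattenP => s /mapP[y hy ->]; rewrite !inE => /orP[]/eqP -> [_ /two[h1 [h2 [-> h3 /copyP ->]]]].
  have -> : h1 = hp M N (Some PIn) :: fields [:: w] by apply/query_itemsP; exists y.
  exists [:: GF M N (Some PIn) [:: w]; GN M md (yes N, c.2)] => //= -[hw [hc _]].
  by case: md hc {copyP} => hc; rewrite leadsQ; [left|case=> -[]].
have -> : h1 = hp M N (Some PNot) :: fields [:: w] by apply/query_itemsP; exists y.
exists [:: GF M N (Some PNot) [:: w]; GN M md (Defs.no N, c.2)] => //= -[hw [hc _]].
by case: md hc {copyP} => hc; rewrite leadsQ; [right|case=> -[]].
Qed.

Lemma acc_sound (X : ntm) (R : config X -> config X -> Prop) (g : config X -> goal M N)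
    (hd : bool -> state X -> letter) (c : config X) r hs :
  (forall d, goal_letters (g d) = config_letters hd true d) ->
  (forall d, sem (g d) <-> leads R d) ->
  (c.1 \notin accept X -> forall d, step c d -> R c d) ->
  r \in acc_rules hd c.1 -> fires r (tapes_letters c.2) hs -> sound_step (sem (g c)) hs.
Proof.
move=> hg hs' hR hr hf; have [ha|na] := boolP (c.1 \in accept X).
  have [[_ ->]|[d hd1 ->]] := acc_rules_sound hr hf.
    by exists [::] => // _; apply/hs'/leads_accept.
  by exists [:: g d]; rewrite /= ?hg // => _; apply/hs'/leads_accept.
have [[h]|[d hd1 ->]] := acc_rules_sound hr hf; first by rewrite h in na.
exists [:: g d]; rewrite /= ?hg // => -[/hs' h _].
by apply/hs'; apply: leads_step h; apply: hR.
Qed.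

Lemma rej_sound (X : ntm) (R : config X -> config X -> Prop) (g : config X -> goal M N)
    (hd : bool -> state X -> letter) (c : config X) r hs :
  (forall d, goal_letters (g d) = config_letters hd false d) ->
  (forall d, sem (g d) <-> ~ leads R d) ->
  (c.1 \notin accept X -> forall d, R c d -> step c d) ->
  r \in rej_rules hd c.1 -> fires r (tapes_letters c.2) hs -> sound_step (sem (g c)) hs.
Proof.
move=> hg hs' hR hr hf; have [na ->] := rej_rules_sound hr hf.
exists (map g (successors c)); first by rewrite -map_comp; apply: eq_map => d; rewrite /= hg.
rewrite sems_map => h; apply/hs' => /leadsE[ha|[d hd1 hl]]; first by rewrite ha in na.
by move/hs': (h d (in_successors (hR na d hd1))).
Qed.

Lemma prog_sound r x hs : r \in prog -> fires r (goal_letters x) hs -> sound_step (sem x) hs.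
Proof.
case: x => [md c|md c|p l] hr.
- case/(prog_fires (h := Some (inl (md, inl c.1))) hr) => r' /=; case: md hr => hr hr' hf.
    by apply: (acc_sound (R := @step M) (g := GM N true)) hr' hf.
  by apply: (rej_sound (R := @step M) (g := GM N false)) hr' hf.
- case/(prog_fires (h := Some (inl (md, inr c.1))) hr) => r' /=; case: ifP => [/andP[/eqP eq na] hr' hf|/negbT hq].
    exact: query_sound eq na hr' hf.
  have hstep : c.1 \notin accept N -> forall d, oracle_step A c d = step c d.
    by move=> na d; move: hq; rewrite /oracle_step na andbT => /negbTE ->.
  case: md hr hq hstep => hr hq hstep hr' hf.
    by apply: (acc_sound (R := @oracle_step N A) (g := GN M true)) hr' hf => // na d; rewrite hstep.
  by apply: (rej_sound (R := @oracle_step N A) (g := GN M false)) hr' hf => // na d; rewrite hstep.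
case/(prog_fires (h := omap inr p) hr) => r' hr' hf.
by apply: (pred_sound AM census _ hf); case: p hr' {hr hf}.
Qed.

Lemma sems_cat s t : sems (s ++ t) <-> sems s /\ sems t.
Proof. by elim: s => [|x s ih] /=; rewrite ?ih; [split=> [|[]] | rewrite andA]. Qed.

(** By induction on the derivation: the premises pushed by a rule imply the goal that it popped. *)
Lemma solve_sound ok n gs : solve ok prog n (map (@goal_letters M N) gs) -> sems gs.
Proof.
move: {-1}(map _ gs) (erefl (map (@goal_letters M N) gs)) => w ew h.
elim: h gs ew => {n w} [|n g w r hs hr hf _ _ ih] [|x gs] //= [eg ew].
rewrite -eg in hf; have [hgs ehs himp] := prog_sound hr hf.
have : sems (catrev hgs gs) by apply: ih; rewrite ehs -ew !catrevE map_cat map_rev.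
rewrite catrevE sems_cat => -[h1 h2]; split=> //; apply: himp.
elim: hgs h1 {ehs} => //= y s ih1; rewrite rev_cons -cats1 sems_cat /= => -[/ih1 h3 [h4 _]].
by split.
Qed.
End Soundness.

(** * Concatenation of derivations, sizes of configurations *)

Lemma solve_cat ok P n1 n2 gs1 gs2 : solve ok P n1 gs1 -> solve ok P n2 gs2 ->
  solve ok P (n1 + n2) (gs1 ++ gs2).
Proof.
move=> h1 h2; elim: h1 => //= n g gs r hs hr hf hg _ ih.
by apply: solve_cons hr hf hg _; move: ih; rewrite !catrevE catA.
Qed.

Lemma size_write_move S (t : tape S) a m :
  size (write_move t a m).1 + size (write_move t a m).2 <= size t.1 + size t.2 + 2.
Proof. by case: t m => l r []; rewrite /= ?size_behead; lia. Qed.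

Lemma size_tape_letters (S : finType) (t : tape S) :
  size (tape_letters t) = size t.1 + size t.2 + 2.
Proof. by rewrite /tape_letters size_cat /= size_cat !size_map /=; lia. Qed.

Lemma size_act_on (X : ntm) (c : config X) act :
  size (tapes_letters (act_on c act).2) <= size (tapes_letters c.2) + 2 * (work_tapes X).+1.
Proof.
have -> : 2 * (work_tapes X).+1 = 2 * size (enum 'I_(work_tapes X).+1) by rewrite size_enum_ord.
rewrite /tapes_letters; elim: (enum _) => //= i s ih; rewrite !(size_cat (tape_letters _)) !size_tape_letters ffunE.
have := size_write_move (c.2 i) (act.2 i).1 (act.2 i).2; lia.
Qed.

Lemma size_step (X : ntm) (c d : config X) : step c d ->
  size (tapes_letters d.2) <= size (tapes_letters c.2) + 2 * (work_tapes X).+1.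
Proof. by case/stepP => act _ ->; apply: size_act_on. Qed.

Lemma size_tape_word (X : ntm) (c : config X) i :
  size (tape_word (c.2 i)) <= size (tapes_letters c.2).
Proof.
have h r : size (bit_prefix r) <= size (r : seq (symbol (aux X))).
  by elim: r => // -[[b|x]|] r ih /=; lia.
apply: leq_trans (h _) _; rewrite /tapes_letters.
have : i \in enum 'I_(work_tapes X).+1 by rewrite mem_enum.
elim: (enum _) => //= j s ih; rewrite inE (size_cat (tape_letters _)) size_tape_letters => /orP[/eqP <-|/ih]; lia.
Qed.

Section Completeness.
Variables (M : ntm) (N : oracle_ntm) (A : language) (kap bet : seq bool).
Notation prog := (prog M N kap bet).
Notation gl := (@goal_letters M N).

(** * Completeness *)

(** Makes the length of an encoded goal linear in its number of letters, with a constant that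
    depends on the two machines only. *)
Definition letter_bound : nat :=
  \max_(h : head_name M N) size (enc1 (hl h)) + \max_(a : symbol (aux M)) size (enc1 (lsym a))
  + \max_(a : symbol (aux N)) size (enc1 (lsym a)) + 1.

Lemma size_enc_bound C w : (forall a, a \in w -> size (enc1 a) <= C) -> size (enc w) <= C * size w.
Proof.
elim: w => //= a w ih h; rewrite enc_cons size_cat mulnS leq_add ?h ?mem_head // ih // => b bw.
by apply: h; rewrite inE bw orbT.
Qed.

Lemma hl_bound (h : head_name M N) : size (enc1 (hl h)) <= letter_bound.
Proof.
have := leq_bigmax (F := fun h : head_name M N => size (enc1 (hl h))) h.
by rewrite /letter_bound /= => H; rewrite -!addnA; apply: leq_trans H (leq_addr _ _).
Qed.

Lemma sep_bound : size (enc1 sep) <= letter_bound.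
Proof. exact: (hl_bound None). Qed.

Lemma tapes_bound (S : finType) C K (T : 'I_K -> tape S) s a : (forall x : symbol S, size (enc1 (lsym x)) <= C) ->
  size (enc1 sep) <= C -> a \in flatten [seq tape_letters (T i) | i <- s] -> size (enc1 a) <= C.
Proof.
move=> hC hs /flatten_mapP[i _]; rewrite /tape_letters mem_cat inE mem_cat inE.
by case/or4P => [/mapP[x _ ->]|/eqP ->|/mapP[x _ ->]|/eqP ->].
Qed.

Lemma gl_bound x : size (enc (gl x)) <= letter_bound * size (gl x).
Proof.
apply: size_enc_bound => a; case: x => [md c|md c|p l] /=; rewrite inE => /orP[/eqP -> | ];
  try exact: hl_bound.
- apply: tapes_bound => [x|]; last exact: sep_bound.
  apply: leq_trans (leq_bigmax (F := fun a : symbol (aux M) => size (enc1 (lsym a))) x) _.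
  by rewrite /letter_bound /=; lia.
- apply: tapes_bound => [x|]; last exact: sep_bound.
  apply: leq_trans (leq_bigmax (F := fun a : symbol (aux N) => size (enc1 (lsym a))) x) _.
  by rewrite /letter_bound /=; lia.
case/flatten_mapP => t _; rewrite mem_cat inE => /orP[/mapP[b _ ->]|/eqP ->]; last exact: sep_bound.
by rewrite /letter_bound /=; lia.
Qed.

Variable B : nat.
Definition ok (g : seq letter) := size (enc g) <= letter_bound * B.

Definition Sol n x := exists2 m, m <= n & solve ok prog m [:: gl x].

Fixpoint Sols n gs : Prop :=
  if gs is x :: gs' then exists a b, [/\ a + b <= n, Sol a x & Sols b gs'] else True.

Lemma Sol_le a b x : a <= b -> Sol a x -> Sol b x.
Proof. by move=> h [m hm s]; exists m => //; lia. Qed.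

Lemma Sols1 n x : Sol n x -> Sols n [:: x].
Proof. by move=> h; exists n, 0; rewrite addn0. Qed.

Lemma Sols2 a b n x y : Sol a x -> Sol b y -> a + b <= n -> Sols n [:: x; y].
Proof. by move=> h1 h2 h; exists a, b; split=> //; exists b, 0; rewrite addn0. Qed.

Lemma Sols_map T (f : T -> goal M N) X s : (forall x, List.In x s -> Sol X (f x)) ->
  Sols (size s * X) (map f s).
Proof.
elim: s => //= x s ih h; exists X, (size s * X); split=> //.
  by apply: h; left.
by apply: ih => y hy; apply: h; right.
Qed.

Lemma Sols_rev n gs : Sols n gs -> exists2 m, m <= n & solve ok prog m (rev (map gl gs)).
Proof.
elim: gs n => [|x gs ih] n /=; first by exists 0 => //; constructor.
case=> a [b [hab [m1 hm1 s1] /ih[m2 hm2 s2]]]; exists (m2 + m1); first lia.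
by rewrite rev_cons -cats1; apply: solve_cat.
Qed.

Lemma Sol_rule n x (h : head_name M N) w r gs : gl x = hl h :: w -> r \in head_rules kap bet h ->
  fires r w (map gl gs) -> size (gl x) <= B -> Sols n gs -> Sol n.+1 x.
Proof.
move=> e hr hf hB /Sols_rev[m hm s]; exists m.+1 => //.
have [r' hr' hf'] := prog_mem hr hf.
rewrite -e in hf'; apply: solve_cons hr' hf' _ _; last by rewrite catrevE cats0.
by apply: leq_trans (gl_bound x) _; rewrite leq_mul2l hB orbT.
Qed.

Lemma Sol_pred n p l fr gs :
  compile_rule fr \in map compile_rule (pred_rules M N kap bet p) ->
  crel fr.1 l -> oprels fr.2 l (map gl gs) -> size (fields l) < B -> Sols n gs ->
  Sol n.+1 (GF M N p l).
Proof.
move=> hr hc hf hB hs; apply: (Sol_rule (h := omap inr p) (r := compile_rule fr)) hs => //.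
  by case: p hr {hB}.
by apply/fires_compile.
Qed.

Section Machine.
Variables (X : ntm) (R : config X -> config X -> Prop) (g : bool -> config X -> goal M N).
Variables (S0 Q : nat).

Notation b := #|{: state X * {ffun 'I_(work_tapes X).+1 -> symbol (aux X) * direction}}|.
Notation K2 := (2 * (work_tapes X).+1).

(** Special states are those of oracle queries, [Q] is the cost of certifying an answer, and [S0]
    bounds the tapes along the run. For [M] there are no special states and [Q] is 0. *)
Variable special : pred (state X).
Hypothesis g_accept : forall c, c.1 \in accept X -> size (tapes_letters c.2) < B ->
  Sol 1 (g true c).
Hypothesis g_step : forall c d n, c.1 \notin accept X -> ~~ special c.1 -> R c d ->
  size (tapes_letters c.2) < B -> Sol n (g true d) -> Sol n.+1 (g true c).
Hypothesis g_rej : forall c n, c.1 \notin accept X -> ~~ special c.1 ->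
  size (tapes_letters c.2) < B -> (forall d, R c d -> Sol n (g false d)) ->
  Sol (b * n).+1 (g false c).
Hypothesis g_special : forall md c d n, c.1 \notin accept X -> special c.1 -> R c d ->
  size (tapes_letters c.2) <= S0 -> Sol n (g md d) -> Sol (n + Q).+1 (g md c).
Hypothesis special_total : forall c, special c.1 -> exists d, R c d.
Hypothesis R_size : forall c d, R c d ->
  size (tapes_letters d.2) <= size (tapes_letters c.2) + K2.

Hypothesis S0B : S0 < B.

Lemma Sol_accept m c c' : nsteps R m c c' -> c'.1 \in accept X ->
  size (tapes_letters c.2) + m * K2 <= S0 -> Sol (m * Q.+1 + 1) (g true c).
Proof.
elim: m c => [|m ih] c /= hn hc hS.
  by apply: g_accept; [rewrite hn|lia].
(* An accepting configuration met on the way ends the derivation; the hypotheses on steps concern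
   the other ones. *)
have [ha|na] := boolP (c.1 \in accept X).
  by apply: (Sol_le (a := 1)); [lia|apply: g_accept => //; lia].
case: hn => d hd hn.
have := ih d hn hc; have := R_size hd; rewrite mulSn in hS => h1 h2.
have {}h2 : Sol (m * Q.+1 + 1) (g true d) by apply: h2; lia.
rewrite mulSn; have [hs|hs] := boolP (special c.1).
  have h3 : size (tapes_letters c.2) <= S0 by lia.
  by apply: Sol_le (g_special na hs hd h3 h2); lia.
by apply: (Sol_le (a := (m * Q.+1 + 1).+1)); [lia|apply: g_step hd _ h2 => //; lia].
Qed.

(** The computation tree has depth at most [m]. A node costs one rule and either at most [b]
    subtrees, or one subtree and [Q] for a query; both fit in a factor [b + Q + 2]. *)
Lemma Sol_reject m c : (forall n c', nsteps R n c c' -> n <= m) -> ~ leads R c ->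
  size (tapes_letters c.2) + m * K2 <= S0 -> Sol ((b + Q + 2) ^ m) (g false c).
Proof.
elim: m c => [|m ih] c hb hl hS.
  have na : c.1 \notin accept X by apply/negP => h; apply: hl; apply: leads_accept.
  have nR d : ~ R c d by move=> hd; have := hb 1 d; rewrite /= => h; have : 1 <= 0 by apply: h; exists d.
  have ns : ~~ special c.1 by apply/negP => /special_total[d /nR].
  by apply: (Sol_le (a := (b * 0).+1)); [lia|apply: g_rej => //; [lia|move=> d /nR]].
have na : c.1 \notin accept X by apply/negP => h; apply: hl; apply: leads_accept.
have key d : R c d -> Sol ((b + Q + 2) ^ m) (g false d).
  move=> hd; apply: ih.
  - by move=> n c' hn; apply: (hb n.+1 c'); exists d.
  - by move=> h; apply: hl; apply: leads_step hd h.
  - by have := R_size hd; rewrite mulSn in hS; lia.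
have p0 : 0 < (b + Q + 2) ^ m by rewrite expn_gt0 addn2.
have [hs|hs] := boolP (special c.1).
  have [d hd] := special_total hs.
  have h3 : size (tapes_letters c.2) <= S0 by lia.
  by apply: Sol_le (g_special na hs hd h3 (key d hd)); rewrite expnS; nia.
have h3 : size (tapes_letters c.2) < B by lia.
by apply: Sol_le (g_rej na hs h3 key); rewrite expnS; nia.
Qed.
End Machine.
End Completeness.

Definition branching (X : ntm) :=
  #|{: state X * {ffun 'I_(work_tapes X).+1 -> symbol (aux X) * direction}}|.
Definition growth (X : ntm) := 2 * (work_tapes X).+1.

Section Completeness.
Variables (M : ntm) (N : oracle_ntm) (A : language) (kap bet : seq bool) (B : nat).
Notation prog := (prog M N kap bet).
Notation gl := (@goal_letters M N).
Notation Sol := (@Sol M N kap bet B).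
Notation Sols := (@Sols M N kap bet B).

Lemma acc_Sol (X : ntm) (g : bool -> config X -> goal M N) (h : bool -> state X -> head_name M N) :
  (forall md c, gl (g md c) = config_letters (fun md q => hl (h md q)) md c) ->
  forall c, (head_rules kap bet (h true c.1) = acc_rules (fun md q => hl (h md q)) c.1) ->
  size (tapes_letters c.2) < B ->
  (c.1 \in accept X -> Sol 1 (g true c)) /\
  (forall d n, step c d -> Sol n (g true d) -> Sol n.+1 (g true c)).
Proof.
move=> hg c hr hB; split.
  move=> /(acc_rules_accept (fun md q => hl (h md q)))[r hr1 hf].
  apply: (Sol_rule (h := h true c.1) (r := r) (gs := [::])) => //; first by rewrite hg.
  - by rewrite hr.
  - exact: hf.
  by rewrite hg.
move=> d n /(acc_rules_step (fun md q => hl (h md q)))[r hr1 hf] hs.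
apply: (Sol_rule (h := h true c.1) (r := r) (gs := [:: g true d])) => //; first by rewrite hg.
- by rewrite hr.
- by rewrite /= hg.
- by rewrite hg.
exact: Sols1.
Qed.

Lemma rej_Sol (X : ntm) (g : bool -> config X -> goal M N) (h : bool -> state X -> head_name M N) :
  (forall md c, gl (g md c) = config_letters (fun md q => hl (h md q)) md c) ->
  forall c, (head_rules kap bet (h false c.1) = rej_rules (fun md q => hl (h md q)) c.1) ->
  size (tapes_letters c.2) < B -> c.1 \notin accept X ->
  forall n, (forall d, step c d -> Sol n (g false d)) -> Sol (branching X * n).+1 (g false c).
Proof.
move=> hg c hr hB na n hs.
have [r hr1 hf] := rej_rules_complete (fun md q => hl (h md q)) na.
have hS : Sols (size (successors c) * n) (map (g false) (successors c)).
  apply: Sols_map => d; rewrite /successors => hd; apply: hs; apply/stepP.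
  elim: (actions c) hd => //= a s ih [<-|/ih[a' ha' ->]]; first by exists a; rewrite ?mem_head.
  by exists a' => //; rewrite inE ha' orbT.
apply: (Sol_le (a := (size (successors c) * n).+1)).
  by rewrite ltnS leq_mul2r size_successors orbT.
apply: (Sol_rule (h := h false c.1) (r := r)) hS => //; first by rewrite hg.
- by rewrite hr.
- suff -> : map gl (map (g false) (successors c)) =
    map (config_letters (fun md q => hl (h md q)) false) (successors c) by [].
  by rewrite -map_comp; apply: eq_map => d; rewrite /= hg.
by rewrite hg.
Qed.

Lemma GM_accept S0 m c c' : S0 < B -> nsteps (@step M) m c c' -> c'.1 \in accept M ->
  size (tapes_letters c.2) + m * growth M <= S0 -> Sol (m + 1) (GM N true c).
Proof.
move=> hB hn hc hs; rewrite -[m]muln1.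
have ha (c1 : config M) : size (tapes_letters c1.2) < B ->
    (c1.1 \in accept M -> Sol 1 (GM N true c1)) /\
    (forall d n, step c1 d -> Sol n (GM N true d) -> Sol n.+1 (GM N true c1)).
  by apply: (acc_Sol (g := GM N) (h := fun md q => Some (inl (md, inl q)))).
apply: (@Sol_accept M N kap bet B M (@step M) (GM N) S0 0 pred0) hn hc hs => //.
- by move=> c1 h1 /ha[h2 _]; apply: h2.
- by move=> c1 d n _ _ h1 /ha[_ h2]; apply: h2.
- exact: size_step.
Qed.

Lemma GM_reject S0 m c : S0 < B -> (forall n c', nsteps (@step M) n c c' -> n <= m) ->
  ~ leads (@step M) c -> size (tapes_letters c.2) + m * growth M <= S0 ->
  Sol ((branching M + 2) ^ m) (GM N false c).
Proof.
move=> hB hb hl hs; rewrite -[branching M]addn0.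
apply: (@Sol_reject M N kap bet B M (@step M) (GM N) S0 0 pred0) hb hl hs => //.
- move=> c1 n na _ h1 h2.
  by apply: (rej_Sol (g := GM N) (h := fun md q => Some (inl (md, inl q)))) h2.
- exact: size_step.
Qed.

Section Oracle.
Variables (S0 Q : nat).
Hypothesis S0B : S0 < B.
Hypothesis query_in : forall s, size s <= S0 -> A s -> Sol Q (GF M N (Some PIn) [:: s]).
Hypothesis query_not : forall s, size s <= S0 -> ~ A s -> Sol Q (GF M N (Some PNot) [:: s]).

Let hN' md (q : state N) : head_name M N := Some (inl (md, inr q)).

Lemma head_N md q : ~~ ((q == query N) && (q \notin accept N)) ->
  head_rules kap bet (hN' md q) = if md then acc_rules (@hN M N) q else rej_rules (@hN M N) q.
Proof. by rewrite /head_rules /hN' => /negbTE ->. Qed.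

Lemma GN_special md (c d : config N) n : c.1 \notin accept N -> c.1 == query N ->
  oracle_step A c d -> size (tapes_letters c.2) <= S0 -> Sol n (GN M md d) ->
  Sol (n + Q).+1 (GN M md c).
Proof.
move=> na eq; rewrite /oracle_step eq /=; set w := tape_word _ => hd hs hn.
have hw : size w <= S0 by apply: leq_trans (size_tape_word _ _) hs.
have hr : head_rules kap bet (hN' md c.1) = query_rules M N md by rewrite /head_rules /= eq na.
have hB : size (gl (GN M md c)) <= B by rewrite /=; lia.
have key p q : (forall y, y \in non_bits N ->
    ([::], [:: query_items N (hp M N p) y; IE (@hN M N md q) :: copy_tapes N]) \in query_rules M N md) ->
    d = (q, c.2) -> Sol Q (GF M N p [:: w]) -> Sol (n + Q).+1 (GN M md c).
  move=> hy ed hQ; have [y yn ht] : exists2 y, y \in non_bits N &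
      trn (query_items N (hp M N p) y) (tapes_letters c.2) (hp M N p :: fields [:: w]).
    by apply/query_itemsP.
  apply: (Sol_rule (h := hN' md c.1) (w := tapes_letters c.2) (r := ([::],
    [:: query_items N (hp M N p) y; IE (@hN M N md q) :: copy_tapes N]))
    (gs := [:: GF M N p [:: w]; GN M md d])) => //.
  - by rewrite hr; apply: hy.
  - split=> //=; split=> //; split=> //; exists (tapes_letters c.2); first by rewrite ed.
    exact: (proj2 (copy_tapesP c.2 _)).
  by apply: Sols2 hQ hn _; rewrite addnC.
case: hd => [[Aw ed]|[nAw ed]].
  apply: (key (Some PIn) (yes N)) => //; last exact: query_in.
  move=> y hy; apply/flattenP; eexists; first by apply/mapP; exists y.
  exact: mem_head.
apply: (key (Some PNot) (Defs.no N)) => //; last exact: query_not.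
move=> y hy; apply/flattenP; eexists; first by apply/mapP; exists y.
by rewrite inE mem_seq1 eqxx orbT.
Qed.

Lemma oracle_size c d : oracle_step (M := N) A c d ->
  size (tapes_letters d.2) <= size (tapes_letters c.2) + growth N.
Proof.
rewrite /oracle_step; case: eqP => _; last exact: size_step.
by case=> -[_ ->] /=; lia.
Qed.

Lemma oracle_stepN (c d : config N) : c.1 != query N -> oracle_step A c d = step c d.
Proof. by rewrite /oracle_step => /negbTE ->. Qed.

Lemma GN_accept m c c' : nsteps (oracle_step (M := N) A) m c c' -> c'.1 \in accept N ->
  size (tapes_letters c.2) + m * growth N <= S0 -> Sol (m * Q.+1 + 1) (GN M true c).
Proof.
move=> hn hc hs.
apply: (@Sol_accept M N kap bet B N (oracle_step (M := N) A) (@GN M N) S0 Q (pred1 (query N))) hn hc hs => //.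
- move=> c1 h1 h2; apply: (proj1 (acc_Sol (g := @GN M N) (h := hN') _ _ h2)) => //.
  by rewrite head_N // h1 andbF.
- move=> c1 d n na /= hq; rewrite oracle_stepN // => hd h2.
  apply: (proj2 (acc_Sol (g := @GN M N) (h := hN') _ _ h2)) => //.
  by rewrite head_N // (negbTE hq).
- by move=> md c1 d n na /= hq hd h2 h3; apply: GN_special hd h2 h3.
- exact: oracle_size.
Qed.

Lemma GN_reject m c : (forall n c', nsteps (oracle_step (M := N) A) n c c' -> n <= m) ->
  ~ leads (oracle_step (M := N) A) c ->
  size (tapes_letters c.2) + m * growth N <= S0 ->
  Sol ((branching N + Q + 2) ^ m) (GN M false c).
Proof.
move=> hb hl hs.
apply: (@Sol_reject M N kap bet B N (oracle_step (M := N) A) (@GN M N) S0 Q (pred1 (query N))) hb hl hs => //.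
- move=> c1 n na /= hq h1 h2.
  apply: (rej_Sol (g := @GN M N) (h := hN')) => //; first by rewrite head_N // (negbTE hq).
  by move=> d hd; apply: h2; rewrite oracle_stepN.
- by move=> md c1 d n na /= hq hd h2 h3; apply: GN_special hd h2 h3.
- move=> c1 /= /eqP hq; rewrite /oracle_step hq eqxx.
  have [hA|hA] := pselect (A (tape_word (c1.2 (oracle_tape N)))).
    by exists (yes N, c1.2); left.
  by exists (Defs.no N, c1.2); right.
- exact: oracle_size.
Qed.
End Oracle.
End Completeness.

(** * Derivations for the predicates of the diagonal program *)

Lemma size_fields l : size (fields l) = sumn [seq (size t).+1 | t <- l].
Proof. by elim: l => //= t l ih; rewrite fields_cons size_cat /= ih size_map addnS. Qed.

Lemma size_init (X : ntm) s : size (tapes_letters (init X s).2) = size s + growth X.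
Proof.
(* A configuration with an arbitrary head letter is compared with its list of fields; the head
   letter accounts for the successor. *)
have /succn_inj -> : (size (tapes_letters (init X s).2)).+1 =
    (size (fields [:: [::], s & nseq (work_tapes X).*2 [::]])).+1.
  exact: (congr1 size (@init_letters X (fun _ _ => sep) true s)).
rewrite size_fields /= map_nseq sumn_nseq /growth.
by rewrite [size [::]]/= mul1n -mul2n; lia.
Qed.

Lemma init_opsE (X : ntm) t l : oprel (init_ops X FC) (t :: l)
  ([::] :: t :: nseq (work_tapes X).*2 [::]).
Proof.
exists (t :: nseq (work_tapes X).*2 [::]) => //; exists (nseq (work_tapes X).*2 [::]) => //.
by elim: (_.*2) => //= k ih; exists (nseq k [::]).
Qed.

Lemma init_ops_lastE (X : ntm) t l : oprel (init_ops X (FL true [:: true])) (rcons t true :: l)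
  ([::] :: rcons t true :: nseq (work_tapes X).*2 [::]).
Proof.
exists (rcons t true :: nseq (work_tapes X).*2 [::]) => //.
exists t, (nseq (work_tapes X).*2 [::]); rewrite cats1; split=> //.
by elim: (_.*2) => //= k ih; exists (nseq k [::]).
Qed.

Section Completeness.
Variables (M : ntm) (N : oracle_ntm) (A : language) (kap bet : seq bool) (B : nat).
Notation Sol := (@Sol M N kap bet B).
Notation GF := (GF M N).

Hypothesis AM : forall s, A s <-> leads (@step M) (init M s).

(** The initial configuration occupies [size s + growth M] letters and grows by [growth M] at each
    step, whence the factor [f.+1]. *)
Lemma In_Sol S0 f s : S0 < B -> (forall n c', nsteps (@step M) n (init M s) c' -> n <= f) ->
  A s -> size s + f.+1 * growth M <= S0 -> Sol f.+2 (GF (Some PIn) [:: s]).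
Proof.
move=> hB hf /AM[n [c [hn hc]]] hS.
have nf := hf _ _ hn; have g2 : 1 < f.+1 * growth M by rewrite /growth mulSn; lia.
apply: (Sol_pred (fr := ([::], [:: (@hM M N true (start M), init_ops M FC)]))
  (gs := [:: GM N true (init M s)])) => //.
- exact: mem_head.
- split=> //; exists ([::] :: s :: nseq (work_tapes M).*2 [::]); last exact: init_opsE.
  by rewrite /= init_letters.
- by rewrite size_fields /=; lia.
apply/Sols1/(Sol_le (a := n + 1)); first lia.
apply: GM_accept hB hn hc _; rewrite size_init; apply: leq_trans hS.
by rewrite -addnA -mulSn leq_add2l leq_mul2r orbC ltnS nf.
Qed.

Lemma Not_Sol S0 f s : S0 < B -> (forall n c', nsteps (@step M) n (init M s) c' -> n <= f) ->
  ~ A s -> size s + f.+1 * growth M <= S0 ->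
  Sol ((branching M + 2) ^ f).+1 (GF (Some PNot) [:: s]).
Proof.
move=> hB hf nA hS; have g2 : 1 < f.+1 * growth M by rewrite /growth mulSn; lia.
apply: (Sol_pred (fr := ([::], [:: (@hM M N false (start M), init_ops M FC)]))
  (gs := [:: GM N false (init M s)])) => //.
- exact: mem_head.
- split=> //; exists ([::] :: s :: nseq (work_tapes M).*2 [::]); last exact: init_opsE.
  by rewrite /= init_letters.
- by rewrite size_fields /=; lia.
apply/Sols1; apply: GM_reject hB hf _ _; first by move/AM.
by rewrite size_init -addnA -mulSn.
Qed.

Ltac in_rules := rewrite /= !inE eqxx ?orbT.

Lemma Lt_Sol t u : wlt t u -> size t + size u + 3 <= B -> Sol (size t).+1 (GF (Some PLt) [:: t; u]).
Proof.
elim: t u => [|a t ih] [|b u] //= h hB.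
  apply: (Sol_pred (fr := ([:: CE; CM b], [::])) (gs := [::])) => //.
  - by case: (b); in_rules.
  - by rewrite size_fields /=; lia.
case: eqP h => [<- h|ab na].
  apply: (Sol_pred (fr := ([::], [:: (hp M N (Some PLt), [:: FM a; FC; FM a; FC])]))
    (gs := [:: GF (Some PLt) [:: t; u]])) => //.
  - by case: (a); in_rules.
  - split=> //; exists [:: t; u] => //=; split=> //.
    by exists [:: u] => //; split=> //; exists [::].
  - by rewrite size_fields /=; lia.
  by apply/Sols1/ih => //; lia.
case: a ab na => //; case: b => // _ _.
apply: (Sol_le (a := 1)) => //.
apply: (Sol_pred (fr := ([:: CM false; CD; CM true], [::])) (gs := [::])) => //.
by rewrite size_fields /=; lia.
Qed.

Lemma Neq_Sol (t u : seq bool) : t != u -> size t + size u + 3 <= B ->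
  Sol (size t).+1 (GF (Some PNeq) [:: t; u]).
Proof.
elim: t u => [|a t ih] [|b u] //= h hB.
- apply: (Sol_pred (fr := ([:: CE; CM b], [::])) (gs := [::])) => //.
  + by case: (b); in_rules.
  + by rewrite size_fields /=; lia.
- apply: (Sol_le (a := 1)) => //.
  apply: (Sol_pred (fr := ([:: CM a; CD; CE], [::])) (gs := [::])) => //.
  + by case: (a); in_rules.
  + by rewrite size_fields /=; lia.
have [eab|ab] := eqVneq a b.
  rewrite -{b}eab in h *; rewrite eqseq_cons eqxx /= in h.
  apply: (Sol_pred (fr := ([::], [:: (hp M N (Some PNeq), [:: FM a; FC; FM a; FC])]))
    (gs := [:: GF (Some PNeq) [:: t; u]])) => //.
  - by case: (a); in_rules.
  - split=> //; exists [:: t; u] => //=; split=> //.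
    by exists [:: u] => //; split=> //; exists [::].
  - by rewrite size_fields /=; lia.
  by apply/Sols1/ih => //; lia.
apply: (Sol_le (a := 1)) => //.
apply: (Sol_pred (fr := ([:: CM a; CD; CM b], [::])) (gs := [::])) => //.
- by case: (a) ab; case: (b) => // _; in_rules.
- by rewrite size_fields /=; lia.
Qed.

(** The cost satisfies [c 0 = 1] and [c (k + 1) = 2 * c k + 2]: two halves, and one rule each for
    [PLen] and [PLenS]. *)
Lemma Len_Sol k z : size z <= 2 ^ size k -> size k + size z + 5 <= B ->
  Sol (3 * 2 ^ size k - 2) (GF (Some PLen) [:: k; z]).
Proof.
elim: k z => [|b k ih] z.
  rewrite expn0; case: z => [|c [|? ?]] // _ hB.
    apply: (Sol_pred (fr := ([:: CE; CE], [::])) (gs := [::])) => //.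
    by rewrite size_fields /=; lia.
  apply: (Sol_pred (fr := ([:: CE; CM c; CE], [::])) (gs := [::])) => //.
  - by case: (c); in_rules.
  - by rewrite size_fields /=; lia.
rewrite [size (b :: k)]/= expnS => hz hB.
have p := expn_gt0 2 (size k); rewrite /= in p.
set x := take (2 ^ size k) z; set y := drop (2 ^ size k) z.
have exy : z = x ++ y by rewrite cat_take_drop.
have sx : size x <= 2 ^ size k by rewrite size_take; case: ltnP; lia.
have sy : size y <= 2 ^ size k by rewrite size_drop; lia.
have sz : size x + size y = size z by rewrite exy size_cat.
apply: (Sol_le (a := (3 * 2 ^ size k - 2 + (3 * 2 ^ size k - 2)).+2)); first lia.
apply: (Sol_pred (fr := ([::], [:: (hp M N (Some PLenS), [:: FM b; FC; FS])]))
    (gs := [:: GF (Some PLenS) [:: k; x; y]])) => //.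
- by case: (b); in_rules.
- split=> //; exists [:: k; x; y] => //=; split=> //.
  by exists [:: x; y] => //; exists x, y, [::].
- by rewrite size_fields /=; lia.
apply/Sols1.
apply: (Sol_pred (fr := ([::], [:: (hp M N (Some PLen), [:: FC; FC; FD]); (hp M N (Some PLen), [:: FC; FD; FC])]))
    (gs := [:: GF (Some PLen) [:: k; x]; GF (Some PLen) [:: k; y]])) => //.
- exact: mem_head.
- split; first by exists [:: k; x] => //=; exists [:: x] => //; exists [::].
  split=> //; exists [:: k; y] => //=; exists [:: y] => //; by exists [::].
- by rewrite size_fields /=; lia.
by apply: Sols2 (ih x _ _) (ih y _ _) _ => //; lia.
Qed.

Variables (W QI : nat).
Hypothesis WB : size kap + size bet + 5 * W + 10 <= B.
Hypothesis query_in : forall s, size s <= 2 ^ size kap -> A s -> Sol QI (GF (Some PIn) [:: s]).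
Hypothesis kapW : 2 ^ size kap <= W.

(** The cost of one element of the chain: comparison with its predecessor, difference from [s],
    length, and membership in [A]. *)
Definition elem_cost := 2 * W + 3 * 2 ^ size kap + QI + 3.

(** The recurrence of [Len_Sol], two halves and two rules, now starting from [elem_cost]. *)
Lemma Ch_Sol b t l s : size l = 2 ^ size b -> path wlt t l -> size t <= W -> size s <= W ->
  size b <= size bet ->
  (forall x, x \in l -> good A kap s x) -> Sol (2 ^ size b * (elem_cost + 2) - 2)
    (GF (Some PCh) [:: b; t; last t l; s]).
Proof.
have p k : 0 < 2 ^ k by rewrite expn_gt0.
elim: b t l => [|c b ih] t l; last first.
  rewrite [size (c :: b)]/= expnS => sl pl st ss sb hl.
  set l1 := take (2 ^ size b) l; set l2 := drop (2 ^ size b) l.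
  have el : l = l1 ++ l2 by rewrite cat_take_drop.
  have s1 : size l1 = 2 ^ size b by rewrite size_takel // sl; lia.
  have s2 : size l2 = 2 ^ size b by rewrite size_drop sl; lia.
  have h1 x : x \in l1 -> good A kap s x by move=> hx; apply: hl; rewrite el mem_cat hx.
  have h2 x : x \in l2 -> good A kap s x by move=> hx; apply: hl; rewrite el mem_cat hx orbT.
  move: pl; rewrite el cat_path last_cat => /andP[p1 p2].
  set m := last t l1 in p2 *.
  have sm : size m <= W.
    have : m \in l1 by rewrite /m; case: (l1) s1 (p (size b)) => [<-|x r _ _] //=; apply: mem_last.
    by move=> /h1[_ h _]; lia.
  have su : size (last m l2) <= W.
    have : last m l2 \in l2 by case: (l2) s2 (p (size b)) => [<-|x r _ _] //=; apply: mem_last.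
    by move=> /h2[_ h _]; lia.
  have hs := Sols2 (ih t l1 s1 p1 st ss (ltnW sb) h1) (ih m l2 s2 p2 sm ss (ltnW sb) h2) (leqnn _).
  rewrite /= in sb.
  have ge2 : 2 <= 2 ^ size b * (elem_cost + 2) by rewrite -[2]mul1n leq_mul // addn2.
  apply: (Sol_le (a := (2 ^ size b * (elem_cost + 2) - 2 + (2 ^ size b * (elem_cost + 2) - 2)).+2)); first lia.
  apply: (Sol_pred (fr := ([::], [:: (hp M N (Some PChS), [:: FM c; FC; FC; FG; FC; FC])]))
    (gs := [:: GF (Some PChS) [:: b; t; m; last m l2; s]])) => //.
  - by case: (c); in_rules.
  - split=> //; exists [:: b; t; m; last m l2; s] => //=; split=> //.
    exists [:: t; m; last m l2; s] => //; exists [:: m; last m l2; s] => //.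
    exists m, [:: last m l2; s]; split=> //; exists [:: s] => //; by exists [::].
  - by rewrite size_fields /=; lia.
  apply/Sols1.
  apply: (Sol_pred (fr := ([::], [:: (hp M N (Some PCh), [:: FC; FC; FC; FD; FC]);
                   (hp M N (Some PCh), [:: FC; FD; FC; FC; FC])]))
    (gs := [:: GF (Some PCh) [:: b; t; m; s]; GF (Some PCh) [:: b; m; last m l2; s]])) => //.
  - exact: mem_head.
  - split; first exists [:: b; t; m; s] => //=.
      by exists [:: t; m; s] => //; exists [:: m; s] => //; exists [:: s] => //; exists [::].
    split=> //; exists [:: b; m; last m l2; s] => //=.
    by exists [:: m; last m l2; s] => //; exists [:: last m l2; s] => //; exists [:: s] => //; exists [::].
  by rewrite size_fields /=; lia.
rewrite expn0; case: l => [|u [|? ?]] //= _; rewrite andbT => tu st ss _ hl.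
have [Au su us] := hl u (mem_head _ _).
apply: (Sol_le (a := ((size t).+1 + ((size u).+1 + (3 * 2 ^ size kap - 2 + QI))).+1)).
  by rewrite /elem_cost; lia.
apply: (Sol_pred (fr := ([::], [:: (hp M N (Some PLt), [:: FE; FC; FC]); (hp M N (Some PNeq), [:: FE; FD; FC; FC]);
                   (hp M N (Some PLen), [:: FE; FK kap; FD; FC]); (hp M N (Some PIn), [:: FE; FD; FC])]))
  (gs := [:: GF (Some PLt) [:: t; u]; GF (Some PNeq) [:: u; s]; GF (Some PLen) [:: kap; u]; GF (Some PIn) [:: u]])) => //.
- by in_rules.
- split; first by exists [:: t; u] => //=; exists [:: u] => //; exists [::].
  split; first by exists [:: u; s] => //=; exists [:: s] => //; exists [::].
  split; first by exists [:: kap; u] => //=; exists [:: u] => //; exists [::].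
  by split=> //; exists [:: u] => //=; exists [::].
- by rewrite size_fields /=; lia.
exists (size t).+1, ((size u).+1 + (3 * 2 ^ size kap - 2 + QI)); split=> //.
  by apply: Lt_Sol => //; lia.
exists (size u).+1, (3 * 2 ^ size kap - 2 + QI); split=> //.
  by apply: Neq_Sol => //; lia.
by apply: Sols2 (Len_Sol su _) (query_in su Au) _ => //; lia.
Qed.
End Completeness.

Lemma cat_nseqS T (x : seq T) n a : x ++ nseq n.+1 a = rcons (x ++ nseq n a) a.
Proof. by rewrite -addn1 nseqD catA cats1. Qed.

Section Completeness.
Variables (M : ntm) (N : oracle_ntm) (A : language) (kap bet : seq bool) (B : nat).
Notation Sol := (@Sol M N kap bet B).
Notation GF := (GF M N).

Ltac in_rules := rewrite /= !inE eqxx ?orbT.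

Section Chain.
Variables (W QI : nat).
Hypothesis WB : size kap + size bet + 5 * W + 10 <= B.
Hypothesis query_in : forall s, size s <= 2 ^ size kap -> A s -> Sol QI (GF (Some PIn) [:: s]).
Hypothesis kapW : 2 ^ size kap <= W.
Notation elem_cost := (elem_cost kap W QI).

(** The chain is cut along the binary digits of its length: a digit [true] followed by [k] digits
    takes a complete segment of [2 ^ k] words, and the costs add up geometrically. *)
Lemma D_Sol b t l s : size l = bval b -> path wlt t l -> size t <= W -> size s <= W ->
  size b <= size bet ->
  (forall x, x \in l -> good A kap s x) -> Sol (2 ^ size b * (elem_cost + 2))
    (GF (Some PD) [:: b; t; s]).
Proof.
have p k : 0 < 2 ^ k by rewrite expn_gt0.
elim: b t l => [|c b ih] t l.
  move=> _ _ st ss _ _; apply: (Sol_le (a := 1)); first by rewrite expn0 /elem_cost; lia.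
  apply: (Sol_pred (fr := ([:: CE], [::])) (gs := [::])) => //.
  by rewrite size_fields /=; lia.
rewrite [size (c :: b)]/= => sl pl st ss sb hl.
have ge2 : 2 <= 2 ^ size b * (elem_cost + 2) by rewrite -[2]mul1n leq_mul // addn2.
rewrite expnS -mulnA mul2n -addnn.
case: c sl => /= [|sl]; last first.
  have {}ih := ih t l sl pl st ss (ltnW sb) hl.
  apply: (Sol_le (a := (2 ^ size b * (elem_cost + 2)).+1)); first lia.
  apply: (Sol_pred (fr := ([::], [:: (hp M N (Some PD), [:: FM false; FC; FC; FC])]))
    (gs := [:: GF (Some PD) [:: b; t; s]])) => //.
  - by in_rules.
  - split=> //; exists [:: b; t; s] => //=; split=> //.
    by exists [:: t; s] => //; exists [:: s] => //; exists [::].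
  - by rewrite size_fields /=; lia.
  exact: Sols1.
rewrite mul1n => sl.
set l1 := take (2 ^ size b) l; set l2 := drop (2 ^ size b) l.
have el : l = l1 ++ l2 by rewrite cat_take_drop.
have s1 : size l1 = 2 ^ size b by rewrite size_takel // sl; lia.
have s2 : size l2 = bval b by rewrite size_drop sl; lia.
have h1 x : x \in l1 -> good A kap s x by move=> hx; apply: hl; rewrite el mem_cat hx.
have h2 x : x \in l2 -> good A kap s x by move=> hx; apply: hl; rewrite el mem_cat hx orbT.
move: pl; rewrite el cat_path => /andP[p1 p2].
have hC := Ch_Sol WB query_in kapW s1 p1 st ss (ltnW sb) h1.
set m := last t l1 in p2 hC.
have sm : size m <= W.
  have : m \in l1 by rewrite /m; case: (l1) s1 (p (size b)) => [<-|x r _ _] //=; apply: mem_last.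
  by move=> /h1[_ h _]; lia.
have {}ih := ih m l2 s2 p2 sm ss (ltnW sb) h2.
apply: (Sol_le (a := (2 ^ size b * (elem_cost + 2) - 2 + 2 ^ size b * (elem_cost + 2)).+2)); first lia.
apply: (Sol_pred (fr := ([::], [:: (hp M N (Some PD1), [:: FM true; FC; FC; FG; FC])]))
    (gs := [:: GF (Some PD1) [:: b; t; m; s]])) => //.
- by in_rules.
- split=> //; exists [:: b; t; m; s] => //=; split=> //.
  exists [:: t; m; s] => //; exists [:: m; s] => //.
  exists m, [:: s]; split=> //; by exists [::].
- by rewrite size_fields /=; lia.
apply/Sols1.
apply: (Sol_pred (fr := ([::], [:: (hp M N (Some PCh), [:: FC; FC; FC; FC]);
      (hp M N (Some PD), [:: FC; FD; FC; FC])]))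
    (gs := [:: GF (Some PCh) [:: b; t; m; s]; GF (Some PD) [:: b; m; s]])) => //.
- exact: mem_head.
- split; first exists [:: b; t; m; s] => //=.
    by exists [:: t; m; s] => //; exists [:: m; s] => //; exists [:: s] => //; exists [::].
  split=> //; exists [:: b; m; s] => //=.
  by exists [:: m; s] => //; exists [:: s] => //; exists [::].
- by rewrite size_fields /=; lia.
exact: Sols2 hC ih (leqnn _).
Qed.

Lemma chain_Not_Sol l s : size l = bval bet -> path wlt [::] l ->
  (forall x, x \in l -> A x /\ size x <= 2 ^ size kap) ->
  ~ A s -> s != [::] -> size s <= 2 ^ size kap ->
  Sol (elem_cost + 2 ^ size bet * (elem_cost + 2)) (GF (Some PNot) [:: s]).
Proof.
move=> sl pl hl nA s0 ss.
have hg x : x \in l -> good A kap s x.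
  by move=> /hl[Ax sx]; split=> //; apply/eqP => e; rewrite e in Ax.
apply: (Sol_le (a := (1 + (3 * 2 ^ size kap - 2 + 2 ^ size bet * (elem_cost + 2))).+1)).
  by rewrite /elem_cost; lia.
apply: (Sol_pred (fr := ([::], [:: (hp M N (Some PLt), [:: FK [::]; FC]); (hp M N (Some PLen), [:: FK kap; FC]);
                   (hp M N (Some PD), [:: FK bet; FK [::]; FC])]))
  (gs := [:: GF (Some PLt) [:: [::]; s]; GF (Some PLen) [:: kap; s]; GF (Some PD) [:: bet; [::]; s]])) => //.
- by in_rules.
- split; first by exists [:: [::]; s] => //=; exists [:: s] => //; exists [::].
  split; first by exists [:: kap; s] => //=; exists [:: s] => //; exists [::].
  split=> //; exists [:: bet; [::]; s] => //=; exists [:: [::]; s] => //.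
  by exists [:: s] => //; exists [::].
- by rewrite size_fields /=; lia.
exists 1, (3 * 2 ^ size kap - 2 + 2 ^ size bet * (elem_cost + 2)); split=> //.
  by apply: (@Lt_Sol M N kap bet B [::]); [case: (s) s0|rewrite /=; lia].
apply: Sols2 (leqnn _); first by apply: Len_Sol => //; lia.
by apply: (D_Sol (l := l)) => //; lia.
Qed.
End Chain.

Lemma strip_Sol n u J : size u + J + 4 <= B -> Sol n (GN M false (init N (rcons u true))) ->
  Sol (n + J).+1 (GF (Some PStrip) [:: rcons u true ++ nseq J false]).
Proof.
move=> hB hn; elim: J hB => [|J ih] hB.
  rewrite cats0 addn0.
  apply: (Sol_pred (fr := ([::], [:: (@hN M N false (start N), init_ops N (FL true [:: true]))]))
    (gs := [:: GN M false (init N (rcons u true))])) => //.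
  - by in_rules.
  - split=> //; eexists; last exact: init_ops_lastE.
    by rewrite /= init_letters.
  - by rewrite size_fields /= size_rcons; lia.
  exact: Sols1.
rewrite addnS.
apply: (Sol_pred (fr := ([::], [:: (hp M N (Some PStrip), [:: FL false [::]])]))
    (gs := [:: GF (Some PStrip) [:: rcons u true ++ nseq J false]])) => //.
- exact: mem_head.
- split=> //; exists [:: rcons u true ++ nseq J false] => //.
  exists (rcons u true ++ nseq J false), [::]; rewrite !cats0; split=> //.
  by rewrite cat_nseqS.
- by rewrite size_fields /= size_cat size_rcons /= size_nseq; lia.
by apply/Sols1/ih; lia.
Qed.

Lemma raw_reject_Sol n u J : size u + J + 5 <= B -> Sol n (GN M false (init N (rcons u true))) ->
  Sol (n + J).+2 (GF None [:: rcons u true ++ nseq J.+1 false]).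
Proof.
move=> hB hn.
apply: (Sol_pred (fr := ([::], [:: (hp M N (Some PStrip), [:: FL false [::]])]))
    (gs := [:: GF (Some PStrip) [:: rcons u true ++ nseq J false]])) => //.
- by in_rules.
- split=> //; exists [:: rcons u true ++ nseq J false] => //.
  exists (rcons u true ++ nseq J false), [::]; rewrite !cats0; split=> //.
  by rewrite cat_nseqS.
- by rewrite size_fields /= size_cat size_rcons /= size_nseq; lia.
by apply/Sols1/strip_Sol => //; lia.
Qed.

(** [i.+1] zeros are already written and [J] are still to be guessed; the induction is on the
    latter. *)
Lemma pad_Sol n x i J : size x + i + J + 4 <= B ->
  Sol n (GN M true (init N (x ++ nseq (i + J).+1 false))) ->
  Sol (n + J).+1 (GF (Some PPad) [:: x ++ nseq i.+1 false]).
Proof.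
elim: J i => [|J ih] i hB hn.
  rewrite !addn0 in hn *.
  apply: (Sol_pred (fr := ([::], [:: (@hN M N true (start N), init_ops N FC)]))
    (gs := [:: GN M true (init N (x ++ nseq i.+1 false))])) => //.
  - by in_rules.
  - split=> //; eexists; last exact: init_opsE.
    by rewrite /= init_letters.
  - by rewrite size_fields /= size_cat /= size_nseq; lia.
  exact: Sols1.
rewrite addnS.
apply: (Sol_pred (fr := ([::], [:: (hp M N (Some PPad), [:: FL false [:: false; false]])]))
    (gs := [:: GF (Some PPad) [:: x ++ nseq i.+2 false]])) => //.
- exact: mem_head.
- split=> //; exists [:: x ++ nseq i.+2 false] => //.
  exists (x ++ nseq i false), [::]; split=> //.
    by rewrite cat_nseqS.
  by rewrite -catA -[[:: false; false]]/(nseq 2 false) -nseqD addn2.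
- by rewrite size_fields /= size_cat /= size_nseq; lia.
by apply/Sols1/ih; rewrite ?addSnnS //; lia.
Qed.

Lemma raw_accept_Sol n u J : size u + J + 6 <= B ->
  Sol n (GN M true (init N (rcons u true ++ nseq J.+1 false))) ->
  Sol (n + J).+2 (GF None [:: rcons u true]).
Proof.
move=> hB hn.
apply: (Sol_pred (fr := ([::], [:: (hp M N (Some PPad), [:: FL true [:: true; false]])]))
    (gs := [:: GF (Some PPad) [:: rcons u true ++ nseq 1 false]])) => //.
- exact: mem_head.
- split=> //; exists [:: rcons u true ++ nseq 1 false] => //.
  by exists u, [::]; split=> //; rewrite -cats1 -catA.
- by rewrite size_fields /= size_rcons; lia.
by apply/Sols1/pad_Sol; rewrite ?size_rcons ?add0n //; lia.
Qed.
End Completeness.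

(** * Polynomial estimates *)

(** The base is at least 2, so constants and sums are absorbed by the exponent for every [n],
    including 0. *)
Definition poly_bounded (f : nat -> nat) := exists e, forall n, f n <= (n + 2) ^ e.

Lemma leq_pow n e e' : e <= e' -> (n + 2) ^ e <= (n + 2) ^ e'.
Proof. by move=> h; rewrite leq_pexp2l // addn2. Qed.

Lemma leq_pow_base a b e : a <= b -> a ^ e <= b ^ e.
Proof. by case: e => // e h; rewrite leq_exp2r. Qed.

Lemma poly_const c : poly_bounded (fun=> c).
Proof.
exists c => n; apply: leq_trans (_ : 2 ^ c <= _); first exact/ltnW/ltn_expl.
by apply: leq_pow_base; rewrite addn2.
Qed.

Lemma poly_id : poly_bounded id.
Proof. by exists 1 => n; rewrite expn1 leq_addr. Qed.

Lemma poly_mul f g : poly_bounded f -> poly_bounded g -> poly_bounded (fun n => f n * g n).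
Proof. by move=> [e hf] [e' hg]; exists (e + e') => n; rewrite expnD leq_mul. Qed.

Lemma poly_add f g : poly_bounded f -> poly_bounded g -> poly_bounded (fun n => f n + g n).
Proof.
move=> [e hf] [e' hg]; exists (e + e').+1 => n.
have h1 := leq_trans (hf n) (leq_pow n (leq_addr e' e)).
have h2 := leq_trans (hg n) (leq_pow n (leq_addl e e')).
rewrite expnS; apply: leq_trans (_ : 2 * (n + 2) ^ (e + e') <= _); first lia.
by rewrite leq_mul2r addn2 orbT.
Qed.

Lemma poly_exp f k : poly_bounded f -> poly_bounded (fun n => f n ^ k).
Proof.
move=> hf; elim: k => [|k ih]; first exact: poly_const.
case: (poly_mul hf ih) => e h; exists e => n; rewrite expnS; exact: h.
Qed.

Lemma poly_le f g : (forall n, f n <= g n) -> poly_bounded g -> poly_bounded f.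
Proof. by move=> h [e hg]; exists e => n; apply: leq_trans (h n) (hg n). Qed.

Lemma bigO_poly f k : bigO f (fun n => n ^ k) -> poly_bounded f.
Proof.
move=> [C [n0 h]]; set D := \max_(i < n0) f i.
apply: (poly_le (g := fun n => C * n ^ k + D)) => [n|].
  have [hn|hn] := leqP n0 n; first by apply: leq_trans (h n hn) (leq_addr _ _).
  by apply: leq_trans (leq_addl _ _); exact: (leq_bigmax (F := fun i : 'I_n0 => f i) (Ordinal hn)).
apply: poly_add; last exact: poly_const.
by apply: poly_mul; [exact: poly_const|apply: poly_exp; exact: poly_id].
Qed.

Lemma exp_ge_sq n : n ^ 2 <= 2 ^ n.+2.
Proof.
elim: n => // n ih; rewrite expnS.
have [h|h] := leqP n 2; first by case: n h {ih} => [|[|[]]].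
apply: leq_trans (_ : 2 * n ^ 2 <= _); last by rewrite leq_mul2l.
by rewrite -!mulnn; nia.
Qed.

(** With [k] the logarithm of [n + 2], it suffices that [(k + 1) * e < n]. By [exp_ge_sq],
    [(k + 1) ^ 2] is at most [8 * (n + 2)], and the threshold makes [8 * (n + 2) * e ^ 2] smaller
    than [n ^ 2]. *)
Lemma pow_lt_exp e : exists n0, forall n, n0 <= n -> (n + 2) ^ e < 2 ^ n.
Proof.
exists (16 * e.+1 ^ 2)%N => n hn.
set k := trunc_log 2 (n + 2).
have h1 : n + 2 < 2 ^ k.+1 by apply: trunc_log_ltn.
have h2 : 2 ^ k <= n + 2 by apply: trunc_logP => //; rewrite addn2.
apply: leq_ltn_trans (_ : (2 ^ k.+1) ^ e < _); first by apply: leq_pow_base; exact: ltnW.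
rewrite -expnM ltn_exp2l //.
have hk := exp_ge_sq k.+1.
have hk2 : 2 ^ k.+3 = 8 * 2 ^ k by rewrite !expnS; lia.
rewrite ltnNge; apply/negP => hc.
have h3 : n * n <= (k.+1 * e) * (k.+1 * e) by apply: leq_mul.
have h4 : (k.+1 * e) * (k.+1 * e) = k.+1 ^ 2 * (e * e) by ring.
have h5 : k.+1 ^ 2 * (e * e) <= 8 * (n + 2) * (e * e) by apply: leq_mul => //; lia.
have h6 : e.+1 ^ 2 = e * e + 2 * e + 1 by ring.
have h7 : n * (16 * (e * e) + 1) <= n * n by rewrite leq_mul2l; apply/orP; right; lia.
have h8 : n * (16 * (e * e) + 1) = 16 * (n * (e * e)) + n by ring.
have h9 : 8 * (n + 2) * (e * e) = 8 * (n * (e * e)) + 16 * (e * e) by ring.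
have h10 : 16 * (e * e) <= n by lia.
have h11 : 0 < n by lia.
have h12 : 2 * (e * e) <= n * (e * e).
  by rewrite leq_mul2r; apply/orP; right; lia.
lia.
Qed.

Lemma poly_lt_exp f : poly_bounded f -> exists n0, forall n, n0 <= n -> f n < 2 ^ n.
Proof.
move=> [e hf]; have [n0 h] := pow_lt_exp e; exists n0 => n hn.
exact: leq_ltn_trans (hf n) (h n hn).
Qed.

(** The power 5 counts the polynomial factors in [diagonal_long]. As [65 * r] is at most
    [2 ^ (7 + r)], the left side is at most [2 ^ (35 + 6 * r)]. *)
Lemma long_estimate p r J : 20 <= r -> p <= r -> J = 64 * r ->
  (J + r) ^ 5 * 2 ^ p < 2 ^ J.
Proof.
move=> hr hp ->.
have h1 : 64 * r + r <= 2 ^ (7 + r).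
  rewrite expnD; have := ltn_expl r (isT : 1 < 2); rewrite (_ : 2 ^ 7 = 128) //; lia.
apply: leq_ltn_trans (_ : (2 ^ (7 + r)) ^ 5 * 2 ^ r < _).
  by rewrite leq_mul ?leq_pow_base // leq_exp2l.
by rewrite -expnM -expnD ltn_exp2l //; lia.
Qed.

(** * Words of low density *)

Section Census.
Import finmap.

(** Sorted so as to form a chain starting strictly above the empty word, which is therefore left
    out. *)
Definition census_list (A : language) q : seq (seq bool) :=
  sort (fun t u => (t == u) || wlt t u)
    [seq t <- enum_fset (fset_set (upto A q)) | t != [::]].

Lemma mem_upto A q t : t \in enum_fset (fset_set (upto A q)) <-> A t /\ size t <= q.
Proof.
rewrite -[_ \in _]/(t \in fset_set (upto A q)) in_fset_set; last exact: finite_upto.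
by rewrite in_setE; split=> [[]|].
Qed.

Lemma census_mem A q t : t \in census_list A q <-> [/\ A t, size t <= q & t != [::]].
Proof.
rewrite mem_sort mem_filter; split; first by case/andP => -> /mem_upto[].
by case=> h1 h2 ->; apply/mem_upto.
Qed.

Lemma census_uniq A q : uniq (census_list A q).
Proof. by rewrite sort_uniq filter_uniq // fset_uniq. Qed.

Lemma census_path A q : path wlt [::] (census_list A q).
Proof.
rewrite (path_sortedE wlt_trans); apply/andP; split.
  by apply/allP => t /census_mem[_ _]; case: t.
have tr : transitive (fun t u => (t == u) || wlt t u).
  move=> u t v /orP[/eqP -> //|h1] /orP[/eqP <-|h2]; first by rewrite h1 orbT.
  by rewrite (wlt_trans h1 h2) orbT.
have to : total (fun t u => (t == u) || wlt t u).
  move=> t u; have [->|h] := eqVneq t u; first by apply/orP; left; apply/orP; left; apply/eqP.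
  by apply/orP; case/orP: (wlt_total h) => ->; [left|right]; rewrite orbT.
have := sort_sorted to [seq t <- enum_fset (fset_set (upto A q)) | t != [::]].
have := census_uniq A q; rewrite -/(census_list A q) !(sorted_pairwise tr) (sorted_pairwise wlt_trans).
rewrite uniq_pairwise; elim: (census_list A q) => //= t s ih /andP[h1 h2] /andP[h3 h4].
rewrite ih // andbT; apply/allP => u us.
case/orP: (allP h3 u us) => // /eqP tu; by move/eqP: (allP h1 u us).
Qed.

Lemma census_size A q q' : q <= q' -> size (census_list A q) <= density A q'.
Proof.
move=> hq; rewrite /density; apply: uniq_leq_size (census_uniq A q) _ => t.
by move=> /census_mem[h1 h2 _]; apply/mem_upto; split=> //; apply: leq_trans h2 hq.
Qed.

Lemma density_le A q q' : q <= q' -> density A q <= density A q'.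
Proof.
move=> hq; apply: uniq_leq_size (fset_uniq _) _ => t.
by move=> /mem_upto[h1 h2]; apply/mem_upto; split=> //; apply: leq_trans h2 hq.
Qed.

End Census.

Lemma bval_ex h d : d < 2 ^ h -> exists2 b, size b = h & bval b = d.
Proof.
elim: h d => [|h ih] d; first by case: d => // _; exists [::].
rewrite expnS => hd; have [hlt|hge] := ltnP d (2 ^ h).
  by have [b <- e] := ih d hlt; exists (false :: b) => //=; rewrite mul0n.
have [|b sb e] := ih (d - 2 ^ h); first lia.
by exists (true :: b); rewrite /= sb // mul1n e; lia.
Qed.

Section Reals.
Import Order.TTheory GRing.Theory Num.Theory.

Lemma infinite_unbounded (S : set nat) N : infinite_set S -> exists2 m, S m & N <= m.
Proof.
move=> hS; apply: contrapT => h; apply: hS.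
apply: (@sub_finite_set _ _ `I_N); last exact: finite_II.
by move=> m Sm /=; rewrite ltnNge; apply/negP => hm; apply: h; exists m.
Qed.

Lemma powR_root (R : realType) (m h E : nat) : (0 < E)%N -> (m <= h ^ (2 * E))%N ->
  (m%:R `^ (2 * E)%:R^-1 <= h%:R :> R)%R.
Proof.
move=> E0 hm; have E0' : ((2 * E)%:R != 0 :> R)%R by rewrite pnatr_eq0; lia.
apply: le_trans (_ : ((h%:R ^+ (2 * E)) `^ (2 * E)%:R^-1 <= _)%R).
  by apply: ge0_ler_powR; rewrite ?nnegrE ?invr_ge0 ?ler0n ?exprn_ge0 // -natrX ler_nat.
by rewrite -powR_mulrn // -powRrM mulfV // powRr1.
Qed.

(** The hypothesis is used with exponent [1 / (2 * E)], at some large [m]. If [n] is maximal with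
    [(n + 2) ^ E <= m], then [m < (n + 3) ^ E], so [m ^ (1 / (2 * E))] is at most the square root of
    [n + 3]. The factor 2 thus makes [h] of order [sqrt n], below [n / c] for any fixed [c]. *)
Lemma low_density (R : realType) A E c n0 : (0 < E)%N -> nonexponential R (density A) ->
  exists n h, [/\ n0 <= n, c * h <= n & density A ((n + 2) ^ E) < 2 ^ h]%N.
Proof.
(* The term [c * (c + 2)] settles the case [h <= c + 2]; otherwise [c * h <= n] follows from
   [(h - 1) ^ 2 < n + 3]. *)
move=> E0 hA; set n1 := (n0 + c * (c + 2))%N.
have c0 : (0 < (2 * E)%:R^-1 :> R)%R by rewrite invr_gt0 ltr0n; lia.
have [m /= hm hm1] := infinite_unbounded ((n1 + 2) ^ E) (hA _ c0).
have ex : exists n, (n + 2) ^ E <= m by exists n1.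
have bd n : (n + 2) ^ E <= m -> n <= m.
  move=> h; apply: leq_trans (_ : n + 2 <= m); first exact: leq_addr.
  by apply: leq_trans h; rewrite -{1}[n + 2]expn1 leq_pexp2l // addn2.
have [n hn nmax] := ex_maxnP ex bd.
have n1n := nmax _ hm1.
have exh : exists h, n + 3 <= h ^ 2 by exists (n + 3); rewrite -mulnn leq_pmulr // addn3.
have [h hh hmin] := ex_minnP exh.
have mh : m <= h ^ (2 * E).
  rewrite expnM; apply: leq_trans (_ : (n + 3) ^ E <= _); last by rewrite leq_exp2r.
  rewrite leqNgt; apply/negP => hlt; have := nmax n.+1.
  by rewrite addSn -addnS => /(_ (ltnW hlt)); rewrite ltnn.
exists n, h; split; first by apply: leq_trans n1n; rewrite leq_addr.
  case: h hh hmin {mh} => [|k] hh hmin; first by rewrite muln0.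
  have hk : k ^ 2 < n + 3 by rewrite ltnNge; apply/negP => /hmin; rewrite ltnn.
  have [hkc|hkc] := leqP k.+1 (c + 2).
    by apply: leq_trans n1n; apply: leq_trans (leq_addl _ _); rewrite leq_mul2l hkc orbT.
  rewrite -mulnn in hk; have : (c + 2) * k <= k * k by rewrite leq_mul2r; apply/orP; right; lia.
  lia.
apply: leq_ltn_trans (density_le A hn) _; rewrite -(ltr_nat R).
apply: lt_le_trans hm _; rewrite natrX -powR_mulrn //.
by apply: ler_powR; [rewrite ler1n|apply: powR_root].
Qed.
End Reals.

(** * Size of the diagonal program *)

Lemma itoks_cons i s : itoks (i :: s) = item_code i ++ itoks s.
Proof. by []. Qed.

Lemma itoks_cat s t : itoks (s ++ t) = itoks s ++ itoks t.
Proof. by rewrite /itoks map_cat flatten_cat. Qed.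

Lemma size_itoks_bits z : size (itoks (map IE (bits z))) = size z.
Proof. by elim: z => //= b z ih; rewrite /itoks /= -/(itoks _) ih. Qed.

(** Only the rules of [PNot] and [PCh] contain [kap] or [bet], as constants to be emitted; the
    others have a fixed size. *)
Lemma head_rules_size (M : ntm) (N : oracle_ntm) (h : head_name M N) : exists C, forall kap bet,
  size (program [seq headed (hl h) r | r <- head_rules kap bet h]) <= C * (1 + size kap + size bet).
Proof.
have indep (f : seq bool -> seq bool -> nat) : (forall kap bet, f kap bet = f [::] [::]) ->
    exists C, forall kap bet, f kap bet <= C * (1 + size kap + size bet).
  by move=> e; exists (f [::] [::]) => kap bet; rewrite e leq_pmulr.
have lin (f : seq bool -> seq bool -> nat) : (forall kap bet, f kap bet <= f [::] [::] + size kap + size bet) ->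
    exists C, forall kap bet, f kap bet <= C * (1 + size kap + size bet).
  move=> e; exists (f [::] [::]).+1 => kap bet; apply: leq_trans (e _ _) _; nia.
case: h => [[[md [q|q]]|p]|]; try by apply: indep.
have sz := (map_cat, itoks_cat, itoks_cons, size_cat, size_itoks_bits).
case: p; try (by apply: indep); apply: lin => kap bet; rewrite /head_rules /pred_rules.
  move: (hl _) (hM _ _ _) (hp _ _ (Some PLt)) (hp _ _ (Some PLen)) (hp _ _ (Some PD)) => a b c d e.
  rewrite /program /rule_code /premise_code /headed /compile_rule /ops_items /=.
  rewrite /premise_code /= ?sz /=; do ! rewrite ?sz /=; lia.
move: (hl _) (hp _ _ (Some PLt)) (hp _ _ (Some PLen)) (hp _ _ (Some PNeq)) (hp _ _ (Some PIn)) (hp _ _ (Some PChS)) => a b c d e f.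
rewrite /program /rule_code /premise_code /headed /compile_rule /ops_items /=.
rewrite /premise_code /= ?sz /=; do ! rewrite ?sz /=; lia.
Qed.

Lemma prog_size (M : ntm) (N : oracle_ntm) : exists C, forall kap bet : seq bool,
  size (program (prog M N kap bet)) <= C * (1 + size kap + size bet).
Proof.
rewrite /prog; elim: (enum _) => [|h s [C ih]]; first by exists 0.
have [D hD] := head_rules_size h; exists (D + C) => kap bet.
rewrite /= /program map_cat flatten_cat size_cat mulnDl.
by apply: leq_add; [exact: hD|exact: ih].
Qed.

(** * The contradiction *)

Section Bounds.
Variables (M : ntm) (N : oracle_ntm) (e : nat).

Definition run_bound n := (n + 2) ^ e.
(** Bounds the letters of a configuration of [N] on an input of length [n], hence also the length of
    its queries. *)
Definition run_space n := n + (run_bound n).+1 * growth N.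
Definition query_run n := run_bound (run_space n).
Definition query_space n := n + (run_bound n).+1 * growth M.
(** The exponent of 2 that bounds the rejecting tree of [N] on the unpadded word, answers to queries
    included. *)
Definition long_exp n :=
  (branching N + query_run n + 5 + (branching M + 2) * query_run n) * run_bound n.
(** Collects the quantities, other than the padding, that [diagonal_long] compares with it; 64 is
    the factor of [long_estimate]. *)
Definition slack n :=
  long_exp n + n + query_space (run_space n) + run_space n + letter_bound M N + 20.
Definition padding n := 64 * slack n.
Definition padded n := n + padding n + 1.
(** The length of [kap]: the least for which [2 ^ level n] exceeds the length of all queries on the
    padded word. Up to a factor 2 this power stays polynomial. *)
Definition level n := (trunc_log 2 (run_space (padded n))).+1.
Definition radius n := 2 ^ level n.
Definition check_cost n := 5 * radius n + run_bound (radius n) + 5.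
Definition query_cost n :=
  (branching M + 2) ^ run_bound 0 + 2 * check_cost n + run_bound (radius n) + 10.
Definition short_space n :=
  6 * radius n + 2 * n + 20 + query_space (radius n) + run_space (padded n) + padding n.
(** The cost on the short word without its only exponential factor, [2 ^ size bet]. *)
Definition short_cost n := (run_bound (padded n) * query_cost n + padding n + 4) *
  (10 * (n * (letter_bound M N * short_space n).+1)).

Lemma run_bound_mono m n : m <= n -> run_bound m <= run_bound n.
Proof. by move=> h; apply: leq_pow_base; rewrite leq_add2r. Qed.

Lemma poly_S f : poly_bounded f -> poly_bounded (fun n => (f n).+1).
Proof. by move=> h; apply: poly_le (poly_add h (poly_const 1)) => n; rewrite addn1. Qed.

Lemma poly_run f : poly_bounded f -> poly_bounded (fun n => run_bound (f n)).
Proof. by move=> h; apply: poly_exp; apply: poly_add => //; apply: poly_const. Qed.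

Ltac poly := by repeat first [assumption | exact: poly_id | exact: poly_const | apply: poly_run
  | apply: poly_S | apply: poly_add | apply: poly_mul].

Lemma poly_run_space f : poly_bounded f -> poly_bounded (fun n => run_space (f n)).
Proof. move=> h; rewrite /run_space; poly. Qed.

Lemma poly_query_space f : poly_bounded f -> poly_bounded (fun n => query_space (f n)).
Proof. move=> h; rewrite /query_space; poly. Qed.

Lemma poly_padding : poly_bounded padding.
Proof.
have h1 := poly_run_space poly_id; have h2 : poly_bounded query_run by apply: poly_run.
have h3 := poly_query_space h1.
rewrite /padding /slack /long_exp; poly.
Qed.

Lemma poly_padded : poly_bounded padded.
Proof. have h := poly_padding; rewrite /padded; poly. Qed.

Lemma radius_le n : radius n <= 2 * run_space (padded n).
Proof.
rewrite /radius /level expnS leq_mul2l /=; apply: trunc_logP => //.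
by rewrite /run_space /padded; lia.
Qed.

Lemma lt_radius n : run_space (padded n) < radius n.
Proof. exact: trunc_log_ltn. Qed.

Lemma poly_radius : poly_bounded radius.
Proof.
apply: poly_le radius_le _; have := poly_run_space poly_padded; move=> h; poly.
Qed.

Lemma poly_short_cost : poly_bounded short_cost.
Proof.
have h1 := poly_padded; have h2 := poly_padding; have h3 := poly_radius.
have h4 := poly_run_space h1; have h5 := poly_query_space h3.
rewrite /short_cost /short_space /query_cost /check_cost; poly.
Qed.

Lemma long_exp_bound n :
  (branching N + ((query_run n).+2 + ((branching M + 2) ^ query_run n).+1) + 2) ^ run_bound n
    <= 2 ^ long_exp n.
Proof.
rewrite /long_exp expnM; apply: leq_pow_base; rewrite expnD.
set a := _ + 5; set b := (branching M + 2) ^ _.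
have b0 : 0 < b by rewrite expn_gt0 addn2.
have ha : a < 2 ^ a by apply: ltn_expl.
have hb : b <= 2 ^ ((branching M + 2) * query_run n).
  by rewrite expnM; apply: leq_pow_base; apply/ltnW/ltn_expl.
apply: leq_trans (_ : 2 ^ a * b <= _); last by rewrite leq_mul2l hb orbT.
apply: leq_trans (_ : a.+1 * b <= _); last by rewrite leq_mul2r ha orbT.
rewrite /a; nia.
Qed.

End Bounds.

Lemma prog_neq0 M N kap bet : prog M N kap bet != [::].
Proof.
set r := headed (hl (None : head_name M N)) (compile_rule (head ([::], [::]) (pred_rules M N kap bet None))).
suff : r \in prog M N kap bet by case: (prog M N kap bet).
apply/flattenP; exists [seq headed (hl (None : head_name M N)) r | r <- @head_rules M N kap bet None].
  by apply: (map_f (fun h : head_name M N => [seq headed (hl h) r | r <- head_rules kap bet h])); rewrite mem_enum.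
by apply: map_f; exact: mem_head.
Qed.

Lemma raw_goal M N x : goal_letters (GF M N None [:: x]) = raw x.
Proof. by rewrite /raw /= /fields /= cats0. Qed.

Section Diagonal.
Variables (M : ntm) (N : oracle_ntm) (A : language) (e : nat).
Notation run_bound := (run_bound e).
Notation V := (accepted (@step universal)).
Notation nu := (@oracle_step N A).

Hypothesis AM : forall s, A s <-> leads (@step M) (init M s).
Hypothesis VN : forall s, V s <-> leads nu (init N s).
Hypothesis M_run : forall s n c, nsteps (@step M) n (init M s) c -> n <= run_bound (size s).
Hypothesis N_run : forall s n c, nsteps nu n (init N s) c -> n <= run_bound (size s).

Lemma diagonal_sound kap bet u :
  (forall l, uniq l -> (forall x, x \in l -> [/\ A x, size x <= 2 ^ size kap & x != [::]]) ->
    size l <= bval bet) ->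
  (forall J, decode 0 (rcons u true ++ nseq J false) = program (prog M N kap bet)) ->
  ~ V (rcons u true).
Proof.
move=> census dec hV.
have sem y : (exists J, y = rcons u true ++ nseq J false) -> V y -> @psem N A kap None [:: y].
  move=> [J ->] hy; have [m hm] := universal_sound (prog_neq0 M N kap bet) (dec J) hy.
  rewrite -(raw_goal M N) in hm.
  by have [] := solve_sound (gs := [:: GF M N None [:: rcons u true ++ nseq J false]]) AM census hm.
have [|h _] := sem (rcons u true) _ hV; first by exists 0; rewrite cats0.
have [J hJ] := h u erefl.
have hy : V (rcons u true ++ nseq J.+1 false).
  by apply: (VN _).2; move: hJ; rewrite cat_rcons.
have [_ h'] := sem _ (ex_intro _ J.+1 erefl) hy.
by apply: (h' u J erefl); exact: (VN _).1 hV.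
Qed.

Lemma complete_within kap bet B m x :
  decode 0 x = program (prog M N kap bet) -> Sol kap bet B m (GF M N None [:: x]) ->
  (m + 1) * (10 * ((size (program (prog M N kap bet))).+1 * (letter_bound M N * B).+1)) < 2 ^ size x ->
  V x.
Proof.
move=> dec [k km sk] hc; rewrite raw_goal in sk.
apply: (universal_complete (L := letter_bound M N * B) (prog_neq0 M N kap bet) dec (fun g h => h) sk).
by apply: leq_ltn_trans hc; apply: (leq_mul _ (leqnn _)); rewrite addn1.
Qed.

Lemma diagonal_long kap bet u (n := (size u).+1) (y := rcons u true ++ nseq (padding M N e n).+1 false) :
  size (program (prog M N kap bet)) < n -> decode 0 y = program (prog M N kap bet) ->
  ~ V (rcons u true) -> V y.
Proof.
move=> szP dec nV; set J := padding M N e n in y dec *.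
set S1 := run_space N e n; set SM := query_space M e S1; set fq := run_bound S1.
pose B := SM + S1 + n + J + 6.
have szx : size (rcons u true) = n by rewrite size_rcons.
have run_s s : size s <= S1 -> forall k c, nsteps (@step M) k (init M s) c -> k <= fq.
  by move=> hs k c /M_run h; apply: leq_trans h (run_bound_mono e hs).
have SMB : SM < B by rewrite /B; lia.
have S1B : S1 < B by rewrite /B; lia.
have space (s : seq bool) : size s <= S1 -> size s + fq.+1 * growth M <= SM by rewrite /SM /query_space leq_add2r.
pose QL := fq.+2 + ((branching M + 2) ^ fq).+1.
have hin s : size s <= S1 -> A s -> Sol kap bet B QL (GF M N (Some PIn) [:: s]).
  move=> hs As; apply: (Sol_le (a := fq.+2)); first by rewrite leq_addr.
  exact: (In_Sol N kap bet AM SMB (run_s s hs) As (space s hs)).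
have hnot s : size s <= S1 -> ~ A s -> Sol kap bet B QL (GF M N (Some PNot) [:: s]).
  move=> hs As; apply: (Sol_le (a := ((branching M + 2) ^ fq).+1)); first by rewrite leq_addl.
  exact: (Not_Sol N kap bet AM SMB (run_s s hs) As (space s hs)).
have nl : ~ leads nu (init N (rcons u true)) by move=> h; apply: nV; exact: (VN _).2 h.
have rx k c : nsteps nu k (init N (rcons u true)) c -> k <= run_bound n by move/N_run; rewrite szx.
have := GN_reject (kap := kap) (bet := bet) S1B hin hnot rx nl.
rewrite size_init szx => sx.
have {}sx := raw_reject_Sol (J := J) (_ : size u + J + 5 <= B) (sx _).
apply: (complete_within dec (sx _ _)).
- by rewrite /B /n; lia.
- by rewrite /S1 /run_space mulSn addnA.
have hX := long_exp_bound M N e n; rewrite -/fq -/S1 -/(query_run N e n) in hX.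
set r := slack M N e n.
have er : r = long_exp M N e n + n + SM + S1 + letter_bound M N + 20 by [].
have est := @long_estimate (long_exp M N e n) r J (_ : 20 <= r) (_ : _ <= r) erefl.
have {est}: (J + r) ^ 5 * 2 ^ long_exp M N e n < 2 ^ J by apply: est; rewrite er; lia.
have p0 : 0 < 2 ^ long_exp M N e n by rewrite expn_gt0.
move: (2 ^ long_exp M N e n) p0 hX => P p0 hX est.
apply: leq_ltn_trans (leq_trans est _); last first.
  by rewrite leq_exp2l // size_cat size_nseq; lia.
(* The four factors of the cost: rule applications, the constant, the program and the goals. They
   are bounded by powers 1, 1, 1 and 2 of [J + r]; only the first has the exponential factor [P]. *)
have a1 : (((branching N + QL + 2) ^ run_bound n + J).+2 + 1) <= (J + r) * P.
  apply: leq_trans (_ : (J + 4) * P <= _); last by rewrite leq_mul2r; apply/orP; right; lia.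
  have : J * 1 <= J * P by rewrite leq_mul2l p0 orbT.
  have : (branching N + QL + 2) ^ run_bound n <= P by exact: hX.
  by move: (_ ^ run_bound n) => X; rewrite mulnDl; lia.
have a2 : 10 <= J + r by rewrite er; lia.
have a3 : (size (program (prog M N kap bet))).+1 <= J + r by rewrite er; lia.
have a4 : (letter_bound M N * B).+1 <= (J + r) * (J + r).
  apply: leq_trans (_ : (letter_bound M N).+1 * B.+1 <= _); first by rewrite mulSn mulnS; lia.
  by apply: leq_mul; rewrite er /B; lia.
have := leq_mul a1 (leq_mul a2 (leq_mul a3 a4)).
by have -> : (J + r) * P * ((J + r) * ((J + r) * ((J + r) * (J + r)))) = (J + r) ^ 5 * P by ring.
Qed.

Lemma diagonal_short kap bet u (n := (size u).+1) :
  size kap = level M N e n -> size (census_list A (2 ^ size kap)) = bval bet ->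
  size bet * 2 <= n -> short_cost M N e n ^ 2 < 2 ^ n ->
  size (program (prog M N kap bet)) < n -> decode 0 (rcons u true) = program (prog M N kap bet) ->
  V (rcons u true ++ nseq (padding M N e n).+1 false) -> V (rcons u true).
Proof.
move=> szk szl szb small szP dec /VN[m [c [hm hc]]]; set J := padding M N e n in hm *.
set q := 2 ^ size kap in szl *; have eq : q = radius M N e n by rewrite /q szk.
set L := padded M N e n; set S2 := run_space N e L; set SM := query_space M e q.
set fq := run_bound q; pose B := short_space M N e n.
have eB : B = 6 * q + 2 * n + 20 + SM + S2 + J by rewrite /SM eq.
have kq : size kap < q by apply: ltn_expl.
have szy : size (rcons u true ++ nseq J.+1 false) = L.
  by rewrite size_cat size_rcons size_nseq -/n /L /padded -/J addn1 addnS.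
have S2q : S2 < q by rewrite eq; exact: lt_radius.
have run_s s f : size s <= f -> forall k c, nsteps (@step M) k (init M s) c -> k <= run_bound f.
  by move=> hs k c' /M_run h; apply: leq_trans h (run_bound_mono e hs).
have SMB : SM < B by rewrite eB; lia.
have S2B : S2 < B by rewrite eB; lia.
have hin s : size s <= q -> A s -> Sol kap bet B fq.+2 (GF M N (Some PIn) [:: s]).
  move=> hs As; apply: (In_Sol N kap bet AM SMB (run_s s _ hs) As).
  by rewrite /SM /query_space leq_add2r.
have WB : size kap + size bet + 5 * q + 10 <= B by rewrite eB; lia.
set E := elem_cost kap q fq.+2.
have eE : E = check_cost M N e n by rewrite /E /elem_cost -/q /check_cost -eq -/fq; lia.
pose Q := fq.+2 + (((branching M + 2) ^ run_bound 0).+1 + (E + 2 ^ size bet * (E + 2))).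
have hin' s : size s <= S2 -> A s -> Sol kap bet B Q (GF M N (Some PIn) [:: s]).
  move=> hs As; apply: (Sol_le (a := fq.+2)); first by rewrite leq_addr.
  by apply: hin => //; lia.
have hnot s : size s <= S2 -> ~ A s -> Sol kap bet B Q (GF M N (Some PNot) [:: s]).
  (* Chains can only refute nonempty words. On the empty one all paths of [M] are searched, at a
     constant cost. *)
  move=> hs As; have [s0|s0] := eqVneq s [::].
    apply: (Sol_le (a := ((branching M + 2) ^ run_bound 0).+1)); first by rewrite /Q; lia.
    apply: (Not_Sol N kap bet AM SMB (run_s s 0 _) As); first by rewrite s0.
    rewrite s0 /SM /query_space; apply: leq_trans (leq_addl _ _).
    by rewrite leq_mul2r ltnS (run_bound_mono e) // orbT.
  apply: (Sol_le (a := E + 2 ^ size bet * (E + 2))); first by rewrite /Q; lia.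
  apply: (chain_Not_Sol WB hin (leqnn _) szl (census_path A q)) => //; last by rewrite -/q; lia.
  by move=> x /census_mem[].
have mL : m <= run_bound L by rewrite -szy; exact: N_run hm.
have space : L + growth N + m * growth N <= S2.
  by rewrite -addnA -mulSn /S2 /run_space leq_add2l leq_mul2r ltnS mL orbT.
have := GN_accept (kap := kap) (bet := bet) S2B hin' hnot hm hc.
rewrite size_init szy => /(_ space) sx.
have hB : size u + J + 6 <= B by rewrite eB /n; lia.
apply: (complete_within dec (raw_accept_Sol hB sx)).
rewrite size_rcons -/n; set T := short_cost M N e n in small *; set G := query_cost M N e n.
have eT : T = (run_bound L * G + J + 4) * (10 * (n * (letter_bound M N * B).+1)) by [].
have eG : G = (branching M + 2) ^ run_bound 0 + 2 * E + fq + 10 by rewrite eE /fq eq.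
have h0 : 0 < 2 ^ size bet by rewrite expn_gt0.
(* With [H] for [2 ^ size bet], the bounds [H ^ 2 <= 2 ^ n] and [T ^ 2 < 2 ^ n] will give
   [H * T < 2 ^ n]. *)
have hH : (2 ^ size bet) ^ 2 <= 2 ^ n by rewrite -expnM leq_exp2l.
move: (2 ^ size bet) h0 hH @Q hin' hnot sx => H h0 hH Q _ _ _.
have QG : Q.+1 <= H * G.
  rewrite eG /Q; move: (_ ^ run_bound 0) => b.
  have : 1 * (b + E + fq + 8) <= H * (b + E + fq + 8) by rewrite leq_mul2r h0 orbT.
  by move: (E) (fq) => E' fq'; lia.
have a1 : (m * Q.+1 + 1 + J).+2 + 1 <= H * (run_bound L * G + J + 4).
  have h1 := leq_mul mL QG; have h2 : 1 * (J + 4) <= H * (J + 4) by rewrite leq_mul2r h0 orbT.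
  have -> : H * (run_bound L * G + J + 4) = run_bound L * (H * G) + H * (J + 4) by ring.
  by move: (m * Q.+1) (run_bound L * (H * G)) (H * (J + 4)) h1 h2 => x y z; lia.
apply: leq_ltn_trans (_ : H * T < _).
  by rewrite eT [H * (_ * _)]mulnA; apply: leq_mul a1 (leq_mul (leqnn _) (leq_mul szP (leqnn _))).
rewrite -(@ltn_exp2r _ _ 2) // expnMn.
apply: leq_ltn_trans (_ : 2 ^ n * T ^ 2 < _); first by rewrite leq_mul2r hH orbT.
by rewrite -[ltnRHS]mulnn ltn_mul2l small andbT expn_gt0.
Qed.

End Diagonal.

(** Three times the length of the program code is at most [K + size kap * K + K * h], so at most
    [K + 2 * n]. This leaves room for more than [ntok] ones, which fill the word up to length [n],
    the last of them being that of [rcons u true]. *)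
Lemma diagonal_input M N C K kap bet h n :
  size (program (prog M N kap bet)) <= C * (1 + size kap + size bet) -> size bet = h ->
  (ntok + 1) * (C + 1) * 3 <= K -> size kap * K <= n -> K * h <= n -> K + 3 * ntok + 4 <= n ->
  size (program (prog M N kap bet)) < n /\ exists2 u, (size u).+1 = n &
    forall J, decode 0 (rcons u true ++ nseq J false) = program (prog M N kap bet).
Proof.
move: (program _) => P szP sb hK hk hh hn.
set T := ntok in hK hn *; set s := 1 + size kap + size bet in szP.
have hD : (T + 1) * (C + 1) * s * 3 <= K * s.
  by rewrite mulnAC leq_mul2r hK orbT.
have hs : K * s = K + size kap * K + K * h by rewrite /s sb; ring.
have e1 : (T + 1) * (C + 1) * s = T * (C * s) + T * s + C * s + s by ring.
have s0 : 0 < s by [].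
have h1 : size P * T <= T * (C * s) by rewrite mulnC leq_mul2l szP orbT.
have hpw := leq_trans (size_program_word P) h1.
split; first lia.
exists (program_word P ++ nseq (n - (size (program_word P)).+1) true).
  by rewrite size_cat size_nseq; lia.
move=> J; rewrite -cat_nseqS -catA; apply: decode_word; rewrite -/T; lia.
Qed.

Local Open Scope classical_set_scope.

Theorem theorem2 (R : realType) : ~ (NE `<=` NP_T (NP `&` NEXPD R)).
Proof.
move=> incl; have [A [NPA dA] [N [[kN [fN [ON runN]]] accN]]] := incl _ universal_NE.
have [kM _ [M [fM [OM runM accM]]]] := NPA.
have [eM hM] := bigO_poly OM; have [eN hN] := bigO_poly ON; set e := (eM + eN)%N.
have M_run s n c : nsteps (@step M) n (init M s) c -> (n <= run_bound e (size s))%N.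
  by move=> /runM h; apply: leq_trans h (leq_trans (hM _) (leq_pow _ (leq_addr _ _))).
have N_run s n c : nsteps (@oracle_step N A) n (init N s) c -> (n <= run_bound e (size s))%N.
  by move=> /runN h; apply: leq_trans h (leq_trans (hN _) (leq_pow _ (leq_addl _ _))).
have AM s : A s <-> leads (@step M) (init M s) by rewrite -accM.
have VN s : accepted (@step universal) s <-> leads (@oracle_step N A) (init N s).
  by rewrite -accN.
have [E hE] := poly_radius M N e; have [C hC] := prog_size M N.
(* The [+ 2] provides [2 * size bet <= n], the rest is what [diagonal_input] asks for. *)
set K := ((ntok + 1) * (C + 1) * 3 + 2)%N.
have [n1 hn1] := poly_lt_exp (poly_exp 2 (poly_short_cost M N e)).
(* As the radius is [2 ^ size kap], this will give [size kap * K <= n]. *)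
have [n2 hn2] := poly_lt_exp (poly_exp K (poly_radius M N e)).
have [n [h [n0n hh low]]] := low_density K (n1 + n2 + K + 3 * ntok + 4) (ltn0Sn E) dA.
set kap := nseq (level M N e n) true.
have szk : size kap = level M N e n by rewrite size_nseq.
have qE : (2 ^ size kap <= (n + 2) ^ E.+1)%N.
  by rewrite szk; apply: leq_trans (hE n) (leq_pow _ (leqnSn _)).
have [bet szb eb] := bval_ex (leq_ltn_trans (census_size A qE) low).
have kK : (size kap * K <= n)%N.
  rewrite szk -(@leq_exp2l 2) // expnM; apply/ltnW/hn2; lia.
have [||szP [u szu dec]] := diagonal_input (hC kap bet) szb _ kK hh _.
- by rewrite /K leq_addr.
- by lia.
have dec0 := dec 0; rewrite cats0 in dec0.
have hb : (size bet * 2 <= n)%N.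
  apply: leq_trans hh; rewrite szb mulnC leq_mul2r; apply/orP; right; rewrite /K; lia.
have small : (short_cost M N e n ^ 2 < 2 ^ n)%N by apply: hn1; lia.
subst n; have nV := diagonal_sound AM VN _ dec.
have nV' : ~ accepted (@step universal) (rcons u true).
  apply: nV => l ul hl; rewrite eb; apply: uniq_leq_size ul _ => x /hl hx; exact/census_mem.
apply: (nV'); apply: (diagonal_short AM VN M_run N_run szk (esym eb) hb small szP dec0).
exact: (diagonal_long AM VN M_run N_run szP (dec _) nV').
Qed.
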